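(* Let $\omega_{\rm o}>0$, $c_0,c_1>0$, $0<z_{\rm int}<z_{\rm obs}$, $\varepsilon>0$, $\gamma\in\mathbb{R}$, $s_j=1/c_j$. Let $V$ be a random field on $\mathbb{R}^2$ that is mean-zero, stationary, isotropic, bounded, rapidly mixing, and smooth with bounded second-order derivatives, and let $\Psi:\mathbb{R}^2\to\mathbb{C}$ be smooth and rapidly decaying. Let $\mathcal{I}_{\rm mf}$ be the matched field imaging functional defined in the context. Then for every $\mathbf{y}\in\mathbb{R}^2$, $$\mathbb{E}\left[\mathcal{I}_{\rm mf}(\mathbf{y})\right]=\phi_V\big(\omega_{\rm o}(s_0-s_1)\big)\,\Psi(\mathbf{y}),$$ where $\phi_V(\tau)=\mathbb{E}[e^{i\tau V(\mathbf{0})}]$.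
   Context: Parameters: $\omega_{\rm o}>0$ (frequency), $c_0,c_1>0$ (wave speeds to the left and right of the interface), $s_j=c_j^{-1}$, $0<z_{\rm int}<z_{\rm obs}$. Integrals are over $\mathbb{R}^2$ for each vector variable. Fourier transform: $\hat f(\mathbf{k})=\int f(\mathbf{x})e^{-i\mathbf{k}\cdot\mathbf{x}}d\mathbf{x}$. ''Smooth and rapidly decaying'' means Schwartz class. The random field $V:\mathbb{R}^2\to\mathbb{R}$: stationary means its law is translation invariant, isotropic means its law is rotation invariant, rapidly mixing means that its restrictions to two regions become asymptotically independent, rapidly, as the distance between the regions tends to infinity. Paraxial propagators: $\hat G_j(\omega,\mathbf{k},z)=\exp\left(-i\frac{z c_j|\mathbf{k}|^2}{2\omega}\right)$, $j=0,1$. Scattering operator (kernel understood in the sense of distributions): $$\mathfrak{K}^\varepsilon(\tau,\mathbf{k},\mathbf{k}')=\frac{1}{(2\pi)^2}\int e^{i(\mathbf{k}'-\mathbf{k})\cdot\mathbf{x}}e^{i\tau V(\mathbf{x}/\varepsilon^{\gamma-1/2})}d\mathbf{x},$$ so that $\int\mathfrak{K}^\varepsilon(\tau,\mathbf{k},\mathbf{k}')\hat f(\mathbf{k}')d\mathbf{k}'$ is the Fourier transform of $\mathbf{x}\mapsto e^{i\tau V(\mathbf{x}/\varepsilon^{\gamma-1/2})}f(\mathbf{x})$. Observed field: $$U^\varepsilon_{\rm obs}(\mathbf{x})=\frac{1}{(2\pi)^2}\iint e^{i\mathbf{k}\cdot\mathbf{x}}\,\mathfrak{K}^\varepsilon\big(\omega_{\rm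 o}(s_0-s_1),\mathbf{k},\mathbf{k}'\big)\hat G_1(\omega_{\rm o},\mathbf{k},z_{\rm obs}-z_{\rm int})\hat G_0(\omega_{\rm o},\mathbf{k}',z_{\rm int})\hat\Psi(\mathbf{k}')\,d\mathbf{k}'d\mathbf{k}.$$ Matched field template (oscillatory integral): $$U_{\rm mf}(\mathbf{x};\mathbf{y})=\frac{1}{(2\pi)^2}\int\hat G_1(\omega_{\rm o},\mathbf{k},z_{\rm obs}-z_{\rm int})\hat G_0(\omega_{\rm o},\mathbf{k},z_{\rm int})e^{i\mathbf{k}\cdot(\mathbf{x}-\mathbf{y})}d\mathbf{k}.$$ Imaging functional: $\mathcal{I}_{\rm mf}(\mathbf{y})=\int U^\varepsilon_{\rm obs}(\mathbf{x})\overline{U_{\rm mf}(\mathbf{x};\mathbf{y})}\,d\mathbf{x}$. *)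

(* Defs.v *)
From HB Require Import structures.
From mathcomp Require Import all_boot all_order all_algebra.
From mathcomp Require Import complex.
From mathcomp Require Import all_classical all_reals all_analysis.

Set Implicit Arguments.
Unset Strict Implicit.
Unset Printing Implicit Defensive.

Import Order.TTheory GRing.Theory Num.Theory.
Import numFieldNormedType.Exports.

Local Open Scope classical_set_scope.
Local Open Scope ring_scope.
Local Open Scope complex_scope.

Notation plane R := (R * R)%type.

Section Analysis.
Context {R : realType}.
Implicit Types (x k : plane R) (f g : plane R -> R[i]) (u : plane R -> R).

Definition dotp k x : R := k.1 * x.1 + k.2 * x.2.
Definition sqnorm x : R := dotp x x.
Definition enorm x : R := Num.sqrt (sqnorm x).

(* The normed space structure of [plane R] is the sup norm; it is only used
   through its topology and directional derivatives. *)
Definition dir (b : bool) : plane R := if b then (0, 1) else (1, 0).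
Definition partial (s : seq bool) u : plane R -> R :=
  foldr (fun b v => 'D_(dir b) v) u s.

Definition smooth u : Prop :=
  forall s : seq bool, continuous (partial s u) /\
    forall (b : bool) x, derivable (partial s u) x (dir b).

Definition bounded_by (M : R) u : Prop := forall x, `|u x| <= M.

Definition schwartz u : Prop :=
  smooth u /\
  forall (a b : nat) (s : seq bool),
    exists M, bounded_by M (fun x => x.1 ^+ a * x.2 ^+ b * partial s u x).

Definition cschwartz f : Prop :=
  schwartz (fun x => complex.Re (f x)) /\ schwartz (fun x => complex.Im (f x)).

Definition expi (t : R) : R[i] := cos t +i* sin t.

Definition cint f : R[i] :=
  Rintegral (lebesgue_measure \x lebesgue_measure)%E setT
    (fun x => complex.Re (f x))
  +i* Rintegral (lebesgue_measure \x lebesgue_measure)%E setT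
    (fun x => complex.Im (f x)).

Definition fourier f k : R[i] := cint (fun x => f x * expi (- dotp k x)).
Definition inv_fourier f x : R[i] :=
  (((2 * pi) ^+ 2)^-1)%:C * cint (fun k => expi (dotp k x) * f k).

(* Oscillatory integral (Abel summation): the limit of the absolutely
   convergent integrals obtained with a Gaussian cutoff that tends to 1.
   For non-degenerate quadratic phases any other Schwartz cutoff equal to 1 at
   the origin gives the same value, whereas sharp cutoffs on discs do not
   converge. *)
Definition damped_cint f (delta : R) : R[i] :=
  cint (fun k => (expR (- (delta * sqnorm k)))%:C * f k).
Definition osc_cint f : R[i] :=
  lim (complex.Re (damped_cint f delta) @[delta --> 0^'+])
  +i* lim (complex.Im (damped_cint f delta) @[delta --> 0^'+]).

End Analysis.

Section RandomFields.
Context {R : realType} {d : measure_display} {T : measurableType d}.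
Variable P : probability T R.
Implicit Types V W : plane R -> T -> R.

Definition cexpectation (X : T -> R[i]) : R[i] :=
  fine (expectation P (fun w => complex.Re (X w)))
  +i* fine (expectation P (fun w => complex.Im (X w))).

Definition cylinders : set (set (plane R -> R)) :=
  [set C | exists x (B : set R), measurable B /\ C = [set v | B (v x)]].

Definition field_law V (C : set (plane R -> R)) : \bar R :=
  P [set w | C (fun x => V x w)].

Definition same_law V W : Prop :=
  forall C, <<s cylinders >> C -> field_law V C = field_law W C.

Definition rotation (theta : R) (x : plane R) : plane R :=
  (cos theta * x.1 - sin theta * x.2, sin theta * x.1 + cos theta * x.2).

Definition mean_zero V : Prop := forall x, expectation P (V x) = 0%E.
Definition stationary V : Prop :=
  forall h : plane R, same_law (fun x => V (x + h)) V.
Definition isotropic V : Prop :=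
  forall theta : R, same_law (fun x => V (rotation theta x)) V.

Definition sigma_restr V (A : set (plane R)) : set (set T) :=
  <<s [set E | exists x (B : set R),
         [/\ A x, measurable B & E = V x @^-1` B]] >>.

(* Strong (alpha-) mixing coefficient of the field for regions at distance at
   least r. *)
Definition mixing_coef V (r : R) : R :=
  sup [set a : R | exists (A B : set (plane R)) (E F : set T),
    [/\ forall x y, A x -> B y -> r <= enorm (x - y),
        sigma_restr V A E, sigma_restr V B F &
        a = `|fine (P (E `&` F)) - fine (P E) * fine (P F)| ]].

Definition rapidly_mixing V : Prop :=
  forall n : nat, r ^+ n * mixing_coef V r @[r --> +oo] --> (0 : R).

Definition bounded_field V : Prop :=
  exists M : R, {ae P, forall w, bounded_by M (fun x => V x w)}.

Definition smooth_field V : Prop :=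
  {ae P, forall w, smooth (fun x => V x w)}.

Definition bounded_second_derivatives V : Prop :=
  exists M : R, {ae P, forall w (s : seq bool),
    size s = 2%N -> bounded_by M (partial s (fun x => V x w))}.

Definition char_fun V (tau : R) : R[i] :=
  cexpectation (fun w => expi (tau * V 0 w)).

End RandomFields.

Section Imaging.
Context {R : realType}.
Variables omega c0 c1 zint zobs eps gamma : R.

Definition propagator (c : R) (k : plane R) (z : R) : R[i] :=
  expi (- (z * c * sqnorm k / (2 * omega))).

(* The operator with distributional kernel K(tau, k, k'), that is
   [scattering v tau g k] is the pairing of K(tau, k, .) with g: integrating
   first in k' gives the Fourier transform of
   x |-> exp(i tau v(x / eps^(gamma - 1/2))) (inv_fourier g)(x).
   Here v is a realization of the random field. *)
Definition scattering (v : plane R -> R) (tau : R) (g : plane R -> R[i]) :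
    plane R -> R[i] :=
  fourier (fun x => expi (tau * v ((eps `^ (gamma - 2^-1))^-1 *: x))
                    * inv_fourier g x).

Definition U_obs (v : plane R -> R) (Psi : plane R -> R[i]) :
    plane R -> R[i] :=
  inv_fourier (fun k =>
    propagator c1 k (zobs - zint) *
    scattering v (omega * (c0^-1 - c1^-1))
      (fun k' => propagator c0 k' zint * fourier Psi k') k).

Definition U_mf (x y : plane R) : R[i] :=
  (((2 * pi) ^+ 2)^-1)%:C *
  osc_cint (fun k => propagator c1 k (zobs - zint) * propagator c0 k zint
                     * expi (dotp k (x - y))).

Definition I_mf (v : plane R -> R) (Psi : plane R -> R[i]) (y : plane R) :
    R[i] :=
  cint (fun x => U_obs v Psi x * (U_mf x y)^*).

End Imaging.

(* Main.v *)
Require Import Defs.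
From HB Require Import structures.
From mathcomp Require Import all_boot all_order all_algebra.
From mathcomp Require Import complex.
From mathcomp Require Import all_classical all_reals all_analysis.
From mathcomp Require Import measurable_realfun.
From mathcomp Require Import ring lra.

Import Order.TTheory GRing.Theory Num.Theory.
Import numFieldNormedType.Exports.

Local Open Scope classical_set_scope.
Local Open Scope ring_scope.
Local Open Scope complex_scope.

Set Implicit Arguments.
Unset Strict Implicit.
Unset Printing Implicit Defensive.

(**
Write [a0 = zint c0 / (2 omega)], [a1 = (zobs - zint) c1 / (2 omega)], let [u]
be the field incident on the interface and [A] the random phase factor of
modulus one, so that the transmitted field is [A u].  A paraxial propagator
[exp(- i a |k|^2)] with [a > 0] acts in space as convolution with the chirp
[exp(i |x|^2 / (4 a)) / (4 pi i a)]; expanding the square, this is a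
multiplication by a chirp followed by a Fourier transform.  The template is the
chirp with parameter [a0 + a1], so imaging amounts to integrating a Fourier
transform against a chirp, and the propagation [a1] cancels: for almost every
realization the image at [y] is the integral of [A u] against the conjugate
chirp with parameter [a0] centred at [y].  Only [A] is random there, and by
stationarity its expectation is the constant [phi_V(tau)].  What remains is the
back-propagation of [u] itself, which is [Psi y] by Fourier inversion.

All integrals converge absolutely because the Fourier transform of a chirp times
[A u] is integrable.  Second derivatives of the medium are just enough for this:
if [h], [d1 h], [d2 h] and [d1 d2 h] decay, then [(1 + i k1) (1 + i k2)] times
the Fourier transform of [h] is square integrable by Bessel's inequality, and
[1 / ((1 + k1^2) (1 + k2^2))] is integrable.  The identities for chirps are
limits of those for complex Gaussians, whose integrals are obtained from linear
differential equations in their parameters.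
*)

(** * Complex-valued integrals *)

Section ComplexAlgebra.
Context {R : realType}.
Implicit Types z w : R[i].

(** Two obstacles shape the argument. The template has constant modulus in [x], and so does its
    integrand in [k], so integrals over positions and wavevectors cannot be exchanged directly. The
    exchange is made under a Gaussian damping, where both factors decay, and the damping is then
    removed by dominated convergence. The damped kernels stay uniformly bounded as long as the chirp
    parameter is nonzero; without a chirp they form an approximate identity, and a Lipschitz
    estimate takes the place of domination.

    The second obstacle is measurability in the outcome. The field is a random variable at each
    point, and its realizations are regular only outside a null set. Joint measurability comes from
    continuity along coordinate lines, after the field has been set to zero on that null set. The
    image has a known formula only off the null set; it is compared with the modified integral
    because changing an arbitrary function on a measurable null set leaves its integral
    unchanged. *)

Lemma creD z w : complex.Re (z + w) = complex.Re z + complex.Re w.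
Proof. by case: z w => [? ?] [? ?]. Qed.
Lemma cimD z w : complex.Im (z + w) = complex.Im z + complex.Im w.
Proof. by case: z w => [? ?] [? ?]. Qed.
Lemma creM z w : complex.Re (z * w) =
  complex.Re z * complex.Re w - complex.Im z * complex.Im w.
Proof. by case: z w => [? ?] [? ?]. Qed.
Lemma cimM z w : complex.Im (z * w) =
  complex.Re z * complex.Im w + complex.Im z * complex.Re w.
Proof. by case: z w => [? ?] [? ?]. Qed.
Lemma creN z : complex.Re (- z) = - complex.Re z. Proof. by case: z. Qed.
Lemma cimN z : complex.Im (- z) = - complex.Im z. Proof. by case: z. Qed.
Lemma cre_conj z : complex.Re (conjc z) = complex.Re z. Proof. by case: z. Qed.
Lemma cim_conj z : complex.Im (conjc z) = - complex.Im z. Proof. by case: z. Qed.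

Definition ReImE := (creD, cimD, creM, cimM, creN, cimN, cre_conj, cim_conj).

Lemma complex_eqP z w :
  complex.Re z = complex.Re w -> complex.Im z = complex.Im w -> z = w.
Proof. by case: z w => [? ?] [? ?] /= -> ->. Qed.

(** The sum norm is real-valued, subadditive and submultiplicative and bounds both coordinates, so
    no square root has to be handled. The price is the constant 2 in [cabs_expi]. *)
Definition cabs z : R := `|complex.Re z| + `|complex.Im z|.

Lemma cabs_ge0 z : 0 <= cabs z. Proof. by rewrite addr_ge0. Qed.
Lemma Re_cabs z : `|complex.Re z| <= cabs z. Proof. by rewrite lerDl. Qed.
Lemma Im_cabs z : `|complex.Im z| <= cabs z. Proof. by rewrite lerDr. Qed.
Lemma cabsD z w : cabs (z + w) <= cabs z + cabs w.
Proof. by rewrite /cabs creD cimD addrACA lerD// ler_normD. Qed.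
Lemma cabsN z : cabs (- z) = cabs z.
Proof. by rewrite /cabs creN cimN !normrN. Qed.
Lemma cabsM z w : cabs (z * w) <= cabs z * cabs w.
Proof.
rewrite /cabs creM cimM mulrDl !mulrDr -!normrM.
apply: (le_trans (lerD (ler_normB _ _) (ler_normD _ _))).
by rewrite le_eqVlt; apply/orP; left; apply/eqP; ring.
Qed.
Lemma cabs_real (r : R) : cabs r%:C = `|r|.
Proof. by rewrite /cabs/= normr0 addr0. Qed.
Lemma cabs_conj z : cabs (conjc z) = cabs z.
Proof. by rewrite /cabs cre_conj cim_conj normrN. Qed.
Lemma cabsZ (r : R) z : cabs (r%:C * z) = `|r| * cabs z.
Proof. by rewrite /cabs creM cimM/= !mul0r subr0 addr0 !normrM mulrDr. Qed.

Lemma expiD (s t : R) : expi (s + t) = expi s * expi t.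
Proof.
by apply: complex_eqP; rewrite !ReImE /= (cosD, sinD)//; ring.
Qed.
Lemma expi0 : expi (0 : R) = 1.
Proof. by rewrite /expi cos0 sin0. Qed.
Lemma expiN (t : R) : expi (- t) = conjc (expi t).
Proof. by rewrite /expi cosN sinN. Qed.
Lemma cabs_expi (t : R) : cabs (expi t) <= 2.
Proof.
rewrite /cabs/=; apply: (@le_trans _ _ (1 + 1)); last by rewrite -natr1.
by apply: lerD; rewrite ler_norml (cos_geN1, sin_geN1) (cos_le1, sin_le1).
Qed.
Lemma expi_mulC (t : R) : expi t * expi (- t) = 1.
Proof. by rewrite -expiD subrr expi0. Qed.

Lemma realCM (r s : R) : (r * s)%:C = r%:C * s%:C :> R[i].
Proof. by rewrite rmorphM. Qed.
End ComplexAlgebra.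

(** * Limits of complex-valued functions, coordinate by coordinate *)

Section ComplexLimit.
Context {R : realType} {X : Type} (F : set_system X).

Definition ccvg (u : X -> R[i]) (l : R[i]) :=
  (fun n => complex.Re (u n)) @ F --> complex.Re l /\
  (fun n => complex.Im (u n)) @ F --> complex.Im l.

Lemma ccvg_unique {FF : ProperFilter F} u l l' : ccvg u l -> ccvg u l' -> l = l'.
Proof.
move=> [a b] [a' b']; apply: complex_eqP.
  exact: (cvg_unique _ a a').
exact: (cvg_unique _ b b').
Qed.

Lemma ccvg_cst {FF : Filter F} l : ccvg (fun _ => l) l.
Proof. by split; exact: cvg_cst. Qed.

Lemma ccvgM {FF : Filter F} u l v m :
  ccvg u l -> ccvg v m -> ccvg (fun n => u n * v n) (l * m).
Proof.
move=> [a b] [a' b']; split.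
  under eq_fun do rewrite creM; rewrite creM.
  by apply: cvgB; exact: cvgM.
under eq_fun do rewrite cimM; rewrite cimM.
by apply: cvgD; exact: cvgM.
Qed.

Lemma ccvgD {FF : Filter F} u l v m :
  ccvg u l -> ccvg v m -> ccvg (fun n => u n + v n) (l + m).
Proof.
move=> [a b] [a' b']; split.
  by under eq_fun do rewrite creD; rewrite creD; exact: cvgD.
by under eq_fun do rewrite cimD; rewrite cimD; exact: cvgD.
Qed.

Lemma ccvg_real {FF : Filter F} (u : X -> R) (l : R) :
  u @ F --> l -> ccvg (fun n => (u n)%:C) l%:C.
Proof. by move=> ul; split => //=; exact: cvg_cst. Qed.

Lemma ccvg_expi {FF : Filter F} (u : X -> R) (l : R) :
  u @ F --> l -> ccvg (fun n => expi (u n)) (expi l).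
Proof.
move=> ul; split => /=.
  by apply: (cvg_comp u cos ul); exact: continuous_cos.
by apply: (cvg_comp u sin ul); exact: continuous_sin.
Qed.
End ComplexLimit.

Section ComplexIntegral.
Context {R : realType}.

Definition cmeas {d} {T : measurableType d} (f : T -> R[i]) :=
  measurable_fun setT (fun x => complex.Re (f x)) /\
  measurable_fun setT (fun x => complex.Im (f x)).

Section measurability.
Context {d} {T : measurableType d}.
Implicit Types f g : T -> R[i].

Lemma cmeasD f g : cmeas f -> cmeas g -> cmeas (fun x => f x + g x).
Proof.
move=> [f1 f2] [g1 g2]; split.
  by under eq_fun do rewrite creD; exact: measurable_funD.
by under eq_fun do rewrite cimD; exact: measurable_funD.
Qed.

Lemma cmeasM f g : cmeas f -> cmeas g -> cmeas (fun x => f x * g x).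
Proof.
move=> [f1 f2] [g1 g2]; split.
  under eq_fun do rewrite creM.
  by apply: measurable_funB; exact: measurable_funM.
under eq_fun do rewrite cimM.
by apply: measurable_funD; exact: measurable_funM.
Qed.

Lemma cmeas_cst c : cmeas (fun _ : T => c : R[i]).
Proof. by split; exact: measurable_cst. Qed.

Lemma cmeas_conj f : cmeas f -> cmeas (fun x => conjc (f x)).
Proof.
move=> [f1 f2]; split; first by under eq_fun do rewrite cre_conj.
by under eq_fun do rewrite cim_conj; exact: measurableT_comp.
Qed.

Lemma cmeas_real (u : T -> R) : measurable_fun setT u -> cmeas (fun x => (u x)%:C).
Proof. by move=> mu; split=> //=. Qed.

Lemma cmeas_expi (u : T -> R) : measurable_fun setT u -> cmeas (fun x => expi (u x)).
Proof.
move=> mu; split => /=; apply: measurableT_comp => //.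
  by apply: continuous_measurable_fun; exact: continuous_cos.
by apply: continuous_measurable_fun; exact: continuous_sin.
Qed.
End measurability.

Lemma cmeas_comp {d d'} {T : measurableType d} {T' : measurableType d'}
  (f : T -> R[i]) (h : T' -> T) :
  cmeas f -> measurable_fun setT h -> cmeas (fun x => f (h x)).
Proof. by move=> [f1 f2] mh; split;
  [exact: (measurableT_comp f1 mh)|exact: (measurableT_comp f2 mh)]. Qed.

Context {d} {T : measurableType d} (mu : {measure set T -> \bar R}).
Implicit Types f g : T -> R[i].

(** Convertible with [cint] at the product Lebesgue measure, and equal to [cexpectation] at a
    probability, so that one set of lemmas serves both. *)
Definition cI f : R[i] :=
  Rintegral mu setT (fun x => complex.Re (f x))
  +i* Rintegral mu setT (fun x => complex.Im (f x)).

Definition cintegrable f :=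
  mu.-integrable setT (EFin \o (fun x => complex.Re (f x))) /\
  mu.-integrable setT (EFin \o (fun x => complex.Im (f x))).

Lemma eq_cI f g : f =1 g -> cI f = cI g.
Proof. by move=> /funext ->. Qed.

Lemma cintegrable_meas f : cintegrable f -> cmeas f.
Proof.
by move=> [/measurable_int/measurable_EFinP ? /measurable_int/measurable_EFinP].
Qed.

Lemma integrable_domR (u v : T -> R) : measurable_fun setT u ->
  mu.-integrable setT (EFin \o v) -> (forall x, `|u x| <= v x) ->
  mu.-integrable setT (EFin \o u).
Proof.
move=> mu_ iv uv; apply: le_integrable iv => //; first exact/measurable_EFinP.
by move=> x _ /=; rewrite lee_fin (le_trans (uv x))// ler_norm.
Qed.

Lemma cintegrable_dom f (g : T -> R) : cmeas f ->
  mu.-integrable setT (EFin \o g) -> (forall x, cabs (f x) <= g x) ->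
  cintegrable f.
Proof.
move=> [f1 f2] ig fg; split; apply: (integrable_domR _ ig) => // x;
  apply: le_trans (fg x); [exact: Re_cabs|exact: Im_cabs].
Qed.

Lemma integrable_cabs f : cintegrable f ->
  mu.-integrable setT (EFin \o (fun x => cabs (f x))).
Proof.
move=> [f1 f2]; rewrite /cabs.
have -> : EFin \o (fun x => `|complex.Re (f x)| + `|complex.Im (f x)|) =
  (abse \o (EFin \o (fun x => complex.Re (f x)))) \+
  (abse \o (EFin \o (fun x => complex.Im (f x)))) by [].
by apply: integrableD => //; exact: integrable_abse.
Qed.

Lemma cintegrableD f g : cintegrable f -> cintegrable g ->
  cintegrable (fun x => f x + g x).
Proof.
move=> [f1 f2] [g1 g2]; split.
  by under eq_fun do rewrite creD; have := integrableD measurableT f1 g1.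
by under eq_fun do rewrite cimD; have := integrableD measurableT f2 g2.
Qed.

Lemma cintegrableMl f (g : T -> R[i]) (C : R) : cmeas g ->
  (forall x, cabs (g x) <= C) -> cintegrable f ->
  cintegrable (fun x => g x * f x).
Proof.
move=> mg gC fi.
apply: (@cintegrable_dom _ (fun x => C * cabs (f x))).
- by apply: cmeasM => //; exact: cintegrable_meas.
- have := integrableZl measurableT C (integrable_cabs fi).
  by under eq_fun do rewrite -EFinM.
- move=> x; apply: (le_trans (cabsM _ _)).
  by rewrite ler_wpM2r// cabs_ge0.
Qed.

Lemma cintegrableZ c f : cintegrable f -> cintegrable (fun x => c * f x).
Proof. by apply: cintegrableMl => //; exact: cmeas_cst. Qed.

Lemma cID f g : cintegrable f -> cintegrable g ->
  cI (fun x => f x + g x) = cI f + cI g.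
Proof.
move=> [f1 f2] [g1 g2]; apply: complex_eqP; rewrite !ReImE/=.
  by under eq_Rintegral do rewrite creD; rewrite RintegralD.
by under eq_Rintegral do rewrite cimD; rewrite RintegralD.
Qed.

Let iZ (r : R) (u : T -> R) : mu.-integrable setT (EFin \o u) ->
  mu.-integrable setT (EFin \o (fun x => r * u x)).
Proof.
move=> iu; have := integrableZl measurableT r iu.
by under eq_fun do rewrite -EFinM.
Qed.

Lemma cIZ c f : cintegrable f -> cI (fun x => c * f x) = c * cI f.
Proof.
move=> [f1 f2]; apply: complex_eqP; rewrite !ReImE/=.
  under eq_Rintegral do rewrite creM.
  by rewrite RintegralB// ?RintegralZl//; exact: iZ.
under eq_Rintegral do rewrite cimM.
by rewrite RintegralD// ?RintegralZl//; exact: iZ.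
Qed.

Lemma cI_conj f : cintegrable f -> cI (fun x => conjc (f x)) = conjc (cI f).
Proof.
move=> [f1 f2]; apply: complex_eqP; rewrite !ReImE/=.
  by under eq_Rintegral do rewrite cre_conj.
under eq_Rintegral do rewrite cim_conj -mulN1r.
by rewrite RintegralZl// mulN1r.
Qed.

Lemma cabs_cI_le f : cintegrable f ->
  cabs (cI f) <= Rintegral mu setT (fun x => cabs (f x)).
Proof.
move=> [f1 f2]; rewrite /cabs RintegralD//.
- by apply: lerD; exact: le_normr_Rintegral.
- exact: (integrable_abse f1).
- exact: (integrable_abse f2).
Qed.

Lemma cabs_cI f (g : T -> R) : cmeas f -> mu.-integrable setT (EFin \o g) ->
  (forall x, cabs (f x) <= g x) -> cabs (cI f) <= Rintegral mu setT g.
Proof.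
move=> mf ig fg; have fi := cintegrable_dom mf ig fg.
apply: (le_trans (cabs_cI_le fi)); apply: le_Rintegral => //.
exact: integrable_cabs.
Qed.

Lemma Rintegral_cvg (u : nat -> T -> R) (v g : T -> R) :
  (forall n, measurable_fun setT (u n)) -> measurable_fun setT v ->
  (forall x, u n x @[n --> \oo] --> v x) ->
  mu.-integrable setT (EFin \o g) -> (forall n x, `|u n x| <= g x) ->
  Rintegral mu setT (u n) @[n --> \oo] --> Rintegral mu setT v.
Proof.
move=> mu_ mv uv ig ug; rewrite /Rintegral.
have iv : mu.-integrable setT (EFin \o v).
  apply: (integrable_domR mv ig) => x.
  have : `|u n x| @[n --> \oo] --> `|v x| by apply: cvg_norm; exact: uv.
  move=> /(@closed_cvg _ _ _ eventually_filter _ (fun y => y <= g x)); apply.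
    exact: closed_le.
  by apply: nearW => n; exact: ug.
apply: fine_cvg; rewrite fineK; last exact: integrable_fin_num.
have [|||||_ _] := @dominated_convergence _ _ _ mu _ measurableT
    (fun n => EFin \o u n) (EFin \o v) (EFin \o g).
- by move=> n; exact/measurable_EFinP.
- exact/measurable_EFinP.
- by apply: aeW => x _; apply: cvg_EFin; [exact: nearW|exact: uv].
- exact: ig.
- by apply: aeW => x n _ /=; rewrite lee_fin.
by apply.
Qed.

Lemma cI_cvg (u : nat -> T -> R[i]) f (g : T -> R) :
  (forall n, cmeas (u n)) -> cmeas f ->
  (forall x, ccvg \oo (u ^~ x) (f x)) ->
  mu.-integrable setT (EFin \o g) -> (forall n x, cabs (u n x) <= g x) ->
  ccvg \oo (fun n => cI (u n)) (cI f).
Proof.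
move=> mu_ mf uf ig ug; split => /=.
- apply: (Rintegral_cvg _ _ _ ig) => [n||x|n x];
  [by case: (mu_ n)|by case: mf|by case: (uf x)|].
  by apply: le_trans (ug n x); exact: Re_cabs.
- apply: (Rintegral_cvg _ _ _ ig) => [n||x|n x];
  [by case: (mu_ n)|by case: mf|by case: (uf x)|].
  by apply: le_trans (ug n x); exact: Im_cabs.
Qed.

End ComplexIntegral.

(** * Fubini's theorem for complex integrands *)

Section ComplexFubini.
Context {R : realType} d1 d2 (T1 : measurableType d1) (T2 : measurableType d2).
Variables (m1 : {sigma_finite_measure set T1 -> \bar R}).
Variables (m2 : {sigma_finite_measure set T2 -> \bar R}).

Lemma integrable_tensor (g1 : T1 -> R) (g2 : T2 -> R) :
  (forall x, 0 <= g1 x) -> (forall x, 0 <= g2 x) ->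
  m1.-integrable setT (EFin \o g1) -> m2.-integrable setT (EFin \o g2) ->
  (m1 \x m2)%E.-integrable setT (EFin \o (fun z => g1 z.1 * g2 z.2)).
Proof.
move=> g10 g20 i1 i2.
have mg1 : measurable_fun setT g1 by exact/measurable_EFinP/(measurable_int _ i1).
have mg2 : measurable_fun setT g2 by exact/measurable_EFinP/(measurable_int _ i2).
apply/integrable12ltyP.
  apply/measurable_EFinP/measurable_funM.
    exact: (measurableT_comp mg1).
  exact: (measurableT_comp mg2).
under eq_integral => x _.
  under eq_integral => y _ do rewrite /= ger0_norm ?mulr_ge0// EFinM.
  rewrite integralZl//; over.
have f2 : (\int[m2]_x (g2 x)%:E)%E \is a fin_num by exact: integrable_fin_num.
rewrite -(fineK f2) integralZr// -(fineK (integrable_fin_num _ i1))//.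
by rewrite -EFinM ltry.
Qed.

(** Every slice, not almost every one, is assumed integrable because [Rintegral] applies [fine] to
    the inner integral at each point. A domination by a tensor product guarantees this below. *)
Let RFubini (u : T1 * T2 -> R) :
  (m1 \x m2)%E.-integrable setT (EFin \o u) ->
  (forall x, m2.-integrable setT (EFin \o (fun y => u (x, y)))) ->
  (forall y, m1.-integrable setT (EFin \o (fun x => u (x, y)))) ->
  Rintegral (m1 \x m2)%E setT u =
    Rintegral m1 setT (fun x => Rintegral m2 setT (fun y => u (x, y))) /\
  Rintegral (m1 \x m2)%E setT u =
    Rintegral m2 setT (fun y => Rintegral m1 setT (fun x => u (x, y))).
Proof.
move=> iu iu2 iu1; rewrite /Rintegral; split; congr fine.
  rewrite -(integral12_prod_meas1 iu)/fubini_F/=.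
  by apply: eq_integral => x _; rewrite fineK//; exact: integrable_fin_num (iu2 x).
rewrite -(integral21_prod_meas1 iu)/fubini_G/=.
by apply: eq_integral => x _; rewrite fineK//; exact: integrable_fin_num (iu1 x).
Qed.

Section Dominated.
Variables (F : T1 * T2 -> R[i]) (g1 : T1 -> R) (g2 : T2 -> R).
Hypothesis mF : cmeas F.
Hypotheses (g10 : forall x, 0 <= g1 x) (g20 : forall x, 0 <= g2 x).
Hypothesis ig1 : m1.-integrable setT (EFin \o g1).
Hypothesis ig2 : m2.-integrable setT (EFin \o g2).
Hypothesis Fg : forall x y, cabs (F (x, y)) <= g1 x * g2 y.

Lemma cintegrable_prod : cintegrable (m1 \x m2)%E F.
Proof.
apply: cintegrable_dom mF (integrable_tensor g10 g20 ig1 ig2) _.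
by move=> [x y]; exact: Fg.
Qed.

Lemma cintegrable_slice1 x : cintegrable m2 (fun y => F (x, y)).
Proof.
apply: (@cintegrable_dom _ _ _ m2 _ (fun y => g1 x * g2 y)).
- exact: cmeas_comp mF (measurable_pair1 x).
- by have := integrableZl measurableT (g1 x) ig2; under eq_fun do rewrite -EFinM.
- exact: Fg.
Qed.

Lemma cintegrable_slice2 y : cintegrable m1 (fun x => F (x, y)).
Proof.
apply: (@cintegrable_dom _ _ _ m1 _ (fun x => g2 y * g1 x)).
- exact: cmeas_comp mF (measurable_pair2 y).
- by have := integrableZl measurableT (g2 y) ig1; under eq_fun do rewrite -EFinM.
- by move=> x; rewrite mulrC; exact: Fg.
Qed.

Lemma cI_prod1 : cI (m1 \x m2)%E F = cI m1 (fun x => cI m2 (fun y => F (x, y))).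
Proof.
have [i1 i2] := cintegrable_prod; apply: complex_eqP => /=.
  by apply: (RFubini i1 _ _).1 => x;
    [case: (cintegrable_slice1 x)|case: (cintegrable_slice2 x)].
by apply: (RFubini i2 _ _).1 => x;
  [case: (cintegrable_slice1 x)|case: (cintegrable_slice2 x)].
Qed.

Lemma cI_prod2 : cI (m1 \x m2)%E F = cI m2 (fun y => cI m1 (fun x => F (x, y))).
Proof.
have [i1 i2] := cintegrable_prod; apply: complex_eqP => /=.
  by apply: (RFubini i1 _ _).2 => x;
    [case: (cintegrable_slice1 x)|case: (cintegrable_slice2 x)].
by apply: (RFubini i2 _ _).2 => x;
  [case: (cintegrable_slice1 x)|case: (cintegrable_slice2 x)].
Qed.

Lemma cFubini : cI m1 (fun x => cI m2 (fun y => F (x, y))) =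
                cI m2 (fun y => cI m1 (fun x => F (x, y))).
Proof. by rewrite -cI_prod1 cI_prod2. Qed.

Lemma cmeas_cI2 : cmeas (fun x => cI m2 (fun y => F (x, y))).
Proof.
have [i1 i2] := cintegrable_prod; split => /=.
- apply/measurable_EFinP; have := measurable_fubini_F i1; congr measurable_fun.
  apply/funext => x; rewrite /fubini_F/= /Rintegral fineK//.
  by apply: integrable_fin_num => //; case: (cintegrable_slice1 x).
- apply/measurable_EFinP; have := measurable_fubini_F i2; congr measurable_fun.
  apply/funext => x; rewrite /fubini_F/= /Rintegral fineK//.
  by apply: integrable_fin_num => //; case: (cintegrable_slice1 x).
Qed.
End Dominated.
End ComplexFubini.

(** * Derivatives of complex-valued functions of a real variable, and differentiation under the
    integral *)

Section Derivative.
Context {R : realType}.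

Definition cderive (f : R -> R[i]) (t : R) (l : R[i]) :=
  is_derive t (1 : R) (fun s => complex.Re (f s) : R) (complex.Re l) /\
  is_derive t (1 : R) (fun s => complex.Im (f s) : R) (complex.Im l).

Lemma is_derive1D (u v : R -> R) (t l m : R) : is_derive t (1 : R) u l ->
  is_derive t (1 : R) v m -> is_derive t (1 : R) (fun s => u s + v s) (l + m).
Proof. by move=> du dv; exact: (@is_deriveD _ _ _ u v). Qed.

Lemma is_derive1N (u : R -> R) (t l : R) : is_derive t (1 : R) u l ->
  is_derive t (1 : R) (fun s => - u s) (- l).
Proof. by move=> du; exact: (@is_deriveN _ _ _ u). Qed.

Lemma is_derive1M (u v : R -> R) (t l m : R) : is_derive t (1 : R) u l ->
  is_derive t (1 : R) v m ->
  is_derive t (1 : R) (fun s => u s * v s) (l * v t + u t * m).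
Proof.
move=> du dv; have duv := is_deriveM du dv; apply: (is_derive_eq duv).
by rewrite /GRing.scale/= addrC mulrC.
Qed.

Lemma is_derive1Z (c : R) (u : R -> R) (t l : R) : is_derive t (1 : R) u l ->
  is_derive t (1 : R) (fun s => c * u s) (c * l).
Proof. by move=> du; exact: (is_deriveZ c du). Qed.

Lemma is_derive1_cst (c t : R) : is_derive t (1 : R) (fun _ : R => c) 0.
Proof. exact: is_derive_cst. Qed.

Lemma is_derive1_id (t : R) : is_derive t (1 : R) (fun s : R => s) 1.
Proof. exact: is_derive_id. Qed.

Lemma is_derive1_compose (u v : R -> R) (t l m : R) : is_derive (v t) (1 : R) u l ->
  is_derive t (1 : R) v m -> is_derive t (1 : R) (fun s => u (v s)) (l * m).
Proof.
by move=> du dv; exact: (is_derive1_comp du dv).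
Qed.

Lemma cderive_eq f t l l' : cderive f t l -> l = l' -> cderive f t l'.
Proof. by move=> ? <-. Qed.

Lemma cderive_cst c t : cderive (fun _ => c) t 0.
Proof. by split; exact: is_derive_cst. Qed.

Lemma cderiveD f g t l m : cderive f t l -> cderive g t m ->
  cderive (fun s => f s + g s) t (l + m).
Proof.
move=> [f1 f2] [g1 g2]; split; rewrite ?creD ?cimD.
  by under eq_fun do rewrite creD; exact: is_deriveD.
by under eq_fun do rewrite cimD; exact: is_deriveD.
Qed.

Lemma cderiveM f g t l m : cderive f t l -> cderive g t m ->
  cderive (fun s => f s * g s) t (l * g t + f t * m).
Proof.
move=> [f1 f2] [g1 g2]; split; rewrite !ReImE.
  under eq_fun do rewrite creM.
  apply: (is_derive_eq (is_derive1D (is_derive1M f1 g1) (is_derive1N (is_derive1M f2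
    g2)))).
  by ring.
under eq_fun do rewrite cimM.
apply: (is_derive_eq (is_derive1D (is_derive1M f1 g2) (is_derive1M f2 g1))).
by ring.
Qed.

Lemma cderive_real (u : R -> R) t l : is_derive t (1 : R) u l ->
  cderive (fun s => (u s)%:C) t l%:C.
Proof. by move=> ?; split => //=; exact: is_derive_cst. Qed.

Lemma cderive_expi (u : R -> R) t l : is_derive t (1 : R) u l ->
  cderive (fun s => expi (u s)) t ('i * l%:C * expi (u t)).
Proof.
move=> du; split; rewrite !ReImE/=.
  apply: (is_derive_eq (is_derive1_compose (is_derive_cos _) du)).
  by ring.
apply: (is_derive_eq (is_derive1_compose (is_derive_sin _) du)).
by ring.
Qed.

Lemma cderive_scale f s t l : cderive f (s * t) l ->
  cderive (fun r => f (s * r)) t (s%:C * l).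
Proof.
move=> [f1 f2].
have ds : is_derive t (1 : R) (fun r => s * r : R) s.
  by apply: (is_derive_eq (is_derive1Z s (is_derive_id _ _))); rewrite mulr1.
split; rewrite !ReImE/= ?mul0r ?subr0 ?addr0.
  by apply: (is_derive_eq (is_derive1_compose f1 ds)); ring.
by apply: (is_derive_eq (is_derive1_compose f2 ds)); ring.
Qed.

Lemma cderive_continuous f t l : cderive f t l ->
  {for t, continuous (fun s => complex.Re (f s))} /\
  {for t, continuous (fun s => complex.Im (f s))}.
Proof.
by move=> [[f1 _] [f2 _]]; split; apply/differentiable_continuous/derivable1_diffP.
Qed.

Lemma cderive0_cst f : (forall t, cderive f t 0) -> forall s t, f s = f t.
Proof.
move=> df s t; apply: complex_eqP.
  by apply: (@is_derive_0_is_cst _ (fun s => complex.Re (f s))) => x; case: (df x).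
by apply: (@is_derive_0_is_cst _ (fun s => complex.Im (f s))) => x; case: (df x).
Qed.

Context d (T : measurableType d) (mu : {measure set T -> \bar R}).

Let is_derive_Rint (u u' : R -> T -> R) (G : T -> R) (t : R) :
  (forall s, mu.-integrable setT (EFin \o u s)) ->
  (forall s x, is_derive s (1 : R) (u ^~ x) (u' s x)) ->
  mu.-integrable setT (EFin \o G) ->
  (forall s x, `|s - t| <= 1 -> `|u' s x| <= G x) ->
  is_derive t (1 : R) (fun s => Rintegral mu setT (u s)) (Rintegral mu setT (u' t)).
Proof.
move=> iu du iG uG.
have p1E s x : partial1of2 u s x = u' s x.
  by rewrite partial1of2E; have [_ ->] := du s x.
have It : (`]t - 1, t + 1[%classic : set R) t.
  by rewrite /= in_itv/= ltrBlDr ltrDl ltr01.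
have G0 x : 0 <= G x by apply: le_trans (uG t x _) => //; rewrite subrr normr0.
have bound s x : (`]t - 1, t + 1[%classic : set R) s -> setT x ->
    `|partial1of2 u s x| <= G x.
  rewrite /= in_itv/= => /andP[s1 s2] _; rewrite p1E; apply: uG.
  by rewrite ler_norml lerBrDr lerBlDl; apply/andP; split; apply: ltW => //;
    rewrite addrC.
split.
  apply: (@derivable_under_integral _ _ _ mu _ _ measurableT t (t - 1) (t + 1) It _ _
    G) => //.
rewrite -derive1E (@differentiation_under_integral _ _ _ mu _ _ measurableT t (t - 1)
  (t + 1) It _ _ G) => //.
by apply: eq_Rintegral => x _; rewrite p1E.
Qed.

Lemma cderive_cI (f f' : R -> T -> R[i]) (G : T -> R) t :
  (forall s, cintegrable mu (f s)) ->
  (forall s x, cderive (f ^~ x) s (f' s x)) ->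
  mu.-integrable setT (EFin \o G) ->
  (forall s x, `|s - t| <= 1 -> cabs (f' s x) <= G x) ->
  cderive (fun s => cI mu (f s)) t (cI mu (f' t)).
Proof.
move=> fi df iG fG; split => /=.
  apply: (@is_derive_Rint (fun s x => complex.Re (f s x)) (fun s x =>
    complex.Re (f' s x)) G) => //.
  - by move=> s; case: (fi s).
  - by move=> s x; case: (df s x).
  - by move=> s x /(fG s x); apply: le_trans; exact: Re_cabs.
apply: (@is_derive_Rint (fun s x => complex.Im (f s x)) (fun s x =>
  complex.Im (f' s x)) G) => //.
- by move=> s; case: (fi s).
- by move=> s x; case: (df s x).
- by move=> s x /(fG s x); apply: le_trans; exact: Im_cabs.
Qed.

End Derivative.

(** * Separate continuity and integration by parts *)

Section Caratheodory.
Context {R : realType}.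

Let grid (n : nat) (t : R) : R := (Num.floor (t * n.+1%:R))%:~R / n.+1%:R.

(** Rounding [t] down to a multiple of [1 / (n + 1)] gives a function whose preimages are countable
    unions of measurable rectangles. Continuity in [t] makes these functions converge pointwise to
    [f]. *)
Lemma measurable_caratheodory d (T : measurableType d) (f : R -> T -> R) :
  (forall t, measurable_fun setT (f t)) ->
  (forall w, continuous (f ^~ w)) ->
  measurable_fun [set: measurableTypeR R * T] (fun z => f z.1 z.2).
Proof.
move=> mf cf.
apply: (@measurable_fun_cvg _ _ _ _ (fun n z => f (grid n z.1) z.2)).
  move=> n _ B mB; rewrite setTI.
  rewrite [X in measurable X](_ : _ = \bigcup_(m : int)
    ([set t | Num.floor (t * n.+1%:R) = m] `*` (f (m%:~R / n.+1%:R) @^-1` B))).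
    apply: countable_bigcupT_measurable => [|m]; first exact: countableP.
    apply: measurableX; last by rewrite -[X in measurable X]setTI; exact: mf.
    rewrite (_ : [set t | _] = (fun t => t * n.+1%:R) @^-1` `[m%:~R, (m + 1)%:~R[).
      rewrite -[X in measurable X]setTI.
      have : measurable_fun setT (fun t : R => t * n.+1%:R).
        by apply: measurable_funM => //; exact: measurable_cst.
      by apply => //; exact: measurable_itv.
    apply/seteqP; split => t /=; rewrite in_itv/=.
      by move/eqP; rewrite floor_eq.
    by move=> h; apply/eqP; rewrite floor_eq.
  apply/seteqP; split => [[t w] /= h|[t w] [m _ /= [<-]]//].
  by exists (Num.floor (t * n.+1%:R)).
move=> [t w] _ /=.
apply: (@cvg_comp _ _ _ (fun n => grid n t) (f ^~ w)); last exact: cf.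
apply/cvgrPdist_le => e e0; near=> n.
rewrite distrC.
have n0 : (0 : R) < n.+1%:R by [].
apply: (@le_trans _ _ n.+1%:R^-1).
  rewrite /grid -[X in _ - X](mulfK (lt0r_neq0 n0)) -mulrBl normrM.
  rewrite [X in _ * X]ger0_norm ?invr_ge0// ler_piMl ?invr_ge0//.
  have := floor_itv (t * n.+1%:R); rewrite intrD => /andP[a b].
  by rewrite ler_norml; apply/andP; split; lra.
apply: ltW; near: n; exact: (near_infty_natSinv_lt (PosNum e0)).
Unshelve. all: by end_near. Qed.

(** This yields measurability for the product of the two Borel structures from continuity along
    coordinate lines, which is all that [scont] records. *)
Lemma measurable_sepcont (f : plane R -> R) :
  (forall x2, continuous (fun x1 => f (x1, x2))) ->
  (forall x1, continuous (fun x2 => f (x1, x2))) ->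
  measurable_fun [set: measurableTypeR R * measurableTypeR R] f.
Proof.
move=> c1 c2.
have -> : f = (fun z : measurableTypeR R * measurableTypeR R => (fun a b =>
  f (a, b)) z.1 z.2).
  by apply/funext => -[].
apply: (@measurable_caratheodory _ _ (fun a b => f (a, b))) => // t.
by apply: continuous_measurable_fun; exact: c2.
Qed.

(** The one-variable result is used twice, first in [x2] with parameter [w], then in [x1] with
    parameter [(x2, w)]. It makes the random field jointly measurable in position and outcome, as
    Fubini demands. *)
Lemma measurable_caratheodory2 d (T : measurableType d) (f : plane R -> T -> R) :
  (forall x, measurable_fun setT (f x)) ->
  (forall w x2, continuous (fun x1 => f (x1, x2) w)) ->
  (forall w x1, continuous (fun x2 => f (x1, x2) w)) ->
  measurable_fun [set: T * (measurableTypeR R * measurableTypeR R)]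
    (fun z => f z.2 z.1).
Proof.
move=> mf c1 c2.
have m2 x1 : measurable_fun [set: measurableTypeR R * T] (fun z => f (x1, z.1) z.2).
  by apply: (@measurable_caratheodory _ _ (fun x2 w => f (x1, x2) w)).
have m1 : measurable_fun [set: measurableTypeR R * (measurableTypeR R * T)]
    (fun z => f (z.1, z.2.1) z.2.2).
  apply: (@measurable_caratheodory _ _ (fun x1 z => f (x1, z.1) z.2)) => [x1|[x2 w]].
    exact: m2.
  exact: c1.
have -> : (fun z : T * plane R => f z.2 z.1) =
  (fun z : measurableTypeR R * (measurableTypeR R * T) => f (z.1, z.2.1) z.2.2) \o
  (fun z : T * (measurableTypeR R * measurableTypeR R) => (z.2.1, (z.2.2, z.1))).
  by apply/funext => -[w [x1 x2]].
apply: measurableT_comp => //.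
apply: measurable_fun_pair.
  exact: (measurableT_comp measurable_fst measurable_snd).
apply: measurable_fun_pair; last exact: measurable_fst.
exact: (measurableT_comp measurable_snd measurable_snd).
Qed.

End Caratheodory.

Section OneDim.
Context {R : realType}.
Notation leb := (@lebesgue_measure R).

Lemma integrable_oneDsqrV :
  leb.-integrable setT (EFin \o (fun x : R => (1 + x ^+ 2)^-1)).
Proof.
have c : continuous (fun x : R => (1 + x ^+ 2)^-1) by exact: continuous_oneDsqrV.
have p x : 0 <= (1 + x ^+ 2)^-1 :> R by rewrite invr_ge0 addr_ge0 ?sqr_ge0.
have m : measurable_fun setT (fun x : R => (1 + x ^+ 2)^-1).
  exact: continuous_measurable_fun.
apply/integrableP; split; first exact/measurable_EFinP.
under eq_integral do rewrite /= ger0_norm//.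
rewrite ge0_symfun_integralT//; last by move=> x /=; rewrite sqrrN.
rewrite (_ : [set x | _] = `[0, +oo[%classic); last first.
  by apply/seteqP; split => x/=; rewrite in_itv/= andbT.
by have := @integral0y_oneDsqr R; rewrite /oneDsqr => ->; rewrite -EFinM ltry.
Qed.

Lemma cvg_oneDsqrV (C : R) (q : R -> R) (u : nat -> R) :
  (forall t, `|q t| <= C / (1 + t ^+ 2)) -> (forall n, n%:R <= `|u n|) ->
  q (u n) @[n --> \oo] --> (0 : R).
Proof.
move=> qC un.
have C0 : 0 <= C.
  by have := le_trans (normr_ge0 _) (qC 0); rewrite expr0n/= addr0 divr1.
apply/cvgrPdist_le => e e0; near=> n; rewrite sub0r normrN.
apply: (le_trans (qC _)).
have n1 : C / e <= n%:R by near: n; exact: nbhs_infty_ger.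
rewrite ler_pdivrMr ?ltr_pwDl ?sqr_ge0//.
have h : C <= e * n%:R by rewrite mulrC -ler_pdivrMr.
apply: (le_trans h); apply: (ler_wpM2l (ltW e0)).
apply: (le_trans (un n)); rewrite -(real_normK (num_real (u n))).
have := sqr_ge0 (`|u n| - 1/2); nra.
Unshelve. all: by end_near. Qed.

(** Integrals over growing symmetric intervals are differences of boundary values, which the
    quadratic bound sends to zero. *)
Lemma integral_derive0 (q q' : R -> R) (C : R) :
  (forall t, is_derive t (1 : R) q (q' t)) -> continuous q' ->
  leb.-integrable setT (EFin \o q') ->
  (forall t, `|q t| <= C / (1 + t ^+ 2)) ->
  Rintegral leb setT q' = 0.
Proof.
move=> dq cq' iq' qC.
(* The endpoints start at 1 so that the interval is never degenerate, as [continuous_FTC2]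
   requires. *)
pose I n : set R := `[- n.+1%:R, n.+1%:R]%classic.
have mq : measurable_fun setT q' by exact: continuous_measurable_fun.
have cv : Rintegral leb setT (q' \_ (I n)) @[n --> \oo] --> Rintegral leb setT q'.
  apply: (@Rintegral_cvg _ _ _ leb _ _ (fun t => `|q' t|)) => //.
  - by move=> n; apply: (measurable_restrictT q' (measurable_itv _)).1;
    exact: measurable_funTS.
  - move=> x; apply: cvg_near_cst; near=> n; rewrite /patch mem_set//=.
    rewrite /I/= in_itv/= -ler_norml; apply: (@le_trans _ _ n%:R);
      last by rewrite ler_nat.
    by near: n; exact: nbhs_infty_ger.
  - exact: (integrable_abse iq').
  - by move=> n x; rewrite /patch; case: ifP; rewrite ?normr0.
have ev n : Rintegral leb setT (q' \_ (I n)) = q n.+1%:R - q (- n.+1%:R).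
  rewrite -Rintegral_mkcond /Rintegral (@continuous_FTC2 _ q' q)//.
  - by rewrite (lt_trans (y := 0))// oppr_lt0.
  - exact: continuous_subspaceT.
  - split.
    + by move=> x _; case: (dq x).
    + by apply: cvg_at_right_filter;
      apply/differentiable_continuous/derivable1_diffP; case: (dq (- n.+1%:R)).
    + by apply: cvg_at_left_filter; apply/differentiable_continuous/derivable1_diffP;
      case: (dq n.+1%:R).
  - by move=> x _; rewrite derive1E; case: (dq x).
have : (fun n => q n.+1%:R - q (- n.+1%:R)) @ \oo --> (0 - 0 : R).
  apply: cvgB; apply: (cvg_oneDsqrV qC) => n; rewrite ?normrN ger0_norm ?ler_nat//.
rewrite subr0; under eq_fun do rewrite -ev; move=> h.
exact: (cvg_unique _ cv h).
Unshelve. all: by end_near. Qed.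

Lemma cI_derive0 (f f' : R -> R[i]) (C : R) :
  (forall t, cderive f t (f' t)) ->
  continuous (fun t => complex.Re (f' t)) -> continuous (fun t => complex.Im (f' t)) ->
  cintegrable leb f' -> (forall t, cabs (f t) <= C / (1 + t ^+ 2)) ->
  cI leb f' = 0.
Proof.
move=> df c1 c2 [i1 i2] fC; apply: complex_eqP => /=.
  apply: (@integral_derive0 (fun t => complex.Re (f t)) _ C) => // t.
    by case: (df t).
  by apply: le_trans (fC t); exact: Re_cabs.
apply: (@integral_derive0 (fun t => complex.Im (f t)) _ C) => // t.
  by case: (df t).
by apply: le_trans (fC t); exact: Im_cabs.
Qed.
End OneDim.

(** * Gaussian integrals with a complex parameter *)

Section Gaussian.
Context {R : realType}.
Notation leb := (@lebesgue_measure R).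

(** Squaring [exp(x) >= 1 + x] at half the exponent produces two powers of [1 + k^2]: one absorbs
    polynomial factors of degree at most two, the other leaves an integrable bound. *)
Lemma gauss_decay (delta : R) : 0 < delta ->
  exists2 C, 0 <= C &
    forall k : R, (1 + k ^+ 2) * expR (- (delta * k ^+ 2)) <= C / (1 + k ^+ 2).
Proof.
move=> d0; pose c := Num.min 1 (delta / 2).
have c0 : 0 < c by rewrite lt_min ltr01 divr_gt0.
exists (c^-1 ^+ 2) => [|k]; first by rewrite sqr_ge0.
have w0 : 0 < 1 + k ^+ 2 by rewrite ltr_pwDl ?sqr_ge0.
have h : c * (1 + k ^+ 2) <= expR (delta / 2 * k ^+ 2).
  apply: le_trans (expR_ge1Dx _).
  rewrite mulrDr mulr1 lerD// ?ge_min ?lexx// ler_wpM2r ?sqr_ge0//.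
  by rewrite ge_min lexx orbT.
rewrite ler_pdivlMr// expRN mulrAC ler_pdivrMr ?expR_gt0//.
have -> : expR (delta * k ^+ 2) = expR (delta / 2 * k ^+ 2) ^+ 2.
  by rewrite -expRM_natl; congr expR; rewrite -[2]/(2%:R : R); field.
rewrite -exprMn -expr2 lerXn2r// ?nnegrE ?mulr_ge0 ?expR_ge0 ?invr_ge0 ?(ltW c0)
  ?(ltW w0)//.
by rewrite ler_pdivlMl.
Qed.

(** The integrand is a multiple of the normal density with mean [m] and variance [1 / (2 delta)]. *)
Lemma integral_gauss_shift (delta m : R) : 0 < delta ->
  leb.-integrable setT (EFin \o (fun x => expR (- (delta * (x - m) ^+ 2)))) /\
  Rintegral leb setT (fun x => expR (- (delta * (x - m) ^+ 2))) =
    Num.sqrt (pi / delta).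
Proof.
move=> d0; pose s := Num.sqrt ((2 * delta)^-1).
have s2 : s ^+ 2 = (2 * delta)^-1.
  by rewrite sqr_sqrtr// invr_ge0 mulr_ge0// ltW.
have s0 : s != 0 by rewrite gt_eqF// sqrtr_gt0 invr_gt0 mulr_gt0.
have pk : normal_peak s = (Num.sqrt (pi / delta))^-1.
  rewrite /normal_peak s2; congr (Num.sqrt _)^-1.
  by rewrite -mulr_natr; field; rewrite gt_eqF.
have pk0 : Num.sqrt (pi / delta) != 0 by rewrite gt_eqF// sqrtr_gt0 divr_gt0 ?pi_gt0.
have e x : expR (- (delta * (x - m) ^+ 2)) = Num.sqrt (pi / delta) * normal_pdf m s x.
  rewrite normal_pdfE//= pk (mulVKf pk0) /normal_fun; congr expR.
  rewrite s2 -mulr_natr; field; rewrite gt_eqF//.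
have i1 := integrable_normal_pdf m s.
have i2 : leb.-integrable setT (EFin \o (fun x => expR (- (delta * (x - m) ^+ 2)))).
  have := integrableZl measurableT (Num.sqrt (pi / delta)) i1.
  by under eq_fun do rewrite -EFinM -e.
split=> //.
under eq_Rintegral do rewrite e.
by rewrite RintegralZl// /Rintegral integral_normal_pdf mulr1.
Qed.

(** The one-dimensional Gaussian [exp(- (delta - i a) k^2 + i p k)] with complex parameter
    [delta - i a]. *)
Definition gauss_chirp (delta a p k : R) : R[i] :=
  (expR (- (delta * k ^+ 2)))%:C * expi (a * k ^+ 2 + k * p).

(** The logarithmic derivative [- 2 (delta - i a) k + i p] of [gauss_chirp] in [k]. *)
Definition gauss_chirp_slope (delta a p k : R) : R[i] :=
  ((- 2 * delta)%:C + 'i * (2 * a)%:C) * k%:C + 'i * p%:C.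

Lemma is_derive_sqr (c t : R) : is_derive t (1 : R) (fun k : R =>
  c * k ^+ 2) (c * (2 * t)).
Proof.
apply: (is_derive_eq (is_derive1Z c (is_derive1M (is_derive_id t 1) (is_derive_id t
  1)))).
by ring.
Qed.

Lemma cderive_gauss_chirp delta a p k : cderive (gauss_chirp delta a p) k
  (gauss_chirp_slope delta a p k * gauss_chirp delta a p k).
Proof.
apply: (cderive_eq (cderiveM
  (cderive_real (is_derive1_compose (is_derive_expR _) (is_derive1N (is_derive_sqr
    delta k))))
  (cderive_expi (is_derive1D (is_derive_sqr a k) (is_derive1M (is_derive_id k _)
    (is_derive_cst p k 1)))))).
by rewrite /gauss_chirp_slope /gauss_chirp; apply: complex_eqP; rewrite !ReImE/=; ring.
Qed.

Lemma cmeas_gauss_chirp delta a p : cmeas (gauss_chirp delta a p).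
Proof.
by split; apply: continuous_measurable_fun => t;
  have [] := cderive_continuous (cderive_gauss_chirp delta a p t).
Qed.

Lemma cabs_gauss_chirp delta a p k : cabs (gauss_chirp delta a p k) <= 2 * expR (-
  (delta * k ^+ 2)).
Proof.
by rewrite /gauss_chirp cabsZ ger0_norm ?expR_ge0// mulrC ler_wpM2r ?expR_ge0//
  cabs_expi.
Qed.

Section Fixed.
Variable delta : R.
Hypothesis d0 : 0 < delta.

Let C := s2val (cid2 (gauss_decay d0)).
Let C0 : 0 <= C. Proof. exact: s2valP (cid2 (gauss_decay d0)). Qed.
Let CP k : (1 + k ^+ 2) * expR (- (delta * k ^+ 2)) <= C / (1 + k ^+ 2).
Proof. exact: s2valP' (cid2 (gauss_decay d0)) k. Qed.

Let G (k : R) := 2 * C * (1 + k ^+ 2)^-1.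

Let iG : leb.-integrable setT (EFin \o G).
Proof.
have := integrableZl measurableT (2 * C) (@integrable_oneDsqrV R).
by under eq_fun do rewrite -EFinM.
Qed.

Let gk_le (c : R[i]) a p k : cabs c <= 1 + k ^+ 2 ->
  cabs (c * gauss_chirp delta a p k) <= G k.
Proof.
move=> ck; apply: (le_trans (cabsM _ _)).
apply: (@le_trans _ _ ((1 + k ^+ 2) * (2 * expR (- (delta * k ^+ 2))))).
  by apply: ler_pM => //; rewrite ?cabs_ge0// cabs_gauss_chirp.
by rewrite mulrCA /G -mulrA ler_wpM2l.
Qed.

Let abs_le (k : R) : `|k| <= 1 + k ^+ 2.
Proof.
have := sqr_ge0 (`|k| - 1/2); rewrite -[k ^+ 2](real_normK (num_real k)).
by have := normr_ge0 k; nra.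
Qed.

Let one_le k : cabs (1 : R[i]) <= 1 + k ^+ 2.
Proof. by rewrite -[1]/(1%:C) cabs_real normr1 lerDl sqr_ge0. Qed.

Let id_le (k : R) : cabs k%:C <= 1 + k ^+ 2.
Proof. by rewrite cabs_real. Qed.

Let sq_le (k : R) : cabs ((k ^+ 2)%:C : R[i]) <= 1 + k ^+ 2.
Proof. by rewrite cabs_real ger0_norm ?sqr_ge0// lerDr. Qed.

Lemma gauss_chirp_decay a p : exists C', forall k, cabs (gauss_chirp delta a p k) <=
  C' / (1 + k ^+ 2).
Proof. by exists (2 * C) => k; rewrite -[gauss_chirp _ _ _ _]mul1r; exact: gk_le. Qed.

Lemma cintegrable_gauss_chirp a p : cintegrable leb (gauss_chirp delta a p).
Proof.
apply: (@cintegrable_dom _ _ _ leb _ G (cmeas_gauss_chirp _ _ _) iG) => k.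
by rewrite -[gauss_chirp _ _ _ _]mul1r; exact: gk_le.
Qed.

Let m1 : cmeas (fun k : R => k%:C : R[i]).
Proof. by apply: cmeas_real; exact: measurable_id. Qed.

Let m2 : cmeas (fun k : R => (k ^+ 2)%:C : R[i]).
Proof. by apply: cmeas_real; exact: measurable_funX. Qed.

Let i1 a p : cintegrable leb (fun k => k%:C * gauss_chirp delta a p k).
Proof.
apply: (@cintegrable_dom _ _ _ leb _ G (cmeasM m1 (cmeas_gauss_chirp _ _ _)) iG) => k.
exact: gk_le.
Qed.

Let i2 a p : cintegrable leb (fun k => (k ^+ 2)%:C * gauss_chirp delta a p k).
Proof.
apply: (@cintegrable_dom _ _ _ leb _ G (cmeasM m2 (cmeas_gauss_chirp _ _ _)) iG) => k.
exact: gk_le.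
Qed.

Let N a p := cI leb (gauss_chirp delta a p).
Let K a p := cI leb (fun k => k%:C * gauss_chirp delta a p k).
Let J a p := cI leb (fun k => (k ^+ 2)%:C * gauss_chirp delta a p k).

Let ccont (f : R -> R[i]) := continuous (fun t => complex.Re (f t)) /\
   continuous (fun t => complex.Im (f t)).

Let ccont_d f f' : (forall t, cderive f t (f' t)) -> ccont f.
Proof. by move=> df; split=> t; have [] := cderive_continuous (df t). Qed.

Let dk t : cderive (fun k : R => k%:C) t 1.
Proof. exact: (cderive_real (is_derive_id t 1)). Qed.

Let dgkD a p t : cderive (gauss_chirp_slope delta a p) t ((- 2 * delta)%:C + 'i * (2
  * a)%:C).
Proof.
rewrite /gauss_chirp_slope; apply: (cderive_eq (cderiveD (cderiveM (cderive_cst _ _)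
  (dk t)) (cderive_cst _ _))).
by rewrite mul0r add0r mulr1 addr0.
Qed.

(** The derivative of [gauss_chirp] in [k] has zero integral. Together with [dNp] this is the linear
    equation [dN/dp = - p N / (2 (delta - i a))]. *)
Let KN a p : ((2 * delta)%:C - 'i * (2 * a)%:C) * K a p = 'i * p%:C * N a p.
Proof.
have [C' hC] := gauss_chirp_decay a p.
have e : (fun k => gauss_chirp_slope delta a p k * gauss_chirp delta a p k) =
    (fun k => ((- 2 * delta)%:C + 'i * (2 * a)%:C) * (k%:C * gauss_chirp delta a p k) +
    'i * p%:C * gauss_chirp delta a p k).
  by apply/funext => k; rewrite /gauss_chirp_slope mulrDl mulrA.
have [c1 c2] := ccont_d (fun t =>
  cderiveM (dgkD a p t) (cderive_gauss_chirp delta a p t)).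
have j1 := cintegrableZ ((- 2 * delta)%:C + 'i * (2 * a)%:C) (i1 a p).
have j2 := cintegrableZ ('i * p%:C) (cintegrable_gauss_chirp a p).
have := @cI_derive0 _ _ _ C' (cderive_gauss_chirp delta a p) c1 c2 _ hC.
rewrite e => /(_ (cintegrableD j1 j2)); rewrite (cID j1 j2).
rewrite (cIZ _ (i1 a p)) (cIZ _ (cintegrable_gauss_chirp a p)) -/(K a p) -/(N a p).
move=> /eqP; rewrite addr_eq0 => /eqP/(congr1 -%R); rewrite opprK => <-.
by apply: complex_eqP; rewrite !ReImE/= ?ReImE/=; ring.
Qed.

(** The derivative of [k] times [gauss_chirp] has zero integral. Together with [dNa] this gives
    [dN/da = i N / (2 (delta - i a))] at [p = 0]. *)
Let NJ a : ((2 * delta)%:C - 'i * (2 * a)%:C) * J a 0 = N a 0.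
Proof.
have dq t : cderive (fun k => k%:C * gauss_chirp delta a 0 k) t
    (gauss_chirp delta a 0 t + (((- 2 * delta)%:C + 'i * (2 * a)%:C) * ((t ^+ 2)%:C *
      gauss_chirp delta a 0 t))).
  apply: (cderive_eq (cderiveM (dk t) (cderive_gauss_chirp delta a 0 t))).
  by rewrite mul1r /gauss_chirp_slope; congr (_ + _); apply: complex_eqP;
    rewrite !ReImE/=; ring.
have d2 t : cderive (fun k : R => (k ^+ 2)%:C) t (2 * t)%:C.
  apply: cderive_real; apply: (is_derive_eq (is_derive1M (is_derive_id t 1)
    (is_derive_id t 1))).
  by ring.
have [c1 c2] := ccont_d (fun t => cderiveD (cderive_gauss_chirp delta a 0 t)
  (cderiveM (cderive_cst ((- 2 * delta)%:C + 'i * (2 * a)%:C) t)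
    (cderiveM (d2 t) (cderive_gauss_chirp delta a 0 t)))).
have hC k : cabs (k%:C * gauss_chirp delta a 0 k) <= 2 * C / (1 + k ^+ 2) by exact:
  gk_le.
have j1 := cintegrable_gauss_chirp a 0.
have j2 := cintegrableZ ((- 2 * delta)%:C + 'i * (2 * a)%:C) (i2 a 0).
have := @cI_derive0 _ _ _ (2 * C) dq c1 c2 (cintegrableD j1 j2) hC.
rewrite (cID j1 j2) (cIZ _ (i2 a 0)) -/(J a 0) -/(N a 0).
move=> /eqP; rewrite addrC addr_eq0 => /eqP/(congr1 -%R); rewrite opprK => <-.
by apply: complex_eqP; rewrite !ReImE/= ?ReImE/=; ring.
Qed.

Let dNp a p : cderive (N a) p ('i * K a p).
Proof.
apply: cderive_eq.
  apply: (@cderive_cI _ _ _ leb (gauss_chirp delta a) (fun p k =>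
    'i * (k%:C * gauss_chirp delta a p k)) G).
  - exact: cintegrable_gauss_chirp.
  - move=> s k; rewrite /gauss_chirp.
    apply: (cderive_eq (cderiveM (cderive_cst _ _) (cderive_expi
      (is_derive1D (is_derive1_cst (a * k ^+ 2) s) (is_derive1M (is_derive1_cst k s)
        (is_derive1_id s)))))).
    by apply: complex_eqP; rewrite !ReImE/=; ring.
  - exact: iG.
  - move=> s k _; rewrite mulrA; apply: gk_le.
    by rewrite /cabs !ReImE/= !mul0r !mulr0 subr0 add0r mul1r normr0 add0r.
by rewrite cIZ.
Qed.

Let dNa a : cderive (fun a => N a 0) a ('i * J a 0).
Proof.
apply: cderive_eq.
  apply: (@cderive_cI _ _ _ leb (fun a => gauss_chirp delta a 0) (fun a k =>
    'i * ((k ^+ 2)%:C * gauss_chirp delta a 0 k)) G).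
  - by move=> s; exact: cintegrable_gauss_chirp.
  - move=> s k; rewrite /gauss_chirp.
    apply: (cderive_eq (cderiveM (cderive_cst _ _) (cderive_expi
      (is_derive1D (is_derive1M (is_derive1_id s) (is_derive1_cst (k ^+ 2) s))
        (is_derive1_cst (k * 0) s))))).
    by apply: complex_eqP; rewrite !ReImE/=; ring.
  - exact: iG.
  - move=> s k _; rewrite mulrA; apply: gk_le.
    rewrite /cabs !ReImE/= !mul0r !mulr0 subr0 add0r mul1r normr0 add0r.
    by rewrite ger0_norm ?sqr_ge0// lerDr.
by rewrite cIZ.
Qed.

(** The factor [E] below is [exp(p^2 / (4 (delta - i a)))], the reciprocal of the expected solution,
    so [N a p * E p] has zero derivative in [p]. *)
Let Np a p : N a p = N a 0 * (expR (- (p ^+ 2 * delta / (4 * (delta ^+ 2 + a ^+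
  2)))))%:C
  * expi (- (p ^+ 2 * a / (4 * (delta ^+ 2 + a ^+ 2)))).
Proof.
set D := delta ^+ 2 + a ^+ 2.
have D0 : D != 0 by rewrite gt_eqF// ltr_pwDl ?exprn_gt0 ?sqr_ge0.
pose E (p : R) := (expR ((delta / (4 * D)) * p ^+ 2))%:C * expi ((a / (4 * D)) * p ^+
  2).
have dE q : cderive E q ((delta / (4 * D) * (2 * q))%:C * E q +
     'i * (a / (4 * D) * (2 * q))%:C * E q).
  apply: (cderive_eq (cderiveM (cderive_real (is_derive1_compose (is_derive_expR _)
    (is_derive_sqr _ _)))
    (cderive_expi (is_derive_sqr _ _)))).
  by rewrite /E; apply: complex_eqP; rewrite !ReImE/=; ring.
have cst : N a p * E p = N a 0 * E 0.
  apply: (@cderive0_cst _ (fun p => N a p * E p)) => q.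
  apply: (cderive_eq (cderiveM (dNp a q) (dE q))).
  have := KN a q; move: (K a q) (N a q) (E q) => [k1 k2] [n1 n2] [e1 e2].
  move=> h; have /= := congr1 (@complex.Re _) h; have /= := congr1 (@complex.Im _) h.
  rewrite !(mul0r, mulr0, addr0, mul1r, subr0, add0r, sub0r) => h2 h1.
  pose v := (2 * D)^-1.
  have v4 c : c / (4 * D) * (2 * q) = c * q * v.
    by rewrite /v; field.
  have vD : 2 * D * v = 1 by rewrite /v divff// mulf_neq0.
  (* Real and imaginary parts of [K = i q N / (2 (delta - i a))]: the denominator is inverted by its
     conjugate, with [v = 1 / (2 D)]. *)
  have {h1 h2}[-> ->] : k1 = (- delta * q * n2 - a * q * n1) * v /\
                        k2 = (delta * q * n1 - a * q * n2) * v.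
    split; rewrite -[LHS]mul1r -vD.
      rewrite mulrAC; congr (_ * v); rewrite /D.
      transitivity (delta * (2 * delta * k1 + 2 * a * k2) - a * (2 * delta * k2 - 2 *
        a * k1)); first by ring.
      rewrite (_ : 2 * delta * k1 + 2 * a * k2 = - q * n2); last by lra.
      by rewrite (_ : 2 * delta * k2 - 2 * a * k1 = q * n1); [ring|lra].
    rewrite mulrAC; congr (_ * v); rewrite /D.
    transitivity (a * (2 * delta * k1 + 2 * a * k2) + delta * (2 * delta * k2 - 2 * a
      * k1)); first by ring.
    rewrite (_ : 2 * delta * k1 + 2 * a * k2 = - q * n2); last by lra.
    by rewrite (_ : 2 * delta * k2 - 2 * a * k1 = q * n1); [ring|lra].
  by rewrite !v4; apply: complex_eqP; rewrite !ReImE/=; ring.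
have E0 : E 0 = 1.
  by rewrite /E expr0n/= !mulr0 expR0 expi0 mul1r.
rewrite E0 mulr1 in cst; rewrite -cst -[LHS]mulr1 -!(mulrA (N a p)); congr (_ * _).
rewrite /E (_ : p ^+ 2 * delta / (4 * D) = delta / (4 * D) * p ^+ 2); last by ring.
rewrite (_ : p ^+ 2 * a / (4 * D) = a / (4 * D) * p ^+ 2); last by ring.
rewrite -mulrA mulrACA expi_mulC mulr1 -realCM expRN divff//.
by rewrite gt_eqF// expR_gt0.
Qed.

(** The equation in [a] makes [N^2 (delta - i a)] constant, and its value [pi] is read off at
    [a = 0]. Working with the square avoids a branch of the complex root, and the planar integral
    only involves the square. *)
Let N2 a : N a 0 * N a 0 = (pi / (delta ^+ 2 + a ^+ 2))%:C * (delta%:C + 'i * a%:C).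
Proof.
set D := delta ^+ 2 + a ^+ 2.
have D0 : D != 0 by rewrite gt_eqF// ltr_pwDl ?exprn_gt0 ?sqr_ge0.
have dz (b : R) : cderive (fun b : R => delta%:C - 'i * b%:C) b (- 'i).
  under eq_fun do rewrite -mulNr.
  apply: (cderive_eq (cderiveD (cderive_cst _ _)
    (cderiveM (cderive_cst (- 'i) b) (cderive_real (is_derive1_id b))))).
  by rewrite mul0r mulr1 !add0r.
have cst : N a 0 * N a 0 * (delta%:C - 'i * a%:C) = N 0 0 * N 0 0 * (delta%:C - 'i *
  0%:C).
  apply: (@cderive0_cst _ (fun a => N a 0 * N a 0 * (delta%:C - 'i * a%:C))) => b.
  apply: (cderive_eq (cderiveM (cderiveM (dNa b) (dNa b)) (dz b))).
  rewrite -(NJ b) (_ : (2 * delta)%:C - 'i * (2 * b)%:C = 2 * (delta%:C - 'i * b%:C)).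
    by move: (J b 0) (delta%:C - 'i * b%:C) ('i%C : R[i]) => j z i; ring.
  by rewrite !realCM (rmorph_nat (real_complex R)); ring.
have N0 : N 0 0 = (Num.sqrt (pi / delta))%:C.
  have [_ h] := @integral_gauss_shift delta 0 d0.
  have e : gauss_chirp delta 0 0 = (fun k => (expR (- (delta * (k - 0) ^+ 2)))%:C).
    by apply/funext => k; rewrite /gauss_chirp mul0r mulr0 addr0 expi0 mulr1 subr0.
  rewrite /N e; apply: complex_eqP; rewrite /= ?h//.
  by rewrite Rintegral_cst// mul0r.
have N00 : N 0 0 * N 0 0 = (pi / delta)%:C.
  by rewrite N0 -realCM -expr2 sqr_sqrtr// divr_ge0 ?pi_ge0 ?(ltW d0).
rewrite N00 in cst.
have zc : (delta%:C - 'i * a%:C) * (delta%:C + 'i * a%:C) = D%:C :> R[i].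
  by apply: complex_eqP; rewrite !ReImE/= /D; ring.
have DC : D%:C != 0 :> R[i] by rewrite fmorph_eq0.
apply: (mulIf DC); rewrite -{1}zc mulrA cst.
rewrite mulr0 subr0 -realCM divfK ?gt_eqF//.
by rewrite mulrAC -realCM divfK.
Qed.

(** This is [pi / (delta - i a) * exp(- s / (4 (delta - i a)))] with [s] a squared length. It keeps
    its meaning at [delta = 0] when [a] is nonzero, where it is a chirp. *)
Definition gauss_ft (a s : R) : R[i] :=
  (pi / (delta ^+ 2 + a ^+ 2))%:C * (delta%:C + 'i * a%:C) *
  ((expR (- (s * delta / (4 * (delta ^+ 2 + a ^+ 2)))))%:C *
   expi (- (s * a / (4 * (delta ^+ 2 + a ^+ 2))))).

Definition chirp_weight (a : R) (p k : plane R) : R[i] :=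
  (expR (- (delta * sqnorm k)))%:C * expi (a * sqnorm k + dotp k p).

Lemma chirp_weightE a p k :
  chirp_weight a p k = gauss_chirp delta a p.1 k.1 * gauss_chirp delta a p.2 k.2.
Proof.
rewrite /chirp_weight /gauss_chirp mulrACA -realCM -expRD -expiD /sqnorm /dotp.
by congr (_%:C * expi _); [congr expR|]; ring.
Qed.

Lemma gauss2D a p : cint (chirp_weight a p) = gauss_ft a (sqnorm p).
Proof.
pose F (k : plane R) := gauss_chirp delta a p.1 k.1 * gauss_chirp delta a p.2 k.2.
rewrite (_ : cint _ = cI (leb \x leb)%E F); last first.
  by apply: eq_cI => k; rewrite chirp_weightE.
have mF : cmeas F.
  apply: cmeasM; first exact: cmeas_comp (cmeas_gauss_chirp _ _ _) measurable_fst.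
  exact: cmeas_comp (cmeas_gauss_chirp _ _ _) measurable_snd.
rewrite (@cI_prod1 _ _ _ _ _ leb leb F (fun k => cabs (gauss_chirp delta a p.1 k))
   (fun k => cabs (gauss_chirp delta a p.2 k))) //.
- transitivity (cI leb (fun x =>
  cI leb (gauss_chirp delta a p.2) * gauss_chirp delta a p.1 x)).
    by apply: eq_cI => x; rewrite [RHS]mulrC -cIZ //; exact: cintegrable_gauss_chirp.
  rewrite cIZ; last exact: cintegrable_gauss_chirp.
  rewrite -/(N a p.1) -/(N a p.2) Np// [X in _ * X]Np// /gauss_ft -N2//.
  rewrite [X in _ = _ * (X%:C * expi _)](_ : _ =
    expR (- (p.1 ^+ 2 * delta / (4 * (delta ^+ 2 + a ^+ 2)))) *
    expR (- (p.2 ^+ 2 * delta / (4 * (delta ^+ 2 + a ^+ 2))))); last first.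
    by rewrite -expRD; congr expR; rewrite /sqnorm/dotp; ring.
  rewrite [X in _ = _ * (_ * expi X)](_ : _ =
    - (p.1 ^+ 2 * a / (4 * (delta ^+ 2 + a ^+ 2)))
    - (p.2 ^+ 2 * a / (4 * (delta ^+ 2 + a ^+ 2)))); last first.
    by rewrite /sqnorm/dotp; ring.
  by rewrite expiD realCM; ring.
- by move=> x; exact: cabs_ge0.
- by move=> x; exact: cabs_ge0.
- by apply: integrable_cabs; exact: cintegrable_gauss_chirp.
- by apply: integrable_cabs; exact: cintegrable_gauss_chirp.
- by move=> x y; exact: cabsM.
Qed.
End Fixed.
End Gaussian.

(** * Decaying functions on the plane and their Fourier transforms *)

Section Plane.
Context {R : realType}.
Notation leb := (@lebesgue_measure R).
Notation leb2 := (leb \x leb)%E.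
Notation cmeas2 := (@cmeas R _ (measurableTypeR R * measurableTypeR R)%type).
Lemma sigma_finite_area : sigma_finite setT (leb \x leb)%E.
Proof.
pose I (n : nat) : set R := `[- n%:R, n%:R]%classic.
exists (fun n => I n `*` I n).
  apply/seteqP; split => // -[x y] _.
  exists (Num.truncn (Num.max `|x| `|y|)).+1 => //.
  have h (t : R) : `|t| <= Num.max `|x| `|y| -> I (Num.truncn (Num.max `|x| `|y|)).+1 t.
    move=> tm; rewrite /I /= in_itv/= -ler_norml (le_trans tm)// ltW//.
    exact: truncnS_gt.
  by split; apply: h; rewrite le_max lexx ?orbT.
move=> n; split; first by apply: measurableX; exact: measurable_itv.
rewrite product_measure1E; try exact: measurable_itv.
have f : (leb (I n) < +oo)%E by rewrite /I lebesgue_measure_itv/=; case: ifP;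
  rewrite ?ltry.
by rewrite lte_mul_pinfty// ge0_fin_numE.
Qed.

(* The library's canonical sigma-finite structures on a product measure only
   cover products of finite measures. *)
Definition area : {sigma_finite_measure set (measurableTypeR R * measurableTypeR
  R)%type -> \bar R} :=
 HB.pack (product_measure1 leb leb) (Measure_isSigmaFinite.Build _ _ _ (leb \x leb)%E
   sigma_finite_area).

Implicit Types (f g h : plane R -> R[i]) (x k p : plane R) (b : bool).

Definition coord b x : R := if b then x.2 else x.1.
Definition setc b x (t : R) : plane R := if b then (x.1, t) else (t, x.2).
(** The product form makes the inverse a tensor product of integrable functions on the line. It is
    also the squared modulus of [(1 + i x1) (1 + i x2)], the Fourier symbol of
    [(1 + d1) (1 + d2)]. *)
Definition weight x : R := (1 + x.1 ^+ 2) * (1 + x.2 ^+ 2).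

Lemma setc_coord b x : setc b x (coord b x) = x.
Proof. by case: b x => -[]. Qed.
Lemma coord_setc b x t : coord b (setc b x t) = t.
Proof. by case: b. Qed.
Lemma setc_setc b x s t : setc b (setc b x s) t = setc b x t.
Proof. by case: b. Qed.

Lemma oneDsqr_pos (t : R) : 0 < 1 + t ^+ 2.
Proof. by rewrite ltr_pwDl ?sqr_ge0. Qed.

Lemma weight_gt0 x : 0 < weight x.
Proof. by rewrite mulr_gt0 ?oneDsqr_pos. Qed.

Lemma weight_ge1 x : 1 <= weight x.
Proof.
by rewrite -[1]mulr1; apply: ler_pM => //; rewrite lerDl sqr_ge0.
Qed.

Lemma weight_coord b x : 1 + coord b x ^+ 2 <= weight x.
Proof.
rewrite /weight; case: b => /=; rewrite ?ler_peMl ?ler_peMr ?lerDl ?sqr_ge0//;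
exact/ltW/oneDsqr_pos.
Qed.

Lemma integrable_weightV (C : R) : leb2.-integrable setT (EFin \o (fun x =>
  C / weight x)).
Proof.
have := @integrable_tensor R _ _ _ _ leb leb (fun t => (1 + t ^+ 2)^-1) (fun t =>
  (1 + t ^+ 2)^-1).
have p (t : R) : 0 <= (1 + t ^+ 2)^-1 by rewrite invr_ge0 ltW// oneDsqr_pos.
move=> /(_ p p (@integrable_oneDsqrV R) (@integrable_oneDsqrV R)) i.
have := integrableZl measurableT C i; congr (_.-integrable _ _).
by apply/funext => x /=; rewrite -EFinM /weight invfM.
Qed.

Definition quadratic_decay f := exists C, forall x, cabs (f x) <= C / weight x.
Definition decaying f := cmeas2 f /\ quadratic_decay f.

Lemma decaying_integrable f : decaying f -> cintegrable leb2 f.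
Proof.
move=> [mf [C fC]]; exact: (@cintegrable_dom _ _ _ leb2 _ _ mf (integrable_weightV C)).
Qed.

Lemma quadratic_decayD f g : quadratic_decay f -> quadratic_decay g ->
  quadratic_decay (fun x => f x + g x).
Proof.
move=> [C fC] [D gD]; exists (C + D) => x; apply: (le_trans (cabsD _ _)).
by rewrite mulrDl lerD.
Qed.

Lemma quadratic_decayMl f g (C : R) : (forall x, cabs (g x) <= C) ->
  quadratic_decay f ->
  quadratic_decay (fun x => g x * f x).
Proof.
move=> gC [D fD]; exists (C * D) => x; apply: (le_trans (cabsM _ _)).
by rewrite -mulrA; apply: ler_pM; rewrite ?cabs_ge0.
Qed.

Lemma decayingD f g : decaying f -> decaying g -> decaying (fun x => f x + g x).
Proof. by move=> [? ?] [? ?]; split; [exact: cmeasD|exact: quadratic_decayD]. Qed.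

Lemma decayingMl f g (C : R) : cmeas2 g -> (forall x, cabs (g x) <= C) -> decaying f ->
  decaying (fun x => g x * f x).
Proof. by move=> mg gC [mf qf]; split;
  [exact: cmeasM|exact: quadratic_decayMl gC qf]. Qed.

Lemma decayingZ c f : decaying f -> decaying (fun x => c * f x).
Proof. by apply: (@decayingMl _ _ (cabs c)) => //; exact: cmeas_cst. Qed.

Lemma decaying_bounded f : decaying f -> exists C, forall x, cabs (f x) <= C.
Proof.
move=> [_ [C fC]]; exists C => x; apply: (le_trans (fC x)).
have C0 : 0 <= C.
  by have := le_trans (cabs_ge0 _) (fC x); rewrite pmulr_lge0// invr_gt0 weight_gt0.
by rewrite ler_pdivrMr ?weight_gt0// ler_peMr// weight_ge1.
Qed.

(** A relation along coordinate lines, so that one-variable calculus applies to each slice and the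
    derivative is given by an explicit formula. *)
Definition pderiv b f f' :=
  forall x, cderive (fun t => f (setc b x t)) (coord b x) (f' x).

Lemma pderiv_slice b f f' x t : pderiv b f f' ->
  cderive (fun t => f (setc b x t)) t (f' (setc b x t)).
Proof.
move=> /(_ (setc b x t)); rewrite coord_setc.
by under [X in cderive X _ _]eq_fun do rewrite setc_setc.
Qed.

Definition ccont (q : R -> R[i]) :=
  continuous (fun t => complex.Re (q t)) /\ continuous (fun t => complex.Im (q t)).

Lemma ccontP q : ccont q <-> forall t, ccvg (nbhs t) q (q t).
Proof.
split => [[c1 c2] t|h]; first by split; [exact: c1|exact: c2].
by split=> t; case: (h t).
Qed.

Definition scont b f := forall x, ccont (fun t => f (setc b x t)).

Lemma pderiv_scont b f f' : pderiv b f f' -> scont b f.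
Proof.
by move=> df x; split => t; have [] := cderive_continuous (pderiv_slice x t df).
Qed.

Lemma scontM b f g : scont b f -> scont b g -> scont b (fun x => f x * g x).
Proof.
move=> sf sg x; apply/ccontP => t; apply: ccvgM.
  by have /ccontP := sf x; exact.
by have /ccontP := sg x; exact.
Qed.

Lemma scontD b f g : scont b f -> scont b g -> scont b (fun x => f x + g x).
Proof.
move=> sf sg x; apply/ccontP => t; apply: ccvgD.
  by have /ccontP := sf x; exact.
by have /ccontP := sg x; exact.
Qed.

Lemma scont_cst b c : scont b (fun _ => c).
Proof. by move=> x; apply/ccontP => t; exact: ccvg_cst. Qed.

Lemma scont_cmeas f : scont false f -> scont true f -> cmeas2 f.
Proof.
move=> s1 s2; split; apply: measurable_sepcont => x;
  [by case: (s1 (0, x))|by case: (s2 (x, 0))|by case: (s1 (0, x))|by case: (s2 (x, 0))].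
Qed.

Lemma pderivM b f f' g g' : pderiv b f f' -> pderiv b g g' ->
  pderiv b (fun x => f x * g x) (fun x => f' x * g x + f x * g' x).
Proof.
move=> df dg x; have := cderiveM (df x) (dg x).
by rewrite !setc_coord.
Qed.

Lemma pderivD b f f' g g' : pderiv b f f' -> pderiv b g g' ->
  pderiv b (fun x => f x + g x) (fun x => f' x + g' x).
Proof. by move=> df dg x; exact: cderiveD. Qed.

Lemma pderiv_cst b c : pderiv b (fun _ => c) (fun _ => 0).
Proof. by move=> x; exact: cderive_cst. Qed.

Lemma pderiv_eq b f f' g' : pderiv b f f' -> f' =1 g' -> pderiv b f g'.
Proof. by move=> df /funext <-. Qed.

(** The variable of differentiation is integrated first: decay in that coordinate removes the
    boundary terms, and the product form of the weight dominates the iterated integral. *)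
Lemma cint_pderiv0 b f f' : pderiv b f f' -> decaying f -> decaying f' -> scont b f' ->
  cint f' = 0.
Proof.
move=> df [mf [C fC]] [mf' [D fD]] sf'.
have C0 : 0 <= C.
  by have := le_trans (cabs_ge0 _) (fC 0); rewrite pmulr_lge0// invr_gt0 weight_gt0.
have p (t : R) : 0 <= (1 + t ^+ 2)^-1 by rewrite invr_ge0 ltW// oneDsqr_pos.
have D0 : 0 <= D.
  by have := le_trans (cabs_ge0 _) (fD 0); rewrite pmulr_lge0// invr_gt0 weight_gt0.
have i1 := @integrable_oneDsqrV R.
have i2 : leb.-integrable setT (EFin \o (fun t : R => D * (1 + t ^+ 2)^-1)).
  by have := integrableZl measurableT D i1; under eq_fun do rewrite -EFinM.
have i2p (t : R) : 0 <= D * (1 + t ^+ 2)^-1 by rewrite mulr_ge0.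
have Fg (s t : R) : cabs (f' (s, t)) <= (1 + s ^+ 2)^-1 * (D * (1 + t ^+ 2)^-1).
  by rewrite mulrCA -invfM; exact: fD.
have fb x : cabs (f x) <= C / (1 + coord b x ^+ 2).
  apply: (le_trans (fC x)); rewrite ler_wpM2l// lef_pV2 ?posrE ?weight_gt0
    ?oneDsqr_pos//.
  exact: weight_coord.
have z x : cI leb (fun t => f' (setc b x t)) = 0.
  have [c1 c2] := sf' x.
  apply: (@cI_derive0 _ (fun t => f (setc b x t)) _ C) => //.
  - by move=> t; exact: pderiv_slice.
  - rewrite /setc; case: (b).
      exact: (cintegrable_slice1 mf' i2 Fg).
    exact: (cintegrable_slice2 mf' i1 Fg).
  - by move=> t; have := fb (setc b x t); rewrite coord_setc.
rewrite (_ : cint f' = cI leb2 f')//.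
have z0 : cI leb (fun _ => 0) = 0 :> R[i].
  by apply: complex_eqP; rewrite /= Rintegral_cst// mul0r.
move: z; case: (b) => z.
  rewrite (@cI_prod1 _ _ _ _ _ leb leb f' _ _ mf' p i2p i1 i2 Fg) -[RHS]z0.
  by apply: eq_cI => x; exact: (z (x, 0)).
rewrite (@cI_prod2 _ _ _ _ _ leb leb f' _ _ mf' p i2p i1 i2 Fg) -[RHS]z0.
by apply: eq_cI => x; exact: (z (0, x)).
Qed.

Lemma measurable_dotp k :
  measurable_fun [set: measurableTypeR R * measurableTypeR R] (dotp k).
Proof.
by apply: measurable_funD; apply: measurable_funM => //; exact: measurable_cst.
Qed.

Lemma cmeas_wave k : cmeas2 (fun x => expi (- dotp k x)).
Proof. by apply: cmeas_expi; apply: measurableT_comp => //; exact: measurable_dotp. Qed.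

Lemma decaying_wave f k : decaying f -> decaying (fun x => f x * expi (- dotp k x)).
Proof.
move=> nf; under eq_fun do rewrite mulrC.
apply: (@decayingMl _ _ 2) => //; first exact: cmeas_wave.
by move=> x; exact: cabs_expi.
Qed.

Lemma fourier_bounded f : decaying f -> exists C, forall k, cabs (fourier f k) <= C.
Proof.
move=> [mf [C fC]]; exists (Rintegral leb2 setT (fun x => (C * 2) / weight x)) => k.
apply: cabs_cI; first by apply: cmeasM => //; exact: cmeas_wave.
  exact: integrable_weightV.
move=> x; apply: (le_trans (cabsM _ _)); rewrite mulrAC.
by apply: ler_pM; rewrite ?cabs_ge0 ?cabs_expi.
Qed.

Lemma fourierD f g k : decaying f -> decaying g ->
  fourier (fun x => f x + g x) k = fourier f k + fourier g k.
Proof.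
move=> nf ng; rewrite /fourier -[RHS]cID; try exact/decaying_integrable/decaying_wave.
by apply: eq_cI => x; rewrite mulrDl.
Qed.

Lemma fourierZ c f k : decaying f -> fourier (fun x => c * f x) k = c * fourier f k.
Proof.
move=> nf; rewrite /fourier -[RHS]cIZ; last exact/decaying_integrable/decaying_wave.
by apply: eq_cI => x; rewrite mulrA.
Qed.

Lemma dotp_setc b k x t : dotp (setc b k t) x = coord (~~ b) k * coord (~~ b) x + t *
  coord b x.
Proof. by case: b; rewrite /dotp/= // addrC. Qed.

Lemma dotpC k x : dotp k x = dotp x k.
Proof. by rewrite /dotp; congr (_ + _); rewrite mulrC. Qed.

Lemma fourier_pderiv b f : decaying f ->
  quadratic_decay (fun x => (coord b x)%:C * f x) ->
  pderiv b (fourier f) (fourier (fun x => - 'i * ((coord b x)%:C * f x))).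
Proof.
move=> nf [C fC] k.
apply: cderive_eq.
  apply: (@cderive_cI _ _ _ leb2 (fun s x => f x * expi (- dotp (setc b k s) x))
     (fun s x => (- 'i * ((coord b x)%:C * f x)) * expi (- dotp (setc b k s) x))
     (fun x => (1 * C * 2) / weight x)).
  - by move=> s; exact/decaying_integrable/decaying_wave.
  - move=> s x; under eq_fun do rewrite dotp_setc.
    rewrite dotp_setc.
    apply: (cderive_eq (cderiveM (cderive_cst _ _) (cderive_expi
      (is_derive1N (is_derive1D (is_derive1_cst _ _) (is_derive1M (is_derive1_id s)
        (is_derive1_cst (coord b x) s))))))).
    rewrite mul0r !add0r mul1r mulr0 addr0 rmorphN /=.
    by ring.
  - exact: integrable_weightV.
  - move=> s x _; apply: (le_trans (cabsM _ _)).
    rewrite mulrAC; apply: ler_pM; rewrite ?cabs_ge0 ?cabs_expi//.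
    apply: (le_trans (cabsM _ _)); rewrite -mulrA.
    apply: ler_pM; rewrite ?cabs_ge0// cabsN.
    by rewrite /cabs/= normr0 normr1 add0r.
by apply: eq_cI => x /=; rewrite setc_coord.
Qed.

Lemma pderiv_wave b k :
  pderiv b (fun x => expi (- dotp k x)) (fun x =>
    - 'i * (coord b k)%:C * expi (- dotp k x)).
Proof.
move=> x; under eq_fun do rewrite dotpC dotp_setc.
rewrite -[in dotp k x](setc_coord b x) dotpC dotp_setc.
apply: (cderive_eq (cderive_expi
      (is_derive1N (is_derive1D (is_derive1_cst _ _) (is_derive1M (is_derive1_id
        (coord b x)) (is_derive1_cst (coord b k) _)))))).
by congr (_ * _); apply: complex_eqP; rewrite !ReImE/=; ring.
Qed.

(** Integration by parts: [cint_pderiv0] is applied to the derivative of [f] times the plane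
    wave. *)
Lemma fourier_of_pderiv b f f' k : pderiv b f f' -> decaying f -> decaying f' ->
  scont b f' -> fourier f' k = 'i * (coord b k)%:C * fourier f k.
Proof.
move=> df nf nf' sf'.
have dF := pderivM df (pderiv_wave b k).
have n1 := decaying_wave k nf'; have n2 := decaying_wave k nf.
have e : (fun x => f' x * expi (- dotp k x) + f x * (- 'i * (coord b k)%:C * expi (-
  dotp k x)))
  = (fun x => f' x * expi (- dotp k x) + (- 'i * (coord b k)%:C) * (f x * expi (-
    dotp k x))).
  by apply/funext => x; rewrite [f x * _]mulrCA.
rewrite e in dF.
have n3 := decayingZ (- 'i * (coord b k)%:C) n2.
have sw : scont b (fun x => expi (- dotp k x)) by exact: pderiv_scont (pderiv_wave b k).
have := cint_pderiv0 dF n2 (decayingD n1 n3).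
have s : scont b (fun x => f' x * expi (- dotp k x) + (- 'i * (coord b k)%:C) * (f x
  * expi (- dotp k x))).
  apply: scontD; first exact: scontM.
  apply: scontM; first exact: scont_cst.
  by apply: scontM => //; exact: pderiv_scont df.
move=> /(_ s) h.
have e2 : 0 = cint (fun x => f' x * expi (- dotp k x)) +
    (- 'i * (coord b k)%:C) * cint (fun x => f x * expi (- dotp k x)).
  rewrite -h; apply: (etrans (cID (decaying_integrable n1) (decaying_integrable n3))).
  by congr (_ + _); exact: (cIZ _ (decaying_integrable n2)).
by apply/eqP; rewrite -subr_eq0 -mulNr -mulNr -e2.
Qed.
End Plane.

(** * Fourier transforms against chirps *)

Section Inversion.
Context {R : realType}.
Notation leb := (@lebesgue_measure R).
Notation leb2 := (leb \x leb)%E.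
Notation mplane := (measurableTypeR R * measurableTypeR R)%type.
Notation area := (@area R).
Notation cmeas2 := (@cmeas R _ mplane).
Implicit Types (f g h : plane R -> R[i]) (x k p z : plane R) (b : bool).

Lemma dotpZ (s : R) k x : dotp (s *: k) x = s * dotp k x.
Proof. by rewrite /dotp /= /GRing.scale/= mulrDr !mulrA. Qed.

Lemma sqnorm_ge0 x : 0 <= sqnorm x.
Proof. by rewrite /sqnorm /dotp -!expr2 addr_ge0 ?sqr_ge0. Qed.

Lemma measurable_sqnorm : measurable_fun [set: mplane] (@sqnorm R).
Proof. by apply: measurable_funD; apply: measurable_funM. Qed.

Lemma decaying_chirp_weight (delta a : R) p : 0 < delta ->
  decaying (chirp_weight delta a p).
Proof.
move=> d0; split.
  apply: cmeasM; last first.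
    apply: cmeas_expi; apply: measurable_funD.
      by apply: measurable_funM; [exact: measurable_cst|exact: measurable_sqnorm].
    by under eq_fun do rewrite dotpC; exact: measurable_dotp.
  apply: cmeas_real; apply: measurableT_comp => //.
  apply: measurableT_comp => //.
  by apply: measurable_funM; [exact: measurable_cst|exact: measurable_sqnorm].
have [C hC] := gauss_chirp_decay d0 a p.1; have [D hD] := gauss_chirp_decay d0 a p.2.
exists (C * D) => x; rewrite chirp_weightE; apply: (le_trans (cabsM _ _)).
rewrite /weight invfM mulrACA; apply: ler_pM; rewrite ?cabs_ge0 ?hC ?hD//.
Qed.

Lemma cabs_chirp_weight (delta a : R) p k : 0 <= delta ->
  cabs (chirp_weight delta a p k) <= 2.
Proof.
move=> d0; rewrite /chirp_weight cabsZ ger0_norm ?expR_ge0//.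
apply: (@le_trans _ _ (1 * 2)); last by rewrite mul1r.
apply: ler_pM; rewrite ?expR_ge0 ?cabs_ge0 ?cabs_expi//.
by rewrite -expR0 ler_expR oppr_le0 mulr_ge0// sqnorm_ge0.
Qed.

Section Swap.
Variables (f h : plane R -> R[i]) (s : R).
Hypotheses (nf : decaying f) (nh : decaying h).

Let F (w : mplane * mplane) : R[i] :=
  f w.1 * (h w.2 * expi (- dotp (s *: w.1) w.2)).

Let mF : cmeas F.
Proof.
apply: cmeasM; first exact: (cmeas_comp nf.1 measurable_fst).
apply: cmeasM; first exact: (cmeas_comp nh.1 measurable_snd).
apply: cmeas_expi; apply: measurableT_comp => //.
under eq_fun do rewrite dotpZ.
apply: measurable_funM; first exact: measurable_cst.
apply: measurable_funD; apply: measurable_funM.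
- exact: (measurableT_comp measurable_fst measurable_fst).
- exact: (measurableT_comp measurable_fst measurable_snd).
- exact: (measurableT_comp measurable_snd measurable_fst).
- exact: (measurableT_comp measurable_snd measurable_snd).
Qed.

Let g1 (k : mplane) : R := cabs (f k).
Let g2 (z : mplane) : R := 2 * cabs (h z).
Let g10 k : 0 <= g1 k. Proof. exact: cabs_ge0. Qed.
Let g20 k : 0 <= g2 k. Proof. by rewrite mulr_ge0// cabs_ge0. Qed.
Let ig1 : leb2.-integrable setT (EFin \o g1).
Proof. exact: integrable_cabs (decaying_integrable nf). Qed.
Let ig2 : leb2.-integrable setT (EFin \o g2).
Proof.
have := integrableZl measurableT 2 (integrable_cabs (decaying_integrable nh)).
by under eq_fun do rewrite -EFinM.
Qed.
Let Fg x y : cabs (F (x, y)) <= g1 x * g2 y.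
Proof.
rewrite /F /g1 /g2; apply: (le_trans (cabsM _ _)); rewrite ler_wpM2l ?cabs_ge0//.
by apply: (le_trans (cabsM _ _)); rewrite mulrC ler_wpM2r ?cabs_ge0 ?cabs_expi.
Qed.

Let inner1 k : cI leb2 (fun z => F (k, z)) = f k * fourier h (s *: k).
Proof. by rewrite /fourier -cIZ//; apply: decaying_integrable;
  exact: decaying_wave. Qed.

(** The multiplication formula. The dilation [s] is carried along because expanding a chirp produces
    transforms at arguments such as [(2 * a)^-1 *: x]. *)
Lemma fourier_swap :
  cint (fun k => f k * fourier h (s *: k)) = cint (fun z => h z * fourier f (s *: z)).
Proof.
rewrite (_ : cint _ = cI area (fun k => cI area (fun z => F (k, z)))); last first.
  by apply: eq_cI => k; rewrite -inner1.
rewrite (@cFubini _ _ _ _ _ area area F g1 g2 mF g10 g20 ig1 ig2 Fg).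
apply: eq_cI => z; rewrite /fourier -cIZ; last exact/decaying_integrable/decaying_wave.
apply: eq_cI => k; rewrite /F /= !dotpZ dotpC.
by rewrite mulrCA.
Qed.

Lemma cmeas_mul_fourier : cmeas2 (fun k => f k * fourier h (s *: k)).
Proof.
have := @cmeas_cI2 _ _ _ _ _ area area F g1 g2 mF g10 g20 ig1 ig2 Fg.
by under eq_fun do rewrite inner1.
Qed.
End Swap.

(** A Gaussian factor makes the double integrand integrable, so Fubini gives measurability of the
    product; the Gaussian is then divided out. *)
Lemma cmeas_fourier h (s : R) : decaying h -> cmeas2 (fun k => fourier h (s *: k)).
Proof.
move=> nh; have := cmeas_mul_fourier s (decaying_chirp_weight 0 0 ltr01) nh.
have m : cmeas2 (fun k => (expR (sqnorm k))%:C).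
  by apply: cmeas_real; apply: measurableT_comp => //; exact: measurable_sqnorm.
move=> /(cmeasM m); congr cmeas; apply/funext => k.
rewrite mulrA /chirp_weight mul1r mul0r /dotp/= !mulr0 !addr0 expi0 mulr1 -realCM.
by rewrite -expRD subrr expR0 mul1r.
Qed.

Lemma fourier_chirp_weight (delta a s : R) p z : 0 < delta ->
  fourier (chirp_weight delta a p) (s *: z) = gauss_ft delta a (sqnorm (p - s *: z)).
Proof.
move=> d0; rewrite -gauss2D//; apply: eq_cI => k.
rewrite /chirp_weight -mulrA -expiD; congr (_ * expi _).
by rewrite /dotp/= /GRing.scale/=; ring.
Qed.

Lemma fourier_regularized (delta a s : R) h p : 0 < delta -> decaying h ->
  cint (fun k => chirp_weight delta a p k * fourier h (s *: k)) =
  cint (fun z => h z * gauss_ft delta a (sqnorm (p - s *: z))).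
Proof.
move=> d0 nh; rewrite fourier_swap//; last exact: decaying_chirp_weight.
by apply: eq_cI => z; rewrite fourier_chirp_weight.
Qed.

Lemma gauss_ft_cvg {X} (F : set_system X) {FF : Filter F} (u : X -> R) (a S : R) :
  a != 0 -> u @ F --> (0 : R) ->
  ccvg F (fun t => gauss_ft (u t) a S) (gauss_ft 0 a S).
Proof.
move=> a0 u0.
have D0 : 0 ^+ 2 + a ^+ 2 != 0 by rewrite expr0n/= add0r sqrf_eq0.
have uD : (fun t => u t ^+ 2 + a ^+ 2) @ F --> (0 ^+ 2 + a ^+ 2 : R).
  by apply: cvgD; [apply: (cvgM u0 u0)|exact: cvg_cst].
have u4 : (fun t => 4 * (u t ^+ 2 + a ^+ 2)) @ F --> (4 * (0 ^+ 2 + a ^+ 2) : R).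
  by apply: cvgM => //; exact: cvg_cst.
have u4V : (fun t => (4 * (u t ^+ 2 + a ^+ 2))^-1) @ F --> ((4 * (0 ^+ 2 + a ^+
  2))^-1 : R).
  by apply: cvgV => //; rewrite mulf_neq0.
apply: ccvgM.
  apply: ccvgM.
    by apply: ccvg_real; apply: cvgM; [exact: cvg_cst|exact: cvgV].
  by apply: ccvgD; [exact: ccvg_real|exact: ccvg_cst].
apply: ccvgM.
  apply: ccvg_real; apply: (cvg_comp _ expR); last exact: continuous_expR.
  by apply: cvgN; apply: cvgM => //; apply: cvgM => //; exact: cvg_cst.
by apply: ccvg_expi; apply: cvgN; apply: cvgM => //; exact: cvg_cst.
Qed.

(** Uniformity in [delta] down to zero is the point: this is the dominating constant when the
    damping is removed. *)
Lemma cabs_gauss_ft (delta a S : R) : 0 <= delta <= 1 -> a != 0 -> 0 <= S ->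
  cabs (gauss_ft delta a S) <= 2 * (pi / a ^+ 2) * (1 + `|a|).
Proof.
move=> /andP[d0 d1] a0 S0.
have a2 : 0 < a ^+ 2 by rewrite exprn_even_gt0.
have D0 : 0 < delta ^+ 2 + a ^+ 2 by rewrite ltr_wpDl ?sqr_ge0.
rewrite /gauss_ft -mulrA cabsZ.
rewrite (_ : 2 * (pi / a ^+ 2) * (1 + `|a|) = (pi / a ^+ 2) * ((1 + `|a|) * 2));
  last by ring.
apply: ler_pM; rewrite ?cabs_ge0//.
  rewrite ger0_norm ?divr_ge0 ?pi_ge0 ?(ltW D0)//.
  by rewrite ler_wpM2l ?pi_ge0// lef_pV2// lerDr sqr_ge0.
apply: (le_trans (cabsM _ _)); apply: ler_pM; rewrite ?cabs_ge0//.
  apply: (le_trans (cabsD _ _)); rewrite cabs_real ger0_norm// lerD//.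
  by rewrite /cabs !ReImE/= !mul0r !mulr0 subr0 mul1r add0r normr0 add0r.
rewrite cabsZ ger0_norm ?expR_ge0// -[leRHS]mul1r.
apply: ler_pM; rewrite ?expR_ge0 ?cabs_ge0 ?cabs_expi//.
rewrite -expR0 ler_expR oppr_le0 divr_ge0 ?mulr_ge0//.
exact: ltW.
Qed.

(** Dampings indexed by integers, for the sequential convergence theorems; they decrease, so
    monotone convergence applies too. *)
Definition cutoff (n : nat) : R := n.+1%:R^-1.

Lemma cutoff_gt0 n : 0 < cutoff n. Proof. by rewrite invr_gt0. Qed.
Lemma cutoff_le1 n : 0 <= cutoff n <= 1.
Proof. by rewrite ltW ?cutoff_gt0//= invf_le1// ler1n. Qed.

Lemma cutoff_cvg : cutoff @ \oo --> (0 : R).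
Proof. exact: cvg_harmonic. Qed.

Lemma chirp_weight_cvg (a : R) p k :
  ccvg \oo (fun n => chirp_weight (cutoff n) a p k) (expi (a * sqnorm k + dotp k p)).
Proof.
rewrite -[expi _]mul1r; apply: ccvgM; last exact: ccvg_cst.
apply: ccvg_real; rewrite -expR0; apply: (cvg_comp _ expR); last exact: continuous_expR.
rewrite -oppr0; apply: cvgN; rewrite -(mul0r (sqnorm k)).
by apply: cvgM; [exact: cutoff_cvg|exact: cvg_cst].
Qed.

Lemma cmeas_phase (a : R) p : cmeas2 (fun k => expi (a * sqnorm k + dotp k p)).
Proof.
apply: cmeas_expi; apply: measurable_funD.
  by apply: measurable_funM; [exact: measurable_cst|exact: measurable_sqnorm].
by under eq_fun do rewrite dotpC; exact: measurable_dotp.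
Qed.

Lemma regularized_cvg (a : R) p (H : plane R -> R[i]) : cintegrable leb2 H ->
  ccvg \oo (fun n => cint (fun k => chirp_weight (cutoff n) a p k * H k))
    (cint (fun k => expi (a * sqnorm k + dotp k p) * H k)).
Proof.
move=> iH; have mH := cintegrable_meas iH.
apply: (@cI_cvg _ _ _ leb2 _ _ (fun k => 2 * cabs (H k))).
- move=> n; apply: cmeasM => //.
  by have [] := decaying_chirp_weight a p (cutoff_gt0 n).
- by apply: cmeasM => //; exact: cmeas_phase.
- by move=> k; apply: ccvgM; [exact: chirp_weight_cvg|exact: ccvg_cst].
- have := integrableZl measurableT 2 (integrable_cabs iH).
  by under eq_fun do rewrite -EFinM.
- move=> n k; apply: (le_trans (cabsM _ _)); rewrite ler_wpM2r ?cabs_ge0//.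
  by apply: cabs_chirp_weight; exact: ltW (cutoff_gt0 n).
Qed.

(** Both sides of [fourier_regularized] converge as the damping vanishes, and limits are unique. *)
Lemma fourier_chirp (a s : R) h p : a != 0 -> decaying h ->
  cintegrable leb2 (fun k => fourier h (s *: k)) ->
  cint (fun k => expi (a * sqnorm k + dotp k p) * fourier h (s *: k)) =
  cint (fun z => h z * gauss_ft 0 a (sqnorm (p - s *: z))).
Proof.
move=> a0 nh iH.
have := regularized_cvg a p iH.
under eq_fun do rewrite (fourier_regularized _ _ _ (cutoff_gt0 _) nh).
move=> /ccvg_unique; apply.
have [mh _] := nh.
have mS : measurable_fun [set: mplane] (fun z : plane R => sqnorm (p - s *: z)).
  apply: measurable_funD; apply: measurable_funM; (apply: measurable_funB;
    first exact: measurable_cst);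
  by apply: measurable_funM => //; exact: measurable_cst.
have mg (delta : R) : cmeas2 (fun z => gauss_ft delta a (sqnorm (p - s *: z))).
  apply: cmeasM; first exact: cmeas_cst.
  apply: cmeasM.
    apply: cmeas_real; apply: measurableT_comp => //.
    apply: measurableT_comp => //.
    do 2![apply: measurable_funM; last exact: measurable_cst].
    exact: mS.
  apply: cmeas_expi; apply: measurableT_comp => //.
  do 2![apply: measurable_funM; last exact: measurable_cst].
  exact: mS.
pose C := 2 * (pi / a ^+ 2) * (1 + `|a|).
apply: (@cI_cvg _ _ _ leb2 _ _ (fun z => C * cabs (h z))).
- by move=> n; exact: cmeasM.
- exact: cmeasM.
- move=> z; apply: ccvgM; first exact: ccvg_cst.
  by apply: gauss_ft_cvg => //; exact: cutoff_cvg.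
- have := integrableZl measurableT C (integrable_cabs (decaying_integrable nh)).
  by under eq_fun do rewrite -EFinM.
- move=> n z; apply: (le_trans (cabsM _ _)); rewrite mulrC ler_wpM2r ?cabs_ge0//.
  by apply: cabs_gauss_ft => //; [exact: cutoff_le1|exact: sqnorm_ge0].
Qed.

Lemma gauss_ft0E (a S : R) : a != 0 ->
  gauss_ft 0 a S = 'i * (pi / a)%:C * expi (- (S / (4 * a))).
Proof.
move=> a0; rewrite /gauss_ft (_ : 0 ^+ 2 + a ^+ 2 = a ^+ 2); last by ring.
rewrite mulr0 mul0r oppr0 expR0 mul1r; congr (_ * _).
  by apply: complex_eqP; rewrite !ReImE/=; field.
by congr (expi (- _)); field.
Qed.

End Inversion.

(** * Bessel's inequality and integrability of Fourier transforms *)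

Section Bessel.
Context {R : realType}.
Notation leb := (@lebesgue_measure R).
Notation leb2 := (leb \x leb)%E.
Notation area := (@area R).
Notation mplane := (measurableTypeR R * measurableTypeR R)%type.
Notation cmeas2 := (@cmeas R _ mplane).
Implicit Types (f g h : plane R -> R[i]) (x k p q z : plane R) (b : bool).

Lemma gauss_mass (c : R) q : 0 < c ->
  leb2.-integrable setT (EFin \o (fun x => expR (- (c * sqnorm (x - q))))) /\
  Rintegral leb2 setT (fun x => expR (- (c * sqnorm (x - q)))) = pi / c.
Proof.
move=> c0.
have [i1 I1] := integral_gauss_shift q.1 c0.
have [i2 I2] := integral_gauss_shift q.2 c0.
pose g1 (t : R) := expR (- (c * (t - q.1) ^+ 2)).
pose g2 (t : R) := expR (- (c * (t - q.2) ^+ 2)).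
have g10 t : 0 <= g1 t by exact: expR_ge0.
have g20 t : 0 <= g2 t by exact: expR_ge0.
have e x : expR (- (c * sqnorm (x - q))) = g1 x.1 * g2 x.2.
  by rewrite /g1 /g2 -expRD; congr expR; rewrite /sqnorm/dotp/=; ring.
have it := @integrable_tensor _ _ _ _ _ leb leb g1 g2 g10 g20 i1 i2.
have {}it : leb2.-integrable setT (EFin \o (fun x => expR (- (c * sqnorm (x - q))))).
  by under eq_fun do rewrite e.
split=> //.
have mg1 : measurable_fun [set: measurableTypeR R] g1 by move: i1 =>
  /measurable_int/measurable_EFinP.
have mg2 : measurable_fun [set: measurableTypeR R] g2 by move: i2 =>
  /measurable_int/measurable_EFinP.
(* The real product is viewed as a complex one so that [cI_prod1] splits the integral. *)
have mF : cmeas2 (fun x => (g1 x.1)%:C * (g2 x.2)%:C).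
  apply: cmeasM; apply: cmeas_real.
    exact: (measurableT_comp mg1 measurable_fst).
  exact: (measurableT_comp mg2 measurable_snd).
have Fg (s t : R) : cabs ((g1 s)%:C * (g2 t)%:C) <= g1 s * g2 t.
  by rewrite -realCM cabs_real ger0_norm ?mulr_ge0.
have r u : (forall t : R, 0 <= u t) -> leb.-integrable setT (EFin \o u) ->
   cI leb (fun t => (u t)%:C) = (Rintegral leb setT u)%:C.
  by move=> _ iu; apply: complex_eqP => //=; rewrite Rintegral_cst// mul0r.
have cr u : leb.-integrable setT (EFin \o u) -> cintegrable leb (fun t => (u t)%:C).
  by move=> iu; split=> //; exact: integrable0.
have := @cI_prod1 _ _ _ _ _ leb leb _ g1 g2 mF g10 g20 i1 i2 Fg => /=.
have -> : (fun x : R => cI leb (fun y : R => (g1 x)%:C * (g2 y)%:C)) =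
  (fun x : R => (Num.sqrt (pi / c))%:C * (g1 x)%:C).
  by apply/funext => t; rewrite (cIZ _ (cr _ i2)) (r _ g20 i2) I2 mulrC.
rewrite (cIZ _ (cr _ i1)) (r _ g10 i1) I1 -realCM -expr2 sqr_sqrtr;
  last by rewrite divr_ge0 ?pi_ge0 ?ltW.
move=> /(congr1 (@complex.Re _)) /= <-.
by apply: eq_Rintegral => x _; rewrite e !mul0r subr0.
Qed.

Lemma gauss_ft_real (delta S : R) : 0 < delta ->
  gauss_ft delta 0 S = (pi / delta * expR (- (S / (4 * delta))))%:C.
Proof.
move=> d0; have dn0 : delta != 0 by rewrite gt_eqF.
rewrite /gauss_ft (_ : delta ^+ 2 + 0 ^+ 2 = delta ^+ 2); last by ring.
rewrite (_ : - (S * 0 / (4 * delta ^+ 2)) = 0) ?expi0 ?mulr1; last by ring.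
rewrite (_ : S * delta / (4 * delta ^+ 2) = S / (4 * delta)); last by field.
by apply: complex_eqP; rewrite !ReImE/=; field.
Qed.

Lemma sqnormB_scale (s : R) p x : s != 0 ->
  sqnorm (p - s *: x) = s ^+ 2 * sqnorm (x - s^-1 *: p).
Proof.
by move=> s0; rewrite /sqnorm/dotp/= /GRing.scale/=; field.
Qed.

(** Without a chirp the kernel is a positive heat kernel whose mass does not depend on [delta]. This
    is used for Bessel's inequality and again as an approximate identity for Fourier inversion. *)
Lemma gauss_ft_mass (delta s : R) p : 0 < delta -> s != 0 ->
  let u x := pi / delta * expR (- (sqnorm (p - s *: x) / (4 * delta))) in
  leb2.-integrable setT (EFin \o u) /\ Rintegral leb2 setT u = (2 * pi / s) ^+ 2.
Proof.
move=> d0 s0 u; pose c := s ^+ 2 / (4 * delta).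
have c0 : 0 < c by apply: divr_gt0; [rewrite exprn_even_gt0|rewrite mulr_gt0].
have [i1 I1] := gauss_mass (s^-1 *: p) c0.
have e : u = (fun x => pi / delta * expR (- (c * sqnorm (x - s^-1 *: p)))).
  by apply/funext => x; rewrite /u /c sqnormB_scale//; congr (_ * expR (- _));
    exact: mulrAC.
rewrite e; split.
  have := integrableZl measurableT (pi / delta) i1.
  by under eq_fun do rewrite -EFinM.
rewrite RintegralZl// I1 /c; field.
by rewrite s0 gt_eqF.
Qed.

Definition sqabs (w : R[i]) : R := complex.Re w ^+ 2 + complex.Im w ^+ 2.

Lemma sqabs_ge0 w : 0 <= sqabs w. Proof. by rewrite addr_ge0 ?sqr_ge0. Qed.

Lemma sqabsE w : (sqabs w)%:C = w * conjc w.
Proof. by apply: complex_eqP; rewrite !ReImE/= /sqabs; ring. Qed.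

Lemma sqabsM w v : sqabs (w * v) = sqabs w * sqabs v.
Proof. by rewrite /sqabs creM cimM; ring. Qed.

Lemma measurable_sqabs (H : plane R -> R[i]) : cmeas2 H ->
  measurable_fun [set: mplane] (fun k => sqabs (H k)).
Proof.
by move=> [m1 m2]; apply: measurable_funD; exact: measurable_funX.
Qed.

Lemma decaying_conj f : decaying f -> decaying (fun x => conjc (f x)).
Proof.
move=> [mf [C fC]]; split; first exact: cmeas_conj.
by exists C => x; rewrite cabs_conj.
Qed.

Lemma cconjM (w v : R[i]) : conjc (w * v) = conjc w * conjc v.
Proof. by apply: complex_eqP; rewrite !ReImE; ring. Qed.

Lemma fourier_conj f k : decaying f ->
  conjc (fourier f k) = fourier (fun x => conjc (f x)) ((-1) *: k).
Proof.
move=> nf; rewrite /fourier -[LHS](cI_conj (decaying_integrable (decaying_wave k nf))).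
apply: eq_cI => x; rewrite cconjM -expiN dotpZ; congr (_ * expi _).
by ring.
Qed.

Lemma Re_cI_real (H : plane R -> R) : complex.Re (cint (fun k =>
  (H k)%:C)) = Rintegral leb2 setT H.
Proof. by []. Qed.

(** Moving one transform across turns the integral into a pairing of [conjc f] with a heat-kernel
    average of [f]. Its size is at most the bound on [f] times the fixed mass of the kernel times
    the integral of [cabs f], whatever [delta] is. *)
Lemma bessel_regularized f (s : R) : s != 0 -> decaying f ->
  exists M, forall delta : R, 0 < delta ->
   leb2.-integrable setT
     (EFin \o (fun k => expR (- (delta * sqnorm k)) * sqabs (fourier f (s *: k)))) /\
   Rintegral leb2 setT
     (fun k => expR (- (delta * sqnorm k)) * sqabs (fourier f (s *: k))) <= M.
Proof.
move=> s0 nf; have [Cf hCf] := decaying_bounded nf.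
have [Ch hCh] := fourier_bounded nf.
have mH := cmeas_fourier s nf.
have Cf0 : 0 <= Cf by apply: le_trans (hCf 0); exact: cabs_ge0.
pose B := Cf * (2 * pi / s) ^+ 2.
exists (Rintegral leb2 setT (fun z => B * cabs (f z))) => delta d0.
pose g k := chirp_weight delta 0 0 k * fourier f (s *: k).
have ng : decaying g.
  rewrite /g; under eq_fun do rewrite mulrC.
  by apply: (@decayingMl _ _ _ Ch) => //; exact: decaying_chirp_weight.
have e k : (expR (- (delta * sqnorm k)) * sqabs (fourier f (s *: k)))%:C
   = g k * fourier (fun x => conjc (f x)) ((- s) *: k).
  rewrite realCM sqabsE /g mulrA fourier_conj// scalerA mulN1r.
  by rewrite /chirp_weight mul0r /dotp/= !mulr0 !addr0 expi0 mulr1.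
have nc := decaying_conj nf.
have [D hD] := fourier_bounded nc.
have i1 : cintegrable leb2 (fun k =>
  (expR (- (delta * sqnorm k)) * sqabs (fourier f (s *: k)))%:C).
  under eq_fun do rewrite e mulrC.
  apply: decaying_integrable.
  exact: (@decayingMl _ g (fun k => fourier (fun x => conjc (f x)) ((- s) *: k)) D
    (cmeas_fourier (- s) nc) (fun k => hD _) ng).
have [i2 _] := i1; split=> //.
rewrite -Re_cI_real; apply: le_trans (le_trans (Re_cabs _) _); first exact: ler_norm.
rewrite (_ : cint _ = cint (fun z => conjc (f z) * fourier g ((- s) *: z))); last first.
  by rewrite -fourier_swap//; apply: eq_cI => k; rewrite e.
have eg z : fourier g ((- s) *: z) =
   cint (fun x => f x * gauss_ft delta 0 (sqnorm (s *: z - s *: x))).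
  rewrite -fourier_regularized//; apply: eq_cI => k.
  rewrite /g /chirp_weight !mul0r !add0r mulrAC; congr (_ * _).
  rewrite -mulrA -expiD; congr (_ * expi _).
  by rewrite /dotp/= /GRing.scale/=; ring.
have bg z : cabs (fourier g ((- s) *: z)) <= B.
  rewrite eg.
  have [im Im] := gauss_ft_mass (s *: z) d0 s0.
  rewrite /B -Im -RintegralZl//.
  apply: cabs_cI.
  - apply: cmeasM; first by case: nf.
    under eq_fun do rewrite gauss_ft_real//.
    by apply: cmeas_real; move: im => /measurable_int/measurable_EFinP.
  - by have := integrableZl measurableT Cf im; under eq_fun do rewrite -EFinM.
  - move=> x; apply: (le_trans (cabsM _ _)); rewrite gauss_ft_real// cabs_real.
    rewrite ger0_norm ?mulr_ge0 ?expR_ge0 ?pi_ge0 ?invr_ge0 ?(ltW d0)//.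
    by rewrite ler_wpM2r ?mulr_ge0 ?expR_ge0 ?pi_ge0 ?invr_ge0 ?(ltW d0).
apply: cabs_cI.
- by apply: cmeasM; [case: nc|exact: cmeas_fourier].
- have := integrableZl measurableT B (integrable_cabs (decaying_integrable nf)).
  by under eq_fun do rewrite -EFinM.
- move=> z; apply: (le_trans (cabsM _ _)); rewrite cabs_conj mulrC.
  by rewrite ler_wpM2r ?cabs_ge0.
Qed.

(** The damped integrands increase to the full one as the cutoff decreases, so the uniform bound
    survives by monotone convergence. *)
Lemma bessel f (s : R) : s != 0 -> decaying f ->
  leb2.-integrable setT (EFin \o (fun k => sqabs (fourier f (s *: k)))).
Proof.
move=> s0 nf; have [M hM] := bessel_regularized s0 nf.
have mH := measurable_sqabs (cmeas_fourier s nf).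
pose v n k := expR (- (@cutoff R n * sqnorm k)) * sqabs (fourier f (s *: k)).
have v0 n k : 0 <= v n k by rewrite mulr_ge0 ?expR_ge0 ?sqabs_ge0.
have vcvg k : v n k @[n --> \oo] --> sqabs (fourier f (s *: k)).
  rewrite -[X in _ --> X]mul1r; apply: cvgM; last exact: cvg_cst.
  rewrite -expR0; apply: (cvg_comp _ expR); last exact: continuous_expR.
  rewrite -oppr0; apply: cvgN; rewrite -(mul0r (sqnorm k)).
  by apply: cvgM; [exact: cutoff_cvg|exact: cvg_cst].
apply/integrableP; split; first exact/measurable_EFinP.
under eq_integral do rewrite /= ger0_norm ?sqabs_ge0//.
have cv : (\int[leb2]_k (v n k)%:E)%E @[n --> \oo] --> (\int[leb2]_k (sqabs (fourier
  f (s *: k)))%:E)%E.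
  have -> : (fun k => (sqabs (fourier f (s *: k)))%:E) = (fun k => limn (fun n =>
    (v n k)%:E)).
    apply/funext => k; apply/esym/cvg_lim => //.
    by apply: cvg_EFin; [exact: nearW|exact: vcvg].
  apply: cvg_monotone_convergence => //.
  - move=> n; apply/measurable_EFinP.
    have [/measurable_int + _] := hM (@cutoff R n) (cutoff_gt0 n).
    by move=> /measurable_EFinP.
  - by move=> n k _; rewrite lee_fin.
  - move=> k _ m n mn; rewrite lee_fin /v ler_wpM2r ?sqabs_ge0// ler_expR lerN2.
    by rewrite ler_wpM2r ?sqnorm_ge0// /cutoff lef_pV2 ?posrE// ler_nat.
apply: (@le_lt_trans _ _ M%:E); last by rewrite ltry.
rewrite -(cvg_lim _ cv)//; apply: lime_le; first by apply/cvg_ex; eexists; exact: cv.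
apply: nearW => n; have [i h] := hM (@cutoff R n) (cutoff_gt0 n).
have fi : (\int[leb2]_k (v n k)%:E)%E \is a fin_num by exact: integrable_fin_num.
by rewrite -(fineK fi) lee_fin.
Qed.

Lemma integrable_weightV_scale (s : R) : s != 0 ->
  leb2.-integrable setT (EFin \o (fun k => (weight (s *: k))^-1)).
Proof.
(* With this [c] one has [c (1 + t^2) <= 1 + (s t)^2]; one factor for each coordinate gives the
   constant [c^-2]. *)
move=> s0; pose c := Num.min 1 (s ^+ 2).
have c0 : 0 < c by rewrite lt_min ltr01 exprn_even_gt0.
have h (t : R) : c * (1 + t ^+ 2) <= 1 + (s * t) ^+ 2.
  rewrite mulrDr mulr1 lerD ?ge_min ?lexx// exprMn ler_wpM2r ?sqr_ge0//.
  by rewrite ge_min lexx orbT.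
have m (t : R) : continuous (fun r : R => (1 + (s * r) ^+ 2)^-1).
  move=> r; apply: cvgV; first by rewrite gt_eqF// oneDsqr_pos.
  apply: cvgD; first exact: cvg_cst.
  by apply: cvgM; apply: cvgM; rewrite //; exact: cvg_cst.
apply: (@integrable_domR _ _ _ leb2 _ _ _ (integrable_weightV (c^-1 ^+ 2))).
  under eq_fun do rewrite /weight invfM.
  apply: measurable_funM.
    exact: (measurableT_comp (continuous_measurable_fun (m 0)) measurable_fst).
  exact: (measurableT_comp (continuous_measurable_fun (m 0)) measurable_snd).
move=> k; rewrite ger0_norm ?invr_ge0 ?(ltW (weight_gt0 _))//.
rewrite exprVn -invfM lef_pV2 ?posrE ?mulr_gt0 ?exprn_gt0 ?oneDsqr_pos//.
rewrite expr2 mulrACA; apply: ler_pM;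
  rewrite ?mulr_ge0 ?(ltW c0) ?(ltW (oneDsqr_pos _)) ?h//.
Qed.

Lemma fourier_integrable h h1 h2 h12 (s : R) : s != 0 ->
  decaying h -> decaying h1 -> decaying h2 -> decaying h12 ->
  pderiv false h h1 -> pderiv true h h2 -> pderiv true h1 h12 ->
  scont false h1 -> scont true h2 -> scont true h12 ->
  cintegrable leb2 (fun k => fourier h (s *: k)).
Proof.
move=> s0 nh nh1 nh2 nh12 d1 d2 d12 c1 c2 c12.
pose f x := (h x + h1 x) + (h2 x + h12 x).
have nf : decaying f by apply: decayingD; exact: decayingD.
have fE k : sqabs (fourier f k) = weight k * sqabs (fourier h k).
  rewrite /f !fourierD//; try exact: decayingD.
  rewrite (fourier_of_pderiv k d12 nh1 nh12 c12) (fourier_of_pderiv k d1 nh nh1 c1)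
    (fourier_of_pderiv k d2 nh nh2 c2) /=.
  rewrite (_ : _ + _ = (1 + 'i * k.1%:C) * ((1 + 'i * k.2%:C) * fourier h k));
    last by ring.
  rewrite !sqabsM mulrA /weight; congr (_ * _ * _); rewrite /sqabs !ReImE/=; ring.
have i1 := bessel s0 nf.
have i2 := integrable_weightV_scale s0.
have i3 := integrableD measurableT i1 i2.
apply: (@cintegrable_dom _ _ _ leb2 _ _ (cmeas_fourier s nh) i3) => k.
rewrite /= fE; move: (weight_gt0 (s *: k)) (fourier h (s *: k)) => W0 [a b] /=.
rewrite /cabs /sqabs /=; set W := weight (s *: k) in W0 *.
have W1 : W * W^-1 = 1 by rewrite divff// gt_eqF.
have V0 : 0 < W^-1 by rewrite invr_gt0.
rewrite -(real_normK (num_real a)) -(real_normK (num_real b)).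
(* A pointwise arithmetic-geometric inequality in place of Cauchy-Schwarz: the modulus is bounded by
   the sum of the two integrable functions in [i3]. *)
have hh (r : R) : r <= W * r ^+ 2 + W^-1 / 4.
  move: (W^-1) W1 {V0} => V W1.
  have : 0 <= W * (r - V / 2) ^+ 2 by rewrite mulr_ge0 ?sqr_ge0 ?ltW.
  rewrite (_ : W * (r - V / 2) ^+ 2 = W * r ^+ 2 - W * V * r + W * V * V / 4);
    last by field.
  by rewrite W1; lra.
have := hh `|a|; have := hh `|b|; lra.
Qed.

(** The mean value theorem holds for the real and imaginary parts separately, hence the factor 2. *)
Lemma cderive_lipschitz (q q' : R -> R[i]) (M : R) (s t : R) :
  (forall r, cderive q r (q' r)) -> (forall r, cabs (q' r) <= M) ->
  cabs (q s - q t) <= 2 * M * `|s - t|.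
Proof.
move=> dq qM.
have lip (u u' : R -> R) : (forall r, is_derive r (1 : R) u (u' r)) ->
    (forall r, `|u' r| <= M) -> forall x y : R, x <= y -> `|u y - u x| <= M * (y - x).
  move=> du uM x y; rewrite le_eqVlt => /predU1P[->|xy].
    by rewrite !subrr normr0 mulr0.
  have cu : {within `[x, y], continuous u}.
    by apply: continuous_subspaceT => r;
      apply/differentiable_continuous/derivable1_diffP; case: (du r).
  have [r _ ->] := @MVT _ u u' _ _ xy (fun r _ => du r) cu.
  have yx0 : 0 <= y - x by rewrite subr_ge0 ltW.
  by rewrite normrM (ger0_norm yx0); exact: ler_wpM2r.
have lip2 (u u' : R -> R) : (forall r, is_derive r (1 : R) u (u' r)) ->
    (forall r, `|u' r| <= M) -> `|u s - u t| <= M * `|s - t|.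
  move=> du uM; have [st|ts] := leP s t.
    have st0 : 0 <= t - s by rewrite subr_ge0.
    by rewrite distrC [X in _ * X]distrC (ger0_norm st0); exact: (lip u u').
  have st0 : 0 <= s - t by rewrite subr_ge0 ltW.
  by rewrite [X in _ * X](ger0_norm st0); exact: (lip u u' du uM _ _ (ltW ts)).
rewrite /cabs !ReImE -mulrA mulr_natl mulr2n; apply: lerD.
  apply: (lip2 (fun r => complex.Re (q r)) (fun r => complex.Re (q' r))) => r;
    first by case: (dq r).
  by apply: le_trans (qM r); exact: Re_cabs.
apply: (lip2 (fun r => complex.Im (q r)) (fun r => complex.Im (q' r))) => r;
  first by case: (dq r).
by apply: le_trans (qM r); exact: Im_cabs.
Qed.

Lemma pderiv_lipschitz h h1 h2 : pderiv false h h1 -> pderiv true h h2 ->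
  decaying h1 -> decaying h2 -> exists2 L, 0 <= L &
  forall x y : plane R, cabs (h x - h y) <= L * (`|x.1 - y.1| + `|x.2 - y.2|).
Proof.
move=> d1 d2 /decaying_bounded[M1 b1] /decaying_bounded[M2 b2].
have M10 : 0 <= M1 by apply: le_trans (b1 0); exact: cabs_ge0.
have M20 : 0 <= M2 by apply: le_trans (b2 0); exact: cabs_ge0.
exists (2 * M1 + 2 * M2) => [|[x1 x2] [y1 y2]] /=; first by lra.
(* The path from one point to the other goes through the corner [(y1, x2)], one coordinate at a
   time. *)
have e : h (x1, x2) - h (y1, y2) = (h (x1, x2) - h (y1, x2)) + (h (y1, x2) - h (y1,
  y2)).
  by rewrite addrA subrK.
rewrite e; apply: (le_trans (cabsD _ _)).
have l1 := @cderive_lipschitz (fun t => h (t, x2)) (fun t => h1 (t, x2)) M1 x1 y1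
  (fun t => pderiv_slice (0, x2) t d1) (fun t => b1 _).
have l2 := @cderive_lipschitz (fun t => h (y1, t)) (fun t => h2 (y1, t)) M2 x2 y2
  (fun t => pderiv_slice (y1, 0) t d2) (fun t => b2 _).
rewrite /= in l1 l2.
have := normr_ge0 (x1 - y1); have := normr_ge0 (x2 - y2); nra.
Qed.

End Bessel.

(** * Fourier inversion and rapidly decaying functions *)

Section FourierInversion.
Context {R : realType}.
Notation leb := (@lebesgue_measure R).
Notation leb2 := (leb \x leb)%E.
Notation mplane := (measurableTypeR R * measurableTypeR R)%type.
Notation cmeas2 := (@cmeas R _ mplane).
Implicit Types (f g h : plane R -> R[i]) (x k p q z : plane R) (b : bool).

Lemma ccvg_squeeze (u : nat -> R[i]) (l : R[i]) (v : nat -> R) :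
  (forall n, cabs (u n - l) <= v n) -> v @ \oo --> (0 : R) -> ccvg \oo u l.
Proof.
move=> uv v0; split; apply/subr_cvg0; apply: norm_cvg0;
  apply: (squeeze_cvgr _ (cvg_cst 0) v0); apply: nearW => n; rewrite normr_ge0/=;
  apply: le_trans (uv n).
  by rewrite -creN -creD Re_cabs.
by rewrite -cimN -cimD Im_cabs.
Qed.

(** With [r = |t| / sqrt(2 / c)], the bound [r <= 1 + r^2 <= exp(r^2)] trades the linear factor for
    half of the exponent, leaving a Gaussian of known mass. *)
Lemma gauss_first_moment (c : R) (t1 t2 : R) : 0 < c ->
  (`|t1| + `|t2|) * expR (- (c * (t1 ^+ 2 + t2 ^+ 2))) <=
  2 * Num.sqrt (2 / c) * expR (- (c / 2 * (t1 ^+ 2 + t2 ^+ 2))).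
Proof.
move=> c0; set e := Num.sqrt (2 / c).
have e0 : 0 < e by rewrite sqrtr_gt0 divr_gt0.
have e2 : e ^+ 2 = 2 / c by rewrite sqr_sqrtr// divr_ge0// ltW.
have h (t : R) : `|t| <= e * expR (c / 2 * t ^+ 2).
  rewrite -ler_pdivrMl//.
  have -> : c / 2 * t ^+ 2 = (e^-1 * `|t|) ^+ 2.
    rewrite exprMn exprVn e2 (real_normK (num_real t)) invf_div.
    by [].
  apply: le_trans (expR_ge1Dx _).
  move: (e^-1 * `|t|) => r; have := sqr_ge0 (r - 1/2); nra.
have m (s t : R) : expR (c / 2 * s ^+ 2) <= expR (c / 2 * (s ^+ 2 + t ^+ 2)).
  by rewrite ler_expR ler_wpM2l ?lerDl ?sqr_ge0// divr_ge0// ltW.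
have E : expR (- (c / 2 * (t1 ^+ 2 + t2 ^+ 2))) =
  expR (c / 2 * (t1 ^+ 2 + t2 ^+ 2)) * expR (- (c * (t1 ^+ 2 + t2 ^+ 2))).
  by rewrite -expRD; congr expR; field.
rewrite E mulrA; apply: ler_wpM2r; first exact: expR_ge0.
rewrite -mulrA mulr_natl mulr2n; apply: lerD.
  by apply: (le_trans (h t1)); rewrite ler_wpM2l ?(ltW e0).
by apply: (le_trans (h t2)); rewrite ler_wpM2l ?(ltW e0)// addrC m.
Qed.

(** The regularized integral averages [h] against a heat kernel centred at [s^-1 *: p]. By the
    Lipschitz bound the error is a first moment, of order the square root of the damping. *)
Lemma fourier_inversion h (L s : R) p : 0 < s -> decaying h -> 0 <= L ->
  (forall x z, cabs (h x - h z) <= L * (`|x.1 - z.1| + `|x.2 - z.2|)) ->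
  cintegrable leb2 (fun k => fourier h (s *: k)) ->
  cint (fun k => expi (dotp k p) * fourier h (s *: k)) =
  ((2 * pi / s) ^+ 2)%:C * h (s^-1 *: p).
Proof.
have pd (d : R) : 0 < d -> 0 <= pi / d by move=> d0; rewrite divr_ge0 ?pi_ge0// ltW.
move=> s0 nh L0 lip iH; have sn0 : s != 0 by rewrite gt_eqF.
have := regularized_cvg 0 p iH.
under eq_fun do rewrite (fourier_regularized _ _ _ (cutoff_gt0 _) nh).
under [X in ccvg _ _ (cint X)]eq_fun do rewrite mul0r add0r.
move=> /ccvg_unique; apply.
pose q := s^-1 *: p.
pose u n x : R := pi / cutoff n * expR (- (sqnorm (p - s *: x) / (4 * cutoff n))).
pose c n : R := s ^+ 2 / (4 * cutoff n).
have c0 n : 0 < c n by apply: divr_gt0; rewrite ?exprn_gt0 ?mulr_gt0 ?cutoff_gt0.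
have uE n x : u n x = pi / cutoff n * expR (- (c n * sqnorm (x - q))).
  by rewrite /u sqnormB_scale//; congr (_ * expR (- _)); exact: mulrAC.
(* The constant is [L * (pi / delta) * 2] times the mass [pi / (c / 2)] of the widened Gaussian,
   where [c = s^2 / (4 delta)]; the dampings cancel. *)
pose K : R := L * (16 * pi ^+ 2 / s ^+ 2).
have vcvg : (fun n => K * Num.sqrt (8 / s ^+ 2 * cutoff n)) @ \oo --> (0 : R).
  rewrite -(mulr0 K); apply: cvgM; first exact: cvg_cst.
  rewrite -(sqrtr0 R); apply: (cvg_comp _ Num.sqrt); last exact: sqrt_continuous.
  rewrite -(mulr0 (8 / s ^+ 2)); apply: cvgM; [exact: cvg_cst|exact: cutoff_cvg].
apply: (ccvg_squeeze _ vcvg).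
move=> n; have d0 := @cutoff_gt0 R n.
have [iu Iu] := gauss_ft_mass p d0 sn0; rewrite -/(u n) in iu Iu.
have ciu : cintegrable leb2 (fun x => (u n x)%:C) by split=> //; exact: integrable0.
have mu_ : measurable_fun [set: mplane] (u n) by move: iu =>
  /measurable_int/measurable_EFinP.
have Ic : cint (fun x => (u n x)%:C) = ((2 * pi / s) ^+ 2)%:C.
  by apply: complex_eqP; rewrite /= ?Iu// Rintegral_cst// mul0r.
have [Ch hCh] := decaying_bounded nh; have [mh _] := nh.
have i1 : cintegrable leb2 (fun x =>
  h x * (u n x)%:C) by exact: (cintegrableMl mh hCh ciu).
have i2 := cintegrableZ (- h q) ciu.
have e : cint (fun z => h z * gauss_ft (cutoff n) 0 (sqnorm (p - s *: z))) - ((2 * pi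
  / s) ^+ 2)%:C * h q
  = cint (fun x => (h x - h q) * (u n x)%:C).
  rewrite -Ic mulrC -mulNr.
  transitivity (cint (fun x => h x * (u n x)%:C) + cint (fun x => - h q * (u n x)%:C)).
    congr (_ + _); last exact: (esym (cIZ (- h q) ciu)).
    by apply: eq_cI => x; rewrite gauss_ft_real.
  apply: (etrans (esym (cID i1 i2))); apply: eq_cI => x; exact/esym/mulrDl.
rewrite e.
have c20 : 0 < c n / 2 by rewrite divr_gt0.
have [i3 I3] := gauss_mass q c20.
pose B : R := L * (pi / cutoff n) * (2 * Num.sqrt (2 / c n)).
have -> : K * Num.sqrt (8 / s ^+ 2 * cutoff n) =
   Rintegral leb2 setT (fun x => B * expR (- (c n / 2 * sqnorm (x - q)))).
  rewrite RintegralZl// I3 /B.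
  have -> : 2 / c n = 8 / s ^+ 2 * cutoff n by rewrite /c; field; rewrite sn0 gt_eqF.
  by rewrite /K /c; field; rewrite sn0 gt_eqF.
apply: cabs_cI.
- apply: cmeasM; last exact: cmeas_real.
  by apply: cmeasD => //; exact: cmeas_cst.
- have := integrableZl measurableT B i3.
  by under eq_fun do rewrite -EFinM.
move=> x; apply: (le_trans (cabsM _ _)); rewrite cabs_real uE.
have pd0 := pd _ d0.
have u0 : 0 <= pi / cutoff n * expR (- (c n * sqnorm (x - q))).
  exact: mulr_ge0 pd0 (expR_ge0 _).
rewrite (ger0_norm u0).
apply: (le_trans (ler_wpM2r u0 (lip _ _))).
have := @gauss_first_moment (c n) (x.1 - q.1) (x.2 - q.2) (c0 n).
have -> : sqnorm (x - q) = (x.1 - q.1) ^+ 2 + (x.2 - q.2) ^+ 2 by rewrite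
  /sqnorm/dotp -!expr2.
move=> /(ler_wpM2l (mulr_ge0 L0 pd0)); rewrite /B => hh.
apply: le_trans (le_trans _ hh) _; rewrite le_eqVlt; apply/orP; left; apply/eqP; ring.
Qed.
End FourierInversion.

(** * Rapidly decaying functions as members of invariant classes *)

Section Rapid.
Context {R : realType}.
Notation leb := (@lebesgue_measure R).
Notation leb2 := (leb \x leb)%E.
Notation mplane := (measurableTypeR R * measurableTypeR R)%type.
Notation cmeas2 := (@cmeas R _ mplane).
Implicit Types (f g h : plane R -> R[i]) (x k p q z : plane R) (b : bool).
Implicit Types S : set (plane R -> R[i]).

(** A coinductive encoding of rapid decay: iterating the closure properties bounds all weighted
    derivatives. To show that an operation preserves rapid decay, it suffices that the image of a
    tame class is tame, without induction over multi-indices. *)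
Record tame S : Prop := Tame {
  tame_bounded : forall f, S f -> exists C, forall x, cabs (f x) <= C;
  tame_coord : forall b f, S f -> S (fun x => (coord b x)%:C * f x);
  tame_pderiv : forall b f, S f -> exists2 f', S f' & pderiv b f f';
  tameD : forall f g, S f -> S g -> S (fun x => f x + g x);
  tameZ : forall c f, S f -> S (fun x => c * f x) }.

Lemma tame_scont S f b : tame S -> S f -> scont b f.
Proof. by move=> tS Sf; have [f' _ /pderiv_scont] := tame_pderiv tS b Sf. Qed.

Lemma tame_decaying S f : tame S -> S f -> decaying f.
Proof.
move=> tS Sf; split; first by apply: scont_cmeas; exact: tame_scont tS Sf.
(* [S1] concerns [(1 + x1^2) f], and [S2] concerns [(1 + x1^2) (1 + x2^2) f], which is [weight]
   times [f]. *)
have S1 := tameD tS Sf (tame_coord tS false (tame_coord tS false Sf)).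
have S2 := tameD tS S1 (tame_coord tS true (tame_coord tS true S1)).
have [C hC] := tame_bounded tS S2.
exists C => x; rewrite ler_pdivlMr ?weight_gt0// mulrC.
apply: le_trans (hC x); rewrite -[X in X * _](ger0_norm (ltW (weight_gt0 x))) -cabsZ.
rewrite le_eqVlt; apply/orP; left; apply/eqP; congr cabs.
by rewrite /weight /= !(realCM, rmorphD)/= rmorph1 !rmorphXn/=; ring.
Qed.

Definition rapid f := exists2 S, tame S & S f.

Lemma rapid_decaying f : rapid f -> decaying f.
Proof. by move=> [S tS Sf]; exact: tame_decaying tS Sf. Qed.

Lemma rapid_scont b f : rapid f -> scont b f.
Proof. by move=> [S tS Sf]; exact: tame_scont tS Sf. Qed.

Lemma rapid_pderiv b f : rapid f -> exists2 f', rapid f' & pderiv b f f'.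
Proof.
by move=> [S tS Sf]; have [f' Sf' df] := tame_pderiv tS b Sf; exists f' => //; exists S.
Qed.

Lemma rapidZ c f : rapid f -> rapid (fun x => c * f x).
Proof. by move=> [S tS Sf]; exists S => //; exact: tameZ. Qed.

Definition chirp (beta : R) x : R[i] := expi (beta * sqnorm x).

Lemma pderiv_chirp b beta :
  pderiv b (chirp beta) (fun x => 'i * (2 * beta)%:C * (coord b x)%:C * chirp beta x).
Proof.
move=> x.
have e t : sqnorm (setc b x t) = coord (~~ b) x ^+ 2 + 1 * t ^+ 2.
  by rewrite /sqnorm dotp_setc; case: b => /=; ring.
rewrite /chirp; under eq_fun do rewrite e.
rewrite -[in sqnorm x](setc_coord b x) e.
apply: (cderive_eq (cderive_expi (is_derive1Z beta (is_derive1D (is_derive1_cst _ _)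
  (is_derive_sqr 1 _))))).
by congr (_ * _); apply: complex_eqP; rewrite !ReImE/=; ring.
Qed.

Lemma cabs_chirp beta x : cabs (chirp beta x) <= 2.
Proof. exact: cabs_expi. Qed.

Lemma cmeas_chirp beta : cmeas2 (chirp beta).
Proof.
apply: cmeas_expi; apply: measurable_funM;
  [exact: measurable_cst|exact: measurable_sqnorm].
Qed.

(** Differentiating the chirp only brings down a coordinate factor, which the class absorbs. *)
Lemma rapid_chirp beta f : rapid f -> rapid (fun x => chirp beta x * f x).
Proof.
move=> [S tS Sf]; exists [set F | exists2 g, S g & F = (fun x =>
  chirp beta x * g x)]; last first.
  by exists f.
split.
- move=> _ [g Sg ->]; have [C hC] := tame_bounded tS Sg; exists (2 * C) => x.
  by apply: (le_trans (cabsM _ _)); apply: ler_pM; rewrite ?cabs_ge0 ?cabs_chirp.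
- move=> b _ [g Sg ->]; exists (fun x => (coord b x)%:C * g x); first exact: tame_coord.
  by apply/funext => x; rewrite mulrCA.
- move=> b _ [g Sg ->]; have [g' Sg' dg] := tame_pderiv tS b Sg.
  exists (fun x => chirp beta x * (('i * (2 * beta)%:C) * ((coord b x)%:C * g x) + g'
    x)).
    exists (fun x => ('i * (2 * beta)%:C) * ((coord b x)%:C * g x) + g' x) => //.
    by apply: tameD => //; apply: tameZ => //; exact: tame_coord.
  apply: (pderiv_eq (pderivM (pderiv_chirp b beta) dg)) => x.
  by move: (chirp beta x) => ?; ring.
- move=> _ _ [f1 Sf1 ->] [f2 Sf2 ->]; exists (fun x => f1 x + f2 x); first exact: tameD.
  by apply/funext => x; rewrite mulrDr.
- move=> c _ [g Sg ->]; exists (fun x => c * g x); first exact: tameZ.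
  by apply/funext => x; rewrite mulrCA.
Qed.

(** The transform exchanges multiplication by coordinates with differentiation, so these two closure
    properties swap roles. *)
Lemma rapid_fourier f : rapid f -> rapid (fourier f).
Proof.
move=> [S tS Sf]; exists [set F | exists2 g, S g & F = fourier g]; last by exists f.
have nS g : S g -> decaying g by exact: tame_decaying.
split.
- by move=> _ [g Sg ->]; apply: fourier_bounded; exact: nS.
- move=> b _ [g Sg ->]; have [g' Sg' dg] := tame_pderiv tS b Sg.
  exists (fun x => - 'i * g' x); first exact: tameZ.
  apply/funext => k; rewrite fourierZ ?(fourier_of_pderiv k dg)//; try exact: nS.
    by apply: complex_eqP; rewrite !ReImE/=; ring.
  exact: tame_scont tS Sg'.
- move=> b _ [g Sg ->]; exists (fourier (fun x => - 'i * ((coord b x)%:C * g x))).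
    by exists (fun x => - 'i * ((coord b x)%:C * g x)) => //; apply: tameZ => //;
      exact: tame_coord.
  apply: fourier_pderiv; first exact: nS.
  by have [] := nS _ (tame_coord tS b Sg).
- move=> _ _ [f1 Sf1 ->] [f2 Sf2 ->]; exists (fun x => f1 x + f2 x); first exact: tameD.
  by apply/funext => k; rewrite fourierD//; exact: nS.
- move=> c _ [g Sg ->]; exists (fun x => c * g x); first exact: tameZ.
  by apply/funext => k; rewrite fourierZ//; exact: nS.
Qed.

Lemma rapid_scale (s : R) f : s != 0 -> rapid f -> rapid (fun x => f (s *: x)).
Proof.
move=> s0 [S tS Sf]; exists [set F | exists2 g, S g & F = (fun x => g (s *: x))];
  last by exists f.
have cs b x : coord b (s *: x) = s * coord b x by case: b.
split.
- by move=> _ [g Sg ->]; have [C hC] := tame_bounded tS Sg; exists C.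
- move=> b _ [g Sg ->]; exists (fun x => (s^-1)%:C * ((coord b x)%:C * g x)).
    by apply: tameZ => //; exact: tame_coord.
  by apply/funext => x; rewrite cs mulrA -realCM mulKf.
- move=> b _ [g Sg ->]; have [g' Sg' dg] := tame_pderiv tS b Sg.
  exists (fun x => s%:C * g' (s *: x)).
    by exists (fun x => s%:C * g' x) => //; exact: tameZ.
  move=> x.
  have e t : s *: setc b x t = setc b (s *: x) (s * t) by rewrite /setc; case: (b).
  under eq_fun do rewrite e.
  by apply: (@cderive_scale _ (fun t => g (setc b (s *: x) t))); rewrite -cs; exact: dg.
- move=> _ _ [f1 Sf1 ->] [f2 Sf2 ->]; exists (fun x => f1 x + f2 x) => //; exact: tameD.
- move=> c _ [g Sg ->]; exists (fun x => c * g x) => //; exact: tameZ.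
Qed.

(** Both derivatives are limits of the same difference quotient; this converts the directional
    derivatives in [smooth] into derivatives along coordinate lines. *)
Lemma is_derive_slice (w : plane R -> R) b x : derivable w x (dir b) ->
  is_derive (coord b x) (1 : R) (fun t : R => w (setc b x t)) ('D_(dir b) w x).
Proof.
move=> dw.
have e (t : R) : setc b x (t *: (1 : R) + coord b x) = t *: (dir b : plane R) + x.
  case: b x {dw} => -[x1 x2].
    by change ((x1, t * 1 + x2) = (t * 0 + x1, t * 1 + x2)); rewrite mulr0 add0r.
  by change ((t * 1 + x1, x2) = (t * 1 + x1, t * 0 + x2)); rewrite mulr0 add0r.
have E : (fun r : R => r^-1 *: (((fun t =>
  w (setc b x t)) \o shift (coord b x)) (r *: (1 : R))
      - (fun t => w (setc b x t)) (coord b x))) =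
    (fun r : R => r^-1 *: ((w \o shift x) (r *: (dir b : plane R)) - w x)).
  by apply/funext => t /=; rewrite e setc_coord.
by split; [rewrite /derivable E|rewrite /derive E].
Qed.

Lemma is_derive1X (n : nat) (t : R) : is_derive t (1 : R) (fun r : R =>
  r ^+ n) (n%:R * t ^+ n.-1).
Proof.
elim: n => [|n IH].
  by under eq_fun do rewrite expr0; rewrite mul0r; exact: is_derive1_cst.
under eq_fun do rewrite exprS.
apply: (is_derive_eq (is_derive1M (is_derive1_id t) IH)).
rewrite mul1r -natr1 mulrDl mul1r addrC; congr (_ + _).
by case: n {IH} => [|n]; rewrite ?mul0r ?mulr0//= mulrCA -exprS.
Qed.

Section Schwartz.
Variables u v : plane R -> R.
Hypotheses (su : schwartz u) (sv : schwartz v).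

Let cpart (s : seq bool) x : R[i] := partial s u x +i* partial s v x.
Let mono (m n : nat) x : R[i] := (x.1 ^+ m * x.2 ^+ n)%:C.

Let pderiv_cpart b s : pderiv b (cpart s) (cpart (b :: s)).
Proof.
move=> x; have [_ du] := su.1 s; have [_ dv] := sv.1 s.
by split; [exact: is_derive_slice (du b x)|exact: is_derive_slice (dv b x)].
Qed.

(** The span of all monomials times partial derivatives; Leibniz' rule keeps it stable under
    differentiation, and the Schwartz bounds control each generator. *)
Inductive schwartz_span : (plane R -> R[i]) -> Prop :=
| span_base m n s : schwartz_span (fun x => mono m n x * cpart s x)
| span_add f g : schwartz_span f -> schwartz_span g ->
  schwartz_span (fun x => f x + g x)
| span_scale c f : schwartz_span f -> schwartz_span (fun x => c * f x).

Let span_eq f g : schwartz_span f -> f =1 g -> schwartz_span g.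
Proof. by move=> sf /funext <-. Qed.

(** At exponent zero the predecessor is again zero, but the coefficient vanishes. *)
Let pderiv_mono c m n : pderiv c (mono m n)
  (fun x => if c then n%:R%:C * mono m n.-1 x else m%:R%:C * mono m.-1 n x).
Proof.
move=> x; rewrite /mono; case: c => /=.
  apply: (cderive_eq (cderive_real (is_derive1Z (x.1 ^+ m) (is_derive1X n x.2)))).
  by rewrite -realCM; congr _%:C; rewrite mulrCA.
apply: (cderive_eq (cderive_real (is_derive1M (is_derive1X m x.1) (is_derive1_cst
  (x.2 ^+ n) x.1)))).
by rewrite -realCM; congr _%:C; rewrite mulr0 addr0 mulrA.
Qed.

Lemma tame_schwartz_span : tame schwartz_span.
Proof.
split.
- move=> f; elim=> {f} [m n s|f g _ [C hC] _ [D hD]|c f _ [C hC]].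
  + have [M hM] := su.2 m n s; have [N hN] := sv.2 m n s.
    exists (M + N) => x; rewrite /mono cabsZ /cabs/= mulrDr -!normrM.
    exact: lerD.
  + by exists (C + D) => x; apply: (le_trans (cabsD _ _)); exact: lerD.
  + exists (cabs c * C) => x; apply: (le_trans (cabsM _ _)).
    by rewrite ler_wpM2l ?cabs_ge0.
- move=> c f; elim=> {f} [m n s|f g _ sf _ sg|e f _ sf].
  + case: c.
      apply: (span_eq (span_base m n.+1 s)) => x.
      by rewrite mulrA /mono -realCM/= exprS mulrCA.
    apply: (span_eq (span_base m.+1 n s)) => x.
    by rewrite mulrA /mono -realCM/= exprS mulrA.
  + by apply: (span_eq (span_add sf sg)) => x; rewrite mulrDr.
  + by apply: (span_eq (span_scale e sf)) => x; rewrite mulrCA.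
- move=> c f; elim=> {f} [m n s|f g _ [f' sf' df] _ [g' sg' dg]|e f _ [f' sf' df]].
  + exists (fun x => (if c then n%:R%:C * mono m n.-1 x else m%:R%:C * mono m.-1 n x)
    * cpart s x
        + mono m n x * cpart (c :: s) x); last exact: pderivM.
    apply: span_add; last exact: span_base.
    case: c; under eq_fun do rewrite -mulrA; apply: span_scale; exact: span_base.
  + by exists (fun x => f' x + g' x); [exact: span_add|exact: pderivD].
  + exists (fun x => e * f' x); first exact: span_scale.
    apply: (pderiv_eq (pderivM (pderiv_cst c e) df)) => x.
    by rewrite mul0r add0r.
- exact: span_add.
- exact: span_scale.
Qed.

End Schwartz.

Lemma rapid_cschwartz f : cschwartz f -> rapid f.
Proof.
move=> [su sv]; exists (schwartz_span (fun x => complex.Re (f x)) (fun x =>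
  complex.Im (f x))).
  exact: tame_schwartz_span.
have := @span_base (fun x => complex.Re (f x)) (fun x => complex.Im (f x)) 0 0 [::].
congr schwartz_span; apply/funext => x; rewrite !expr0 mulr1 mul1r/=.
by apply: complex_eqP.
Qed.

End Rapid.

(** * Phase screens *)

Section Multiplier.
Context {R : realType}.
Notation leb := (@lebesgue_measure R).
Notation leb2 := (leb \x leb)%E.
Notation mplane := (measurableTypeR R * measurableTypeR R)%type.
Notation cmeas2 := (@cmeas R _ mplane).
Implicit Types (f g h u : plane R -> R[i]) (x k p q z : plane R) (b : bool).

Definition bounded_cmeas f := cmeas2 f /\ exists C, forall x, cabs (f x) <= C.

(** Exactly the regularity that lets a product with a rapid function meet the hypotheses of
    [fourier_integrable] through Leibniz' rule. *)
Definition multiplier (A : plane R -> R[i]) : Prop := exists A1 A2 A12,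
  [/\ [/\ bounded_cmeas A, bounded_cmeas A1, bounded_cmeas A2 & bounded_cmeas A12],
      pderiv false A A1, pderiv true A A2, pderiv true A1 A12 &
      [/\ scont false A1, scont true A2 & scont true A12]].

Lemma decaying_mult A u : bounded_cmeas A -> rapid u -> decaying (fun x => A x * u x).
Proof. by move=> [mA [C hC]] /rapid_decaying; exact: decayingMl hC. Qed.

Lemma multiplier_fourier A u (s : R) : multiplier A -> rapid u -> s != 0 ->
  cintegrable leb2 (fun k => fourier (fun x => A x * u x) (s *: k)).
Proof.
move=> [A1 [A2 [A12 [[bA bA1 bA2 bA12] d1 d2 d12 [s1 s2 s12]]]]] ru s0.
have [u1 ru1 du1] := rapid_pderiv false ru.
have [u2 ru2 du2] := rapid_pderiv true ru.
have [u12 ru12 du12] := rapid_pderiv true ru1.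
apply: (fourier_integrable s0 _ _ _ _ (pderivM d1 du1) (pderivM d2 du2)
  (pderivD (pderivM d12 du2) (pderivM d2 du12))).
- exact: decaying_mult.
- by apply: decayingD; exact: decaying_mult.
- by apply: decayingD; exact: decaying_mult.
- by apply: decayingD; apply: decayingD; exact: decaying_mult.
- apply: scontD; apply: scontM => //; try exact: rapid_scont.
  exact: pderiv_scont d1.
- apply: scontD; apply: scontM => //; try exact: rapid_scont.
  exact: pderiv_scont d2.
- apply: scontD; apply: scontD; apply: scontM => //; try exact: rapid_scont.
    exact: pderiv_scont d12.
  exact: pderiv_scont d2.
Qed.

(** The transparent screen, which specializes the integrability statement to rapid functions
    themselves. *)
Lemma multiplier1 : multiplier (fun _ => 1).
Proof.
have b (c : R[i]) : bounded_cmeas (fun _ => c).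
  by split; [exact: cmeas_cst|exists (cabs c)].
exists (fun _ => 0), (fun _ => 0), (fun _ => 0); split; try exact: pderiv_cst.
  by split.
by split; exact: scont_cst.
Qed.

Lemma rapid_fourier_integrable u (s : R) : rapid u -> s != 0 ->
  cintegrable leb2 (fun k => fourier u (s *: k)).
Proof.
move=> ru s0; have := multiplier_fourier multiplier1 ru s0.
by under [X in fourier X]eq_fun do rewrite mul1r.
Qed.

(** Interpolation of the first derivative: on [[t, t + 1]] the mean value theorem yields a point
    where it is a difference of two values of [q], and the bound on [q''] carries this back to
    [t]. *)
Lemma derive_bounded (q q' q'' : R -> R) (M0 M2 t : R) :
  (forall r, is_derive r (1 : R) q (q' r)) ->
  (forall r, is_derive r (1 : R) q' (q'' r)) ->
  (forall r, `|q r| <= M0) -> (forall r, `|q'' r| <= M2) ->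
  `|q' t| <= 2 * M0 + M2.
Proof.
move=> dq dq' qM q''M.
have cont (w w' : R -> R) : (forall r, is_derive r (1 : R) w (w' r)) ->
    forall x y : R, {within `[x, y], continuous w}.
  move=> dw x y; apply: continuous_subspaceT => r.
  by apply/differentiable_continuous/derivable1_diffP; case: (dw r).
have tt : t < t + 1 by rewrite ltrDl.
have [r rI e1] := @MVT _ q q' _ _ tt (fun r _ => dq r) (cont _ _ dq _ _).
have q'r : `|q' r| <= 2 * M0.
  move: e1; rewrite addrAC subrr add0r mulr1 => <-.
  by apply: (le_trans (ler_normB _ _)); rewrite mulr_natl mulr2n lerD.
move: rI; rewrite in_itv/= => /andP[tr r1].
have [r' _ e2] := @MVT _ q' q'' _ _ tr (fun r _ => dq' r) (cont _ _ dq' _ _).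
have h : `|q' r - q' t| <= M2.
  rewrite e2 normrM -[leRHS]mulr1; apply: ler_pM => //.
  by rewrite ger0_norm ?subr_ge0 ?ltW// ltrBlDl.
have -> : q' t = q' r - (q' r - q' t) by ring.
by apply: (le_trans (ler_normB _ _)); exact: lerD.
Qed.

Section Phase.
Variables (v : plane R -> R) (M0 M2 tau l : R).
Hypotheses (sv : smooth v) (bv : bounded_by M0 v).
Hypothesis bv2 : forall s : seq bool, size s = 2%N -> bounded_by M2 (partial s v).

Let dv s b x t : is_derive t (1 : R) (fun t => partial s v (setc b x t))
  (partial (b :: s) v (setc b x t)).
Proof.
have := is_derive_slice ((sv s).2 b (setc b x t)); rewrite coord_setc.
by under eq_fun do rewrite setc_setc.
Qed.

Let bv1 b : bounded_by (2 * M0 + M2) (partial [:: b] v).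
Proof.
move=> x; rewrite -[x](setc_coord b).
apply: (derive_bounded _ (dv [::] b x) (dv [:: b] b x)) => r; first exact: bv.
exact: bv2.
Qed.

Let vl s x := partial s v (l *: x).

Let setcZ b x t : l *: setc b x t = setc b (l *: x) (l * t).
Proof. by case: b. Qed.

Let dvl s b x : is_derive (coord b x) (1 : R) (fun t => vl s (setc b x t))
  (l * vl (b :: s) x).
Proof.
rewrite /vl; under eq_fun do rewrite setcZ.
have dl := is_derive1Z l (is_derive1_id (coord b x)).
apply: (is_derive_eq (is_derive1_compose (dv s b (l *: x) (l * coord b x)) dl)).
by rewrite mulr1 -setcZ setc_coord mulrC.
Qed.

Let cont_vl s b x : continuous (fun t : R => vl s (setc b x t)).
Proof.
move=> t; apply/differentiable_continuous/derivable1_diffP.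
have [+ _] := dvl s b (setc b x t); rewrite coord_setc.
by under eq_fun do rewrite setc_setc.
Qed.

Let meas_vl s : measurable_fun [set: mplane] (vl s).
Proof.
apply: measurable_sepcont => t;
  [exact: (@cont_vl s false (0, t))|exact: (@cont_vl s true (t, 0))].
Qed.

Definition phase x : R[i] := expi (tau * v (l *: x)).

Let D b x : R[i] := ('i * (tau * l)%:C) * ((vl [:: b] x)%:C * phase x).

Let D12 x : R[i] := ('i * (tau * l)%:C) *
  ((l * vl [:: true; false] x)%:C * phase x + (vl [:: false] x)%:C * D true x).

Let pd_phase b : pderiv b phase (D b).
Proof.
move=> x; apply: (cderive_eq (cderive_expi (is_derive1Z tau (dvl [::] b x)))).
rewrite setc_coord /D /phase /vl/=; move: (expi _) => e.
by rewrite !realCM; ring.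
Qed.

Let pd_vl s b : pderiv b (fun x => (vl s x)%:C) (fun x => (l * vl (b :: s) x)%:C).
Proof. by move=> x; apply: cderive_real; exact: dvl. Qed.

Let pd_D : pderiv true (D false) D12.
Proof.
apply: (pderiv_eq (pderivM (pderiv_cst true ('i * (tau * l)%:C))
   (pderivM (pd_vl [:: false] true) (pd_phase true)))) => x.
by rewrite mul0r add0r.
Qed.

Let bm_vl s M : bounded_by M (partial s v) -> bounded_cmeas (fun x => (vl s x)%:C).
Proof.
by move=> bM; split; [exact: cmeas_real|exists M => x; rewrite cabs_real; exact: bM].
Qed.

Let bmM f g : bounded_cmeas f -> bounded_cmeas g -> bounded_cmeas (fun x => f x * g x).
Proof.
move=> [mf [C hC]] [mg [E hE]]; split; first exact: cmeasM.
by exists (C * E) => x; apply: (le_trans (cabsM _ _)); apply: ler_pM; rewrite ?cabs_ge0.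
Qed.

Let bmD f g : bounded_cmeas f -> bounded_cmeas g -> bounded_cmeas (fun x => f x + g x).
Proof.
move=> [mf [C hC]] [mg [E hE]]; split; first exact: cmeasD.
by exists (C + E) => x; apply: (le_trans (cabsD _ _)); apply: lerD.
Qed.

Let bmC (c : R[i]) : bounded_cmeas (fun _ => c).
Proof. by split; [exact: cmeas_cst|exists (cabs c)]. Qed.

Let bm_phase : bounded_cmeas phase.
Proof.
split; last by exists 2 => x; exact: cabs_expi.
apply: cmeas_expi; apply: measurable_funM;
  [exact: measurable_cst|exact: (meas_vl [::])].
Qed.

Let bm_D b : bounded_cmeas (D b).
Proof.
by apply: bmM => //; apply: bmM => //; exact: bm_vl (bv1 b).
Qed.

Let sc_vl s b : scont b (fun x => (vl s x)%:C).
Proof. by move=> x; split; [exact: cont_vl|move=> t; exact: cvg_cst]. Qed.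

(** The second-order bound on the medium serves at the mixed word [[:: true; false]] directly, and
    at the pure words through [bv1]. *)
Lemma multiplier_phase : multiplier phase.
Proof.
exists (D false), (D true), D12; split=> //.
- split=> //; apply: bmM => //; apply: bmD.
    apply: bmM => //; split.
      by apply: cmeas_real; apply: measurable_funM => //; exact: measurable_cst.
    exists (`|l| * M2) => x; rewrite cabs_real normrM ler_wpM2l//.
    exact: bv2.
  by apply: bmM => //; exact: bm_vl (bv1 false).
- have s1 b c : scont b (D c).
    apply: scontM; first exact: scont_cst.
    by apply: scontM; [exact: sc_vl|exact: pderiv_scont (pd_phase b)].
  split=> //; apply: scontM; first exact: scont_cst.
  apply: scontD; apply: scontM => //; try exact: sc_vl.
    have := scontM (scont_cst true l%:C) (@sc_vl [:: true; false] true).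
    by under eq_fun do rewrite -realCM.
  exact: pderiv_scont (pd_phase true).
Qed.
End Phase.
End Multiplier.

(** * The image for a fixed realization of the medium *)

Section Pathwise.
Context {R : realType}.
Notation leb := (@lebesgue_measure R).
Notation leb2 := (leb \x leb)%E.
Notation mplane := (measurableTypeR R * measurableTypeR R)%type.
Notation cmeas2 := (@cmeas R _ mplane).
Implicit Types (f g h u : plane R -> R[i]) (x k p q z y : plane R) (b : bool).

(** Amplitude of the backward chirp; the forward kernel [exp(i |x|^2 / (4 a)) / (4 pi i a)] has
    amplitude [- amp a]. *)
Definition amp (a : R) : R[i] := 'i * ((4 * pi * a)^-1)%:C.

Let pi0 : pi != 0 :> R. Proof. by rewrite gt_eqF// pi_gt0. Qed.

Let amp_const (a : R) : a != 0 ->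
  (((2 * pi) ^+ 2)^-1)%:C * ('i * (pi / a)%:C) = amp a.
Proof.
move=> a0; rewrite /amp mulrCA -realCM; congr (_ * _%:C).
by move: (@pi R) pi0 => P P0; field; rewrite a0 P0.
Qed.

Let ampN (a : R) : amp (- a) = - amp a.
Proof.
by rewrite /amp mulrN invrN rmorphN/= mulrN.
Qed.

Lemma inv_fourier_propagated (a : R) h : 0 < a -> decaying h ->
  cintegrable leb2 (fourier h) ->
  inv_fourier (fun k => expi (- (a * sqnorm k)) * fourier h k) =
  (fun x => - amp a * (chirp (4 * a)^-1 x *
     fourier (fun z => chirp (4 * a)^-1 z * h z) ((2 * a)^-1 *: x))).
Proof.
move=> a0 nh ih; apply/funext => x; have an0 : a != 0 by rewrite gt_eqF.
have nc : decaying (fun z => chirp (4 * a)^-1 z * h z).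
  by apply: decayingMl nh; [exact: cmeas_chirp|exact: cabs_chirp].
rewrite /inv_fourier.
have e1 : cint (fun k => expi (dotp k x) * (expi (- (a * sqnorm k)) * fourier h k)) =
  cint (fun k => expi (- a * sqnorm k + dotp k x) * fourier h (1 *: k)).
  by apply: eq_cI => k; rewrite scale1r mulrA -expiD addrC mulNr.
rewrite e1 fourier_chirp ?oppr_eq0//; last first.
  by under eq_fun do rewrite scale1r.
have e2 : cint (fun z => h z * gauss_ft 0 (- a) (sqnorm (x - 1 *: z))) =
   cint (fun z => ('i * (pi / - a)%:C * chirp (4 * a)^-1 x) *
     ((chirp (4 * a)^-1 z * h z) * expi (- dotp ((2 * a)^-1 *: x) z))).
  apply: eq_cI => z; rewrite gauss_ft0E ?oppr_eq0// scale1r.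
  (* The cross term of [|x - z|^2 / (4 a)] is [- x.z / (2 a)], whence the scale of the Fourier
     transform. *)
  have -> : expi (- (sqnorm (x - z) / (4 * - a))) =
     chirp (4 * a)^-1 x * chirp (4 * a)^-1 z * expi (- dotp ((2 * a)^-1 *: x) z).
    rewrite /chirp -!expiD; congr expi.
    by rewrite dotpZ /sqnorm /dotp/=; field.
  by ring.
rewrite e2.
have i3 := decaying_integrable (decaying_wave ((2 * a)^-1 *: x) nc).
rewrite (_ : cint _ = ('i * (pi / - a)%:C * chirp (4 * a)^-1 x) *
   fourier (fun z => chirp (4 * a)^-1 z * h z) ((2 * a)^-1 *: x));
     last exact: (cIZ _ i3).
by rewrite -ampN -amp_const ?oppr_eq0// -!mulrA.
Qed.

(** For positive [delta] the Abel means are computed exactly by [gauss2D], so the oscillatory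
    integral is the limit of an explicit function along right neighbourhoods of zero. *)
Lemma osc_gauss (a : R) p : a != 0 ->
  osc_cint (fun k => expi (a * sqnorm k + dotp k p)) = gauss_ft 0 a (sqnorm p).
Proof.
move=> a0; rewrite /osc_cint.
have id0 : (id : R -> R) @ 0^'+ --> (0 : R) by exact: cvg_at_right_filter cvg_id.
have [c1 c2] := gauss_ft_cvg (sqnorm p) a0 id0.
have e (delta : R) : 0 < delta ->
    damped_cint (fun k => expi (a * sqnorm k + dotp k p)) delta =
    gauss_ft delta a (sqnorm p).
  by move=> d0; rewrite -gauss2D.
set f := (fun k => expi _) in e *.
have nr (F : R[i] -> R) : {near (0 : R)^'+, (fun delta =>
  F (gauss_ft delta a (sqnorm p))) =1
    (fun delta => F (damped_cint f delta))}.
  near=> delta; congr F; apply/esym/e.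
  by near: delta; exact: nbhs_right_gt.
have -> : lim (complex.Re (damped_cint f delta) @[delta --> 0^'+]) =
    complex.Re (gauss_ft 0 a (sqnorm p)).
  by apply/cvg_lim => //; apply: cvg_trans c1; exact: near_eq_cvg (nr (@complex.Re R)).
have -> : lim (complex.Im (damped_cint f delta) @[delta --> 0^'+]) =
    complex.Im (gauss_ft 0 a (sqnorm p)).
  by apply/cvg_lim => //; apply: cvg_trans c2; exact: near_eq_cvg (nr (@complex.Im R)).
by case: (gauss_ft _ _ _).
Unshelve. all: by end_near. Qed.

Lemma decaying_chirp_shift (beta : R) y h : decaying h ->
  decaying (fun z => chirp beta (y - z) * h z).
Proof.
move=> nh; apply: (@decayingMl _ _ _ 2) nh => [|z]; last exact: cabs_chirp.
apply: cmeas_expi; apply: measurable_funM; first exact: measurable_cst.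
by apply: measurable_funD; apply: measurable_funM; apply: measurable_funB => //;
  exact: measurable_cst.
Qed.

Section Imaging.
Variables omega c0 c1 zint zobs eps gamma : R.
Hypotheses (homega : 0 < omega) (hc0 : 0 < c0) (hc1 : 0 < c1)
  (hzint : 0 < zint) (hzobs : zint < zobs).

Let a0 : R := zint * c0 / (2 * omega).
Let a1 : R := (zobs - zint) * c1 / (2 * omega).
Let a : R := a0 + a1.

Let o2 : 0 < 2 * omega. Proof. by rewrite mulr_gt0. Qed.
Let a0_gt0 : 0 < a0. Proof. by rewrite divr_gt0// mulr_gt0. Qed.
Let a1_gt0 : 0 < a1. Proof. by rewrite divr_gt0// mulr_gt0// subr_gt0. Qed.
Let a_gt0 : 0 < a. Proof. exact: addr_gt0. Qed.

Let prop0 k : propagator omega c0 k zint = expi (- (a0 * sqnorm k)).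
Proof. by rewrite /propagator /a0 mulrAC. Qed.
Let prop1 k : propagator omega c1 k (zobs - zint) = expi (- (a1 * sqnorm k)).
Proof. by rewrite /propagator /a1 mulrAC. Qed.

Lemma U_mfE x y : U_mf omega c0 c1 zint zobs x y = - amp a * chirp (4 * a)^-1 (x - y).
Proof.
have an0 : - a != 0 by rewrite oppr_eq0 gt_eqF.
rewrite /U_mf (_ : (fun k => _) = (fun k => expi (- a * sqnorm k + dotp k (x - y)))).
  rewrite osc_gauss// gauss_ft0E// -ampN -amp_const// -!mulrA;
    congr (_ * (_ * (_ * expi _))).
  by field; rewrite gt_eqF.
apply/funext => k; rewrite prop0 prop1 -!expiD; congr expi.
by rewrite /a; ring.
Qed.

Variable Psi : plane R -> R[i].
Hypothesis hPsi : cschwartz Psi.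

Definition incident : plane R -> R[i] :=
  inv_fourier (fun k => propagator omega c0 k zint * fourier Psi k).

Let rPsi : rapid Psi. Proof. exact: rapid_cschwartz. Qed.

Let s0 : (2 * a0)^-1 != 0 :> R.
Proof. by rewrite invr_eq0 mulf_neq0// gt_eqF. Qed.

Lemma incidentE : incident = (fun x => - amp a0 * (chirp (4 * a0)^-1 x *
     fourier (fun z => chirp (4 * a0)^-1 z * Psi z) ((2 * a0)^-1 *: x))).
Proof.
rewrite /incident; under [X in inv_fourier X]eq_fun do rewrite prop0.
apply: inv_fourier_propagated => //; first exact: rapid_decaying.
have := rapid_fourier_integrable rPsi (oner_neq0 R).
by under eq_fun do rewrite scale1r.
Qed.

(** Decay of the derivatives is wanted as well, since Leibniz' rule distributes derivatives between
    the screen and the incident field. *)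
Lemma rapid_incident : rapid incident.
Proof.
rewrite incidentE; apply: rapidZ; apply: rapid_chirp.
by apply: (rapid_scale s0); apply: rapid_fourier; exact: rapid_chirp.
Qed.

(** The conjugate of the forward kernel over the first medium: [amp a0] is purely imaginary, so
    conjugating [- amp a0] gives [amp a0]. *)
Definition image_kernel y z : R[i] := amp a0 * chirp (- (4 * a0)^-1) (y - z).

Let image_kernelE y z : image_kernel y z =
  amp a0 * chirp (- (4 * a0)^-1) y * expi (dotp z ((2 * a0)^-1 *: y)) * chirp (- (4 *
    a0)^-1) z.
Proof.
have e : chirp (- (4 * a0)^-1) (y - z) = chirp (- (4 * a0)^-1) y *
    (expi (dotp z ((2 * a0)^-1 *: y)) * chirp (- (4 * a0)^-1) z).
  rewrite /chirp -!expiD; congr expi.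
  by rewrite dotpC dotpZ /sqnorm /dotp/=; field; rewrite gt_eqF.
by rewrite /image_kernel e; move: (amp a0) => w; ring.
Qed.

Let chirpNK beta z : chirp (- beta) z * chirp beta z = 1.
Proof. by rewrite /chirp -expiD mulNr addNr expi0. Qed.

(** The chirps in [z] of the kernel and of the incident field cancel, leaving the inverse transform
    of [h], a chirp times [Psi]; the remaining chirps in [y] cancel in turn. *)
Lemma image_incident y : cint (fun z => image_kernel y z * incident z) = Psi y.
Proof.
have rh : rapid (fun z => chirp (4 * a0)^-1 z * Psi z) by exact: rapid_chirp.
set h := (fun z => _) in rh.
pose s : R := (2 * a0)^-1.
have an0 : a0 != 0 by rewrite gt_eqF.
have sp : 0 < s by rewrite invr_gt0 mulr_gt0.
have nh := rapid_decaying rh.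
have [h1 rh1 dh1] := rapid_pderiv false rh.
have [h2 rh2 dh2] := rapid_pderiv true rh.
have [L L0 lip] := pderiv_lipschitz dh1 dh2 (rapid_decaying rh1) (rapid_decaying rh2).
have ih := rapid_fourier_integrable rh s0.
have inv := fourier_inversion (s *: y) sp nh L0 lip ih.
have e : cint (fun z => image_kernel y z * incident z) =
  cint (fun z => (- (amp a0 * amp a0) * chirp (- (4 * a0)^-1) y) *
    (expi (dotp z (s *: y)) * fourier h (s *: z))).
  apply: eq_cI => z; rewrite image_kernelE incidentE -/h -/s.
  transitivity ((- (amp a0 * amp a0) * chirp (- (4 * a0)^-1) y) *
    (expi (dotp z (s *: y)) * fourier h (s *: z)) *
    (chirp (- (4 * a0)^-1) z * chirp (4 * a0)^-1 z)); first by ring.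
  by rewrite chirpNK mulr1.
rewrite e.
have ii : cintegrable leb2 (fun z => expi (dotp z (s *: y)) * fourier h (s *: z)).
  apply: (@cintegrableMl _ _ _ leb2 _ _ 2 _ _ ih) => [|x]; last exact: cabs_expi.
  apply: cmeas_expi; under eq_fun do rewrite dotpC; exact: measurable_dotp.
rewrite (_ : cint _ = (- (amp a0 * amp a0) * chirp (- (4 * a0)^-1) y) *
    cint (fun z => expi (dotp z (s *: y)) * fourier h (s *: z)));
      last exact: (cIZ _ ii).
have sy : s^-1 *: (s *: y) = y by rewrite scalerA (mulVf (lt0r_neq0 sp)) scale1r.
rewrite inv sy /h.
have -> : ((2 * pi / s) ^+ 2)%:C = (4 * pi * a0)%:C * (4 * pi * a0)%:C :> R[i].
  by rewrite -realCM /s; congr _%:C; field.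
(* The two amplitudes and the inversion constant combine into [- i^2 = 1]. *)
have an : amp a0 * (4 * pi * a0)%:C = 'i.
  have n4 : 4 * pi * a0 != 0.
    apply: lt0r_neq0; apply: mulr_gt0 (mulr_gt0 _ (pi_gt0 R)) a0_gt0.
    exact: ltr0n.
  by rewrite /amp -(mulrA 'i) -realCM (mulVf n4) mulr1.
transitivity (- ((amp a0 * (4 * pi * a0)%:C) * (amp a0 * (4 * pi * a0)%:C)) *
   (chirp (- (4 * a0)^-1) y * chirp (4 * a0)^-1 y) * Psi y); first by ring.
rewrite chirpNK mulr1 an; apply: complex_eqP; rewrite !ReImE/=; ring.
Qed.

Lemma decaying_image y : decaying (fun z => image_kernel y z * incident z).
Proof.
rewrite /image_kernel; under eq_fun do rewrite -mulrA.
by apply: decayingZ; apply: decaying_chirp_shift; exact: rapid_decaying rapid_incident.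
Qed.

Variable v : plane R -> R.
Let tau := omega * (c0^-1 - c1^-1).
Let A := phase v tau (eps `^ (gamma - 2^-1))^-1.
Hypothesis mA : multiplier A.

Let W x : R[i] := A x * incident x.

Let s1 : (2 * a1)^-1 != 0 :> R.
Proof. by rewrite invr_eq0 mulf_neq0// gt_eqF. Qed.

Let nW : decaying W.
Proof. by have [A1 [A2 [A12 [[bA _ _ _] _ _ _ _]]]] := mA;
  exact: decaying_mult bA rapid_incident. Qed.

Let U_obsE : U_obs omega c0 c1 zint zobs eps gamma v Psi =
  (fun x => - amp a1 * (chirp (4 * a1)^-1 x *
     fourier (fun z => chirp (4 * a1)^-1 z * W z) ((2 * a1)^-1 *: x))).
Proof.
rewrite /U_obs; under [X in inv_fourier X]eq_fun do rewrite prop1.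
apply: (@inv_fourier_propagated a1 W) => //.
have := multiplier_fourier mA rapid_incident (oner_neq0 R).
by under eq_fun do rewrite scale1r.
Qed.

Lemma I_mfE y : I_mf omega c0 c1 zint zobs eps gamma v Psi y =
  cint (fun z => image_kernel y z * (A z * incident z)).
Proof.
pose h z : R[i] := chirp (4 * a1)^-1 z * W z.
have nh : decaying h by apply: decayingMl nW; [exact: cmeas_chirp|exact: cabs_chirp].
pose s : R := (2 * a1)^-1.
(* Net curvature of the chirp in the observed field and the conjugate template. It equals
   [a0 / (4 a a1)], nonzero because [a0 > 0], as [fourier_chirp] asks. *)
pose b : R := (4 * a1)^-1 - (4 * a)^-1.
have an0 : a != 0 by rewrite gt_eqF.
have a1n0 : a1 != 0 by rewrite gt_eqF.
have a0n0 : a0 != 0 by rewrite gt_eqF.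
have bE : b = a0 / (4 * a * a1) by rewrite /b /a; field; rewrite a1n0 -/a an0.
have b0 : b != 0.
  rewrite bE; apply: lt0r_neq0; apply: (divr_gt0 a0_gt0).
  by apply: mulr_gt0 (mulr_gt0 _ a_gt0) a1_gt0; exact: ltr0n.
pose p := (2 * a)^-1 *: y.
have ih : cintegrable leb2 (fun k => fourier h (s *: k)).
  have := multiplier_fourier mA (rapid_chirp (4 * a1)^-1 rapid_incident) s1.
  rewrite (_ : (fun x => A x * _) = h)//.
  by apply/funext => x; rewrite /h /W mulrCA.
have fc := fourier_chirp p b0 nh ih.
have e1 : I_mf omega c0 c1 zint zobs eps gamma v Psi y =
  cint (fun x => (amp a1 * amp a * - 1 * chirp (- (4 * a)^-1) y) *
    (expi (b * sqnorm x + dotp x p) * fourier h (s *: x))).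
  apply: eq_cI => x; rewrite U_obsE U_mfE -/h -/s.
  have cj : conjc (- amp a * chirp (4 * a)^-1 (x - y)) = amp a * chirp (- (4 * a)^-1)
    (x - y).
    have -> : chirp (- (4 * a)^-1) (x - y) = conjc (chirp (4 * a)^-1 (x - y)).
      by rewrite /chirp -expiN mulNr.
    by apply: complex_eqP; rewrite /amp !ReImE/=; ring.
  transitivity (- amp a1 * (chirp (4 * a1)^-1 x * fourier h (s *: x)) *
      (amp a * chirp (- (4 * a)^-1) (x - y))); first by congr (_ * _); exact: cj.
  have -> : expi (b * sqnorm x + dotp x p) = chirp (4 * a1)^-1 x *
      (chirp (- (4 * a)^-1) (x - y) * chirp (4 * a)^-1 y).
    rewrite /chirp -!expiD; congr expi; rewrite /b /p dotpC dotpZ /sqnorm /dotp/=.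
    by field; rewrite an0 a1n0.
  transitivity (amp a1 * amp a * - 1 * (chirp (- (4 * a)^-1) y * chirp (4 * a)^-1 y) *
     (chirp (4 * a1)^-1 x * chirp (- (4 * a)^-1) (x - y) * fourier h (s *: x))).
    by rewrite chirpNK; ring.
  by ring.
rewrite e1.
have ii : cintegrable leb2 (fun x =>
  expi (b * sqnorm x + dotp x p) * fourier h (s *: x)).
  apply: (@cintegrableMl _ _ _ leb2 _ _ 2 _ _ ih) => [|x]; last exact: cabs_expi.
  exact: cmeas_phase.
rewrite (_ : cint _ = (amp a1 * amp a * - 1 * chirp (- (4 * a)^-1) y) *
    cint (fun x => expi (b * sqnorm x + dotp x p) * fourier h (s *: x)));
      last exact: (cIZ _ ii).
rewrite fc.
(* The curvature in [z] is now [1 / (4 a1) - a / (4 a0 a1) = - 1 / (4 a0)]: this is where the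
   propagation through the second medium drops out. *)
have e2 z : h z * gauss_ft 0 b (sqnorm (p - s *: z)) =
   'i * (pi / b)%:C * chirp (4 * a)^-1 y * (chirp (- (4 * a0)^-1) (y - z) * W z).
  rewrite gauss_ft0E// /h.
  have -> : chirp (- (4 * a0)^-1) (y - z) = chirp (- (4 * a)^-1) y *
      (chirp (4 * a1)^-1 z * expi (- (sqnorm (p - s *: z) / (4 * b)))).
    rewrite /chirp -!expiD; congr expi; rewrite bE /p /s /sqnorm /dotp/= /GRing.scale/=.
    by rewrite /a; field; rewrite a0n0 a1n0 -/a an0.
  transitivity ('i * (pi / b)%:C * (chirp (- (4 * a)^-1) y * chirp (4 * a)^-1 y) *
     (chirp (4 * a1)^-1 z * W z * expi (- (sqnorm (p - s *: z) / (4 * b))))).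
    by rewrite chirpNK; ring.
  by ring.
have nk := decaying_chirp_shift (- (4 * a0)^-1) y nW.
have ink := decaying_integrable nk.
have -> : cint (fun z => h z * gauss_ft 0 b (sqnorm (p - s *: z))) =
   'i * (pi / b)%:C * chirp (4 * a)^-1 y *
     cint (fun z => chirp (- (4 * a0)^-1) (y - z) * W z).
  by apply: etrans (cIZ _ ink); apply: eq_cI => z; exact: e2.
have -> : cint (fun z => image_kernel y z * (A z * incident z)) =
   amp a0 * cint (fun z => chirp (- (4 * a0)^-1) (y - z) * W z).
  apply: (etrans _ (cIZ (amp a0) ink)).
  by apply: eq_cI => z; exact/esym/mulrA.
rewrite mulrA; congr (_ * _).
(* Only constants remain: the moduli reduce to [1 / (4 pi a0)], and the phase [- i^3 = i] is that of
   [amp a0]. *)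
transitivity (- (amp a1 * amp a * ('i * (pi / b)%:C)) *
   (chirp (- (4 * a)^-1) y * chirp (4 * a)^-1 y)); first by ring.
rewrite chirpNK mulr1 bE.
have -> : (pi / (a0 / (4 * a * a1)))%:C = (4 * pi * a1)%:C * (4 * pi * a)%:C * ((4 *
  pi * a0)^-1)%:C :> R[i].
  by rewrite -!realCM; congr _%:C; move: (@pi R) pi0 => P P0; field;
    rewrite ?a0n0 ?P0 ?an0 ?a1n0.
have cancel (r : R) : 0 < r -> ((4 * pi * r)^-1)%:C * (4 * pi * r)%:C = 1 :> R[i].
  move=> r0; have n4 : 4 * pi * r != 0.
    by apply: lt0r_neq0; apply: mulr_gt0 (mulr_gt0 _ (pi_gt0 R)) r0; exact: ltr0n.
  by rewrite -realCM (mulVf n4).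
transitivity (- ('i * 'i * 'i) * (((4 * pi * a1)^-1)%:C * (4 * pi * a1)%:C) *
  (((4 * pi * a)^-1)%:C * (4 * pi * a)%:C) * ((4 * pi * a0)^-1)%:C);
    first by rewrite /amp; ring.
rewrite !cancel// !mulr1 /amp; congr (_ * _).
by apply: complex_eqP; rewrite !ReImE/=; ring.
Qed.
End Imaging.
End Pathwise.

(** * Expectation of the image *)

Section NullModification.
Context {R : realType} d (T : measurableType d) (mu : {measure set T -> \bar R}).
Variable N : set T.
Hypotheses (mN : measurable N) (N0 : mu N = 0%E).

Import HBNNSimple.

(** A simple function below [f], cut to zero on [N], lies below [g] and keeps its integral, so the
    suprema compare. *)
Let ge0_le_integral_null (f g : T -> \bar R) :
  (forall x, 0 <= f x)%E -> (forall x, 0 <= g x)%E ->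
  (forall x, ~ N x -> f x = g x) -> (\int[mu]_x f x <= \int[mu]_x g x)%E.
Proof.
move=> f0 g0 fg; rewrite !ge0_integralTE//; apply: ge_ereal_sup => _ [h /= hf <-].
have mC : measurable (~` N) by exact: measurableC.
have e : (proj_nnsfun h mC : T -> R) = h \_ (~` N) by rewrite mrestrict.
apply: le_ereal_sup_tmp.
exists (sintegral mu (proj_nnsfun h mC)); last first.
  rewrite -!integralT_nnsfun le_eqVlt; apply/orP; left; apply/eqP.
  apply: ge0_ae_eq_integral => //.
  - exact/measurable_EFinP.
  - exact/measurable_EFinP.
  - by move=> x _; rewrite lee_fin.
  - by move=> x _; rewrite lee_fin.
  exists N; split=> // x; apply: contra_notP => Nx _.
  by rewrite e /patch mem_set.
exists (proj_nnsfun h mC) => // x; rewrite e /patch.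
by case: ifPn => [|_]; [rewrite inE => Nx; rewrite -fg|exact: g0].
Qed.

(* No measurability is required: the Lebesgue integral of an arbitrary function
   is defined through the simple functions below it. *)
Lemma integral_null_modification (f g : T -> \bar R) :
  (forall x, ~ N x -> f x = g x) -> (\int[mu]_x f x = \int[mu]_x g x)%E.
Proof.
move=> fg.
have eq0 (u v : T -> \bar R) : (forall x, 0 <= u x)%E -> (forall x, 0 <= v x)%E ->
    (forall x, ~ N x -> u x = v x) -> (\int[mu]_x u x = \int[mu]_x v x)%E.
  move=> u0 v0 uv; apply/eqP; rewrite eq_le; apply/andP.
  by split; apply: ge0_le_integral_null => // x /uv.
rewrite integralE [in RHS]integralE; congr (_ - _)%E; apply: eq0 => //.
  by move=> x Nx; rewrite !funeposE fg.
by move=> x Nx; rewrite !funenegE fg.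
Qed.

Lemma cI_null_modification (f g : T -> R[i]) :
  (forall x, ~ N x -> f x = g x) -> cI mu f = cI mu g.
Proof.
move=> fg; apply: complex_eqP; rewrite /= /Rintegral; congr fine;
  by apply: integral_null_modification => x Nx; rewrite fg.
Qed.
End NullModification.

(** * Exchange of expectation and spatial integration *)

Section Expectation.
Context {R : realType} d (T : measurableType d) (P : probability T R).
Notation leb := (@lebesgue_measure R).
Notation area := (@area R).
Notation mplane := (measurableTypeR R * measurableTypeR R)%type.

Lemma cexpectationE (X : T -> R[i]) : cexpectation P X = cI P X.
Proof. by rewrite /cexpectation unlock. Qed.

(** Translation invariance on the cylinders over the origin equates the laws of [V x] and [V 0], and
    each expectation is an integral against such a law. *)
Lemma stationary_expectation (V : plane R -> {RV P >-> R}) (u : R -> R) (M : R) x :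
  stationary P V -> measurable_fun setT u -> (forall r, `|u r| <= M) ->
  Rintegral P setT (fun w => u (V x w)) = Rintegral P setT (fun w => u (V 0 w)).
Proof.
move=> stV mu_ uM; rewrite /Rintegral; congr fine.
have iu y : P.-integrable setT ((EFin \o u) \o V y).
  apply: (@integrable_domR _ _ _ P (fun w => u (V y w)) (fun=> M)) => //.
    exact: measurableT_comp.
  exact: finite_measure_integrable_cst.
rewrite -(@integral_distribution _ _ _ _ _ P (V x) (EFin \o u))//;
  last exact/measurable_EFinP.
rewrite -(@integral_distribution _ _ _ _ _ P (V 0) (EFin \o u))//;
  last exact/measurable_EFinP.
apply: eq_measure_integral => B mB _.
have := stV x [set v | B (v 0)].
rewrite /field_law /= add0r; apply.
by apply: sub_sigma_algebra; exists 0, B.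
Qed.

Section Main.
Variables (V : plane R -> {RV P >-> R}) (tau l : R).
Hypothesis hst : stationary P V.
Variable N : set T.
Hypotheses (mN : measurable N) (N0 : P N = 0%E).
Hypothesis cV : forall w, ~ N w -> continuous (fun x => V x w).

(** Every realization of this modification is continuous, and each [V' x] stays measurable, as
    [measurable_caratheodory2] asks for all outcomes. *)
Let V' (x : plane R) : T -> R := (V x : T -> R) \_ (~` N).

Let mV' x : measurable_fun setT (V' x).
Proof.
apply/(measurable_restrictT _ (measurableC mN)).
exact: measurable_funTS.
Qed.

Let V'E x w : ~ N w -> V' x w = V x w.
Proof. by move=> Nw; rewrite /V' /patch mem_set. Qed.

Let V'0 x w : N w -> V' x w = 0.
Proof. by move=> Nw; rewrite /V' /patch memNset//=; apply. Qed.

Let cont_slice w (c : R -> plane R) : continuous c -> continuous (fun t => V' (c t) w).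
Proof.
move=> cc; have [Nw|Nw] := pselect (N w).
  rewrite (_ : (fun t => _) = (fun=> 0)); first by move=> t; exact: cvg_cst.
  by apply/funext => t; rewrite V'0.
rewrite (_ : (fun t => _) = (fun t => V (c t) w)); last by apply/funext => t;
  rewrite V'E.
move=> t; apply: (@cvg_comp _ _ _ c (fun x => V x w)); first exact: cc.
exact: cV.
Qed.

(** The integrand is dominated by the constant 2, integrable for a probability, times [cabs (G z)].
    After Fubini the inner expectation does not depend on the position. *)
Lemma expectation_phase (G : plane R -> R[i]) : decaying G ->
  cI P (fun w => cint (fun z => expi (tau * V' (l *: z) w) * G z)) =
  char_fun P V tau * cint G.
Proof.
move=> nG; have [mG _] := nG.
have cl : continuous (fun x : plane R => l *: x : plane R) by exact: scaler_continuous.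
pose F (q : T * mplane) := expi (tau * V' (l *: q.2) q.1) * G q.2.
have mF : cmeas F.
  apply: cmeasM; last exact: cmeas_comp mG measurable_snd.
  apply: cmeas_expi; apply: measurable_funM; first exact: measurable_cst.
  apply: (@measurable_caratheodory2 _ _ _ (fun x w => V' (l *: x) w)) => //.
  - move=> w x2; apply: cont_slice => t.
    apply: (@cvg_comp _ _ _ (fun t : R => (t, x2)) (fun x => l *: x)); last exact: cl.
    exact: (@cvg_pair _ _ _ (nbhs t) (nbhs t) (nbhs x2) _ _ _ (fun r : R => r) (fun=>
      x2) cvg_id (cvg_cst x2)).
  - move=> w x1; apply: cont_slice => t.
    apply: (@cvg_comp _ _ _ (fun t : R => (x1, t)) (fun x => l *: x)); last exact: cl.
    exact: (@cvg_pair _ _ _ (nbhs t) (nbhs x1) (nbhs t) _ _ _ (fun=>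
      x1) (fun r : R => r) (cvg_cst x1) cvg_id).
have i1 : P.-integrable setT (EFin \o (fun _ : T => 2 : R)).
  exact: finite_measure_integrable_cst.
have i2 := integrable_cabs (decaying_integrable nG).
have Fg w z : cabs (F (w, z)) <= 2 * cabs (G z).
  by apply: (le_trans (cabsM _ _)); rewrite ler_wpM2r ?cabs_ge0 ?cabs_expi.
have := @cFubini _ _ _ _ _ P area F (fun=> 2) (fun z => cabs (G z)) mF
  (fun=> ler0n _ _) (fun z => cabs_ge0 _) i1 i2 Fg.
rewrite /F /= => E; apply: (etrans E) => {E}.
(* Stationarity concerns [V], so the modification is undone at fixed position before it is
   invoked. *)
have inner z : cI P (fun w => expi (tau * V' (l *: z) w) * G z) = char_fun P V tau *
  G z.
  transitivity (cI P (fun w => G z * expi (tau * V (l *: z) w))).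
    by apply: (cI_null_modification mN N0) => w Nw; rewrite V'E// mulrC.
  have ie : cintegrable P (fun w => expi (tau * V (l *: z) w)).
    apply: (@cintegrable_dom _ _ _ P _ (fun=> 2)) => //; last by move=> w;
      exact: cabs_expi.
    by apply: cmeas_expi; apply: measurable_funM.
  rewrite (cIZ _ ie) mulrC; congr (_ * _); rewrite /char_fun cexpectationE.
  apply: complex_eqP => /=.
    apply: (@stationary_expectation V (fun r => cos (tau * r)) 1) => //.
      apply: measurableT_comp; last exact: measurable_funM.
      by apply: continuous_measurable_fun; exact: continuous_cos.
    by move=> r; rewrite ler_norml cos_geN1 cos_le1.
  apply: (@stationary_expectation V (fun r => sin (tau * r)) 1) => //.
    apply: measurableT_comp; last exact: measurable_funM.
    by apply: continuous_measurable_fun; exact: continuous_sin.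
  by move=> r; rewrite ler_norml sin_geN1 sin_le1.
transitivity (cI area (fun z => char_fun P V tau * G z)).
  by apply: eq_cI => z; exact: inner.
exact: (cIZ _ (decaying_integrable nG)).
Qed.

Lemma expectation_phase_ae (J : T -> R[i]) (G : plane R -> R[i]) : decaying G ->
  (forall w, ~ N w -> J w = cint (fun z => expi (tau * V (l *: z) w) * G z)) ->
  cexpectation P J = char_fun P V tau * cint G.
Proof.
move=> nG JE; rewrite cexpectationE -expectation_phase//.
apply: (cI_null_modification mN N0) => w Nw; rewrite JE//.
by apply: eq_cI => z; rewrite V'E.
Qed.

End Main.
End Expectation.

Unset Implicit Arguments.

Theorem proposition3p1 (R : realType)
  (d : measure_display) (T : measurableType d) (P : probability T R)
  (omega c0 c1 zint zobs eps gamma : R)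
  (homega : 0 < omega) (hc0 : 0 < c0) (hc1 : 0 < c1)
  (hzint : 0 < zint) (hzobs : zint < zobs) (heps : 0 < eps)
  (V : plane R -> {RV P >-> R})
  (hV_mean : mean_zero P V)
  (hV_stationary : stationary P V)
  (hV_isotropic : isotropic P V)
  (hV_bounded : bounded_field P V)
  (hV_mixing : rapidly_mixing P V)
  (hV_smooth : smooth_field P V)
  (hV_second : bounded_second_derivatives P V)
  (Psi : plane R -> R[i]) (hPsi : cschwartz Psi)
  (y : plane R) :
  cexpectation P
    (fun w => I_mf omega c0 c1 zint zobs eps gamma (fun x => V x w) Psi y)
  = char_fun P V (omega * (c0^-1 - c1^-1)) * Psi y.
Proof.
have [M0 bV] := hV_bounded; have [M2 bV2] := hV_second.
(* A single measurable null set collects the exceptional outcomes of the three almost sure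
   properties. *)
have [N [mN N0 sN]] : P.-negligible (~` [set w |
    [/\ bounded_by M0 (fun x => V x w), smooth (fun x => V x w) &
    forall s : seq bool, size s = 2%N -> bounded_by M2 (partial s (fun x => V x w))]]).
  have : {ae P, forall w, [/\ bounded_by M0 (fun x => V x w), smooth (fun x => V x w) &
    forall s : seq bool, size s = 2%N -> bounded_by M2 (partial s (fun x => V x w))]}.
    by apply: filterS3 bV hV_smooth bV2 => w.
  by [].
have good w : ~ N w -> [/\ bounded_by M0 (fun x => V x w), smooth (fun x => V x w) &
    forall s : seq bool, size s = 2%N -> bounded_by M2 (partial s (fun x => V x w))].
  by move=> Nw; apply: contrapT => h; apply: Nw; exact: sN.
pose G z := image_kernel omega c0 zint y z * incident omega c0 zint Psi z.
have nG : decaying G by exact: decaying_image.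
(* Writing [Psi y] as the integral of [G] gives the right-hand side the form produced by
   [expectation_phase_ae]. *)
rewrite -(image_incident homega hc0 hzint hPsi y).
apply: (@expectation_phase_ae R d T P V _ (eps `^ (gamma - 2^-1))^-1 hV_stationary N mN N0 _ _ G nG).
  by move=> w /good[_ sv _]; have [] := sv [::].
move=> w /good[bv sv bv2].
rewrite (I_mfE homega hc0 hc1 hzint hzobs hPsi (multiplier_phase _ _ sv bv bv2)).
by apply: eq_cI => z; rewrite /G /phase mulrCA.
Qed.
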